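(* Let $\vec f\in L^2(I;L^2(\Omega)^d)$ and $\vec u_0\in \vec V^1$. Let $(\vec u,p)$, with $\vec u\in L^2(I;\vec V^1)$, $\partial_t\vec u\in L^2(I;L^2(\Omega)^d)$, $p\in L^2(I;L^2_0(\Omega))$ and $\vec u(0)=\vec u_0$, be the weak solution of the transient Stokes problem, and let $(\vec u_{\tau h},p_{\tau h})\in X^w_\tau(\vec X_h\times M_h)$ be the solution of the fully discrete problem (both problems are given in the context). Then there is a constant $C$ such that for every $\vec\chi\in X^w_\tau(\vec V_h)$ $$\|\vec u-\vec u_{\tau h}\|_{L^2(I\times\Omega)}\le C\Big(\|\vec u-\vec\chi\|_{L^2(I\times\Omega)}+\|\vec u-\pi_\tau\vec u\|_{L^2(I\times\Omega)}+\|\vec u-R_h^S(\vec u,p)\|_{L^2(I\times\Omega)}\Big).$$ The constant $C$ is independent of $h$, $\tau$, $\vec f$, $\vec u_0$, $(\vec u,p)$ and $\vec\chi$.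
   Context: **Domain and function spaces.** $\Omega\subset\mathbb R^d$, $d\in\{2,3\}$, is a bounded polygonal/polyhedral Lipschitz domain, $T>0$, $I=(0,T]$. $(\cdot,\cdot)$ or $(\cdot,\cdot)_\Omega$ is the $L^2(\Omega)$ (or $L^2(\Omega)^d$) inner product and $(\cdot,\cdot)_{J\times\Omega}$ the $L^2(J;L^2(\Omega))$ inner product (also vector-valued) for an interval $J$; $\|\cdot\|_{L^2(I\times\Omega)}=\|\cdot\|_{L^2(I;L^2(\Omega))}$. $L^2_0(\Omega)$ is the space of mean-zero $L^2$ functions. $\vec V^1=\{\vec v\in H^1_0(\Omega)^d:\nabla\cdot\vec v=0\}$, with the $H^1$ norm. **Continuous problem.** For $\vec f\in L^2(I;L^2(\Omega)^d)$, $\vec u_0\in\vec V^1$ there is a unique $(\vec u,p)$ with $\vec u\in L^2(I;\vec V^1)$, $\partial_t\vec u\in L^2(I;L^2(\Omega)^d)$, $p\in L^2(I;L^2_0(\Omega))$, $\vec u(0)=\vec u_0$ and $$(\partial_t\vec u,\vec v)_{I\times\Omega}+(\nabla\vec u,\nabla\vec v)_{I\times\Omega}-(p,\nabla\cdot\vec v)_{I\times\Omega}+(\nabla\cdot\vec u,\xi)_{I\times\Omega}=(\vec f,\vec v)_{I\times\Omega}$$ for all $\vec v\in L^2(I;H^1_0(\Omega)^d)$, $\xi\in L^2(I;L^2_0(\Omega))$. **Space discretization.** $\{\mathcal T_h\}$ is a family of triangulations of $\bar\Omega$ into closed simplices with maximal mesh size $h$. $\vec X_h\subset H^1_0(\Omega)^d$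 and $M_h\subset L^2_0(\Omega)$ are (finite-dimensional) finite element spaces satisfying the uniform inf-sup condition $\sup_{\vec v_h\in\vec X_h}\frac{(q_h,\nabla\cdot\vec v_h)}{\|\nabla\vec v_h\|_{L^2(\Omega)}}\ge\beta\|q_h\|_{L^2(\Omega)}$ for all $q_h\in M_h$, with $\beta>0$ independent of $h$. $\vec V_h=\{\vec v_h\in\vec X_h:(\nabla\cdot\vec v_h,q_h)=0\ \forall q_h\in M_h\}$. **Time discretization.** $0=t_0<t_1<\dots<t_M=T$, $I_m=(t_{m-1},t_m]$, $\tau_m=t_m-t_{m-1}$, $\tau=\max_m\tau_m$, $\tau_{\min}=\min_m\tau_m$, with: (i) $\tau_{\min}\ge c\,\tau^{\gamma}$ for some constants $c,\gamma>0$ independent of $\tau$; (ii) $\kappa^{-1}\le\tau_m/\tau_{m+1}\le\kappa$ for $m=1,\dots,M-1$, with $\kappa>0$ independent of $\tau$; (iii) $\tau\le T/4$. For a Banach space $\mathcal B$ and a fixed integer $w\ge0$, $X_\tau^w(\mathcal B)$ is the space of $v\in L^2(I;\mathcal B)$ whose restriction to each $I_m$ is a polynomial in $t$ of degree at most $w$ with values in $\mathcal B$. For piecewise continuous $\vec v$: $\vec v_m^\pm=\lim_{\varepsilon\to0^+}\vec v(t_m\pm\varepsilon)$, $[\vec v]_m=\vec v_m^+-\vec v_m^-$. **Fully discrete problem.** With $$B((\vec u,p),(\vec v,q))=\sum_{m=1}^M(\partial_t\vec u,\vec v)_{I_m\times\Omega}+(\nabla\vec u,\nabla\vec v)_{I\times\Omega}-(p,\nabla\cdot\vec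 v)_{I\times\Omega}+(\nabla\cdot\vec u,q)_{I\times\Omega}+\sum_{m=2}^M([\vec u]_{m-1},\vec v_{m-1}^+)_\Omega+(\vec u_0^+,\vec v_0^+)_\Omega,$$ $(\vec u_{\tau h},p_{\tau h})\in X_\tau^w(\vec X_h\times M_h)$ is the unique solution of $B((\vec u_{\tau h},p_{\tau h}),(\vec v_{\tau h},q_{\tau h}))=(\vec f,\vec v_{\tau h})_{I\times\Omega}+(\vec u_0,\vec v_{\tau h,0}^+)_\Omega$ for all $(\vec v_{\tau h},q_{\tau h})\in X_\tau^w(\vec X_h\times M_h)$. **Projections.** For $v\in C(\bar I;L^2(\Omega))$ (applied componentwise to vector functions), $\pi_\tau v$ is the function which on each $I_m$ is a polynomial in $t$ of degree at most $w$ with values in $L^2(\Omega)$, with $\pi_\tau v(t_m^-)=v(t_m^-)$ and, if $w>0$, $(\pi_\tau v-v,\phi)_{I_m\times\Omega}=0$ for all $L^2(\Omega)$-valued polynomials $\phi$ of degree at most $w-1$ on $I_m$. For $(\vec w,\varphi)\in H^1_0(\Omega)^d\times L^2(\Omega)$ the Stokes projection $(R_h^S(\vec w,\varphi),R_h^{S,p}(\vec w,\varphi))\in\vec X_h\times M_h$ is defined by $(\nabla(\vec w-R_h^S(\vec w,\varphi)),\nabla\vec v_h)-(\varphi-R_h^{S,p}(\vec w,\varphi),\nabla\cdot\vec v_h)=0$ for all $\vec v_h\in\vec X_h$ and $(\nabla\cdot(\vec w-R_h^S(\vec w,\varphi)),q_h)=0$ for all $q_h\in M_h$; for time-dependent arguments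 it is applied pointwise in time. **Constants.** $C$ may depend on the fixed data such as $\Omega,d,T,w,\beta$ and the time-partition constants $c,\gamma,\kappa$. *)

(* Defs.v *)
From HB Require Import structures.
From mathcomp Require Import all_boot all_order all_algebra.
From mathcomp Require Import all_classical all_reals all_analysis.

Set Implicit Arguments.
Unset Strict Implicit.
Unset Printing Implicit Defensive.

Import Order.TTheory GRing.Theory Num.Theory.
Import numFieldNormedType.Exports.

Local Open Scope classical_set_scope.
Local Open Scope ring_scope.

(** * Lebesgue measure on R^n, with R^n represented by ['rV[R]_n] *)

Definition measure_matrix_display : measure_display -> measure_display.
Proof. exact. Qed.

(* Matrices carry the product sigma-algebra of their entries. *)
Section measurable_matrix.
Context {d} {T : measurableType d} {m n : nat}.

Definition mx_coor_sets : set (set 'M[T]_(m, n)) :=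
  \bigcup_(ij in [set: 'I_m * 'I_n])
    preimage_set_system setT (fun A : 'M[T]_(m, n) => A ij.1 ij.2) measurable.

Let mx_set0 : <<s mx_coor_sets >> set0.
Proof. exact: sigma_algebra0. Qed.

Let mx_setC A : <<s mx_coor_sets >> A -> <<s mx_coor_sets >> (~` A).
Proof. exact: sigma_algebraC. Qed.

Let mx_bigcup (F : (set 'M[T]_(m, n))^nat) :
  (forall i, <<s mx_coor_sets >> (F i)) -> <<s mx_coor_sets >> (\bigcup_i (F i)).
Proof. exact: sigma_algebra_bigcup. Qed.

HB.instance Definition _ := @isMeasurable.Build (measure_matrix_display d)
  'M[T]_(m, n) <<s mx_coor_sets >> mx_set0 mx_setC mx_bigcup.

Lemma measurable_mx_coor (i : 'I_m) (j : 'I_n) :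
  measurable_fun setT (fun A : 'M[T]_(m, n) => A i j).
Proof.
move=> _ Y mY; apply: sub_sigma_algebra => /=.
by exists (i, j) => //; exists Y.
Qed.

Lemma measurable_fun_mx d' (S : measurableType d') (f : S -> 'M[T]_(m, n)) :
  (forall i j, measurable_fun setT (fun x => f x i j)) -> measurable_fun setT f.
Proof.
move=> mf; pose G := [set B | measurable (f @^-1` B)].
have sG : <<s mx_coor_sets >> `<=` G.
  apply: smallest_sub.
    split => [|A GA|F GF]; rewrite /G /=.
    - by rewrite preimage_set0.
    - by rewrite setTD preimage_setC; exact: measurableC.
    - by rewrite preimage_bigcup; exact: bigcupT_measurable.
  move=> B [[i j] _ [A mA <-]]; rewrite /G /= setTI.
  by rewrite -[X in measurable X]setTI; exact: (mf i j).
by move=> _ Y mY; rewrite setTI; exact: sG.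
Qed.

End measurable_matrix.

Section lebesgue_rV.
Context {R : realType}.

Definition cons_rV n (z : measurableTypeR R * 'rV[R]_n) : 'rV[R]_n.+1 :=
  row_mx (const_mx z.1 : 'rV_1) z.2.

Lemma measurable_cons_rV n : measurable_fun setT (@cons_rV n).
Proof.
apply: measurable_fun_mx => i j; rewrite /cons_rV.
have -> : (fun z : measurableTypeR R * 'rV[R]_n =>
    (row_mx (const_mx z.1 : 'rV_1) z.2 : 'rV[R]_n.+1) i j) =
    (fun z => match @fintype.split 1 n j with inl _ => z.1 | inr k => z.2 i k end).
  apply/funext => z; rewrite [LHS]mxE.
  by case: (fintype.split _) => k //; rewrite mxE.
case: (fintype.split _) => k.
  exact: (@measurable_fst _ _ (measurableTypeR R) 'rV[R]_n).
exact: (measurableT_comp (@measurable_mx_coor _ R 1 n i k)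
  (@measurable_snd _ _ (measurableTypeR R) 'rV[R]_n)).
Qed.

Section step.
Context {n : nat} (mu : {sigma_finite_measure set 'rV[R]_n -> \bar R}).

Definition lebesgue_rV_step : set 'rV[R]_n.+1 -> \bar R :=
  pushforward (lebesgue_measure \x mu)%E (@cons_rV n).

Let step0 : lebesgue_rV_step set0 = 0%E.
Proof. by rewrite /lebesgue_rV_step /pushforward preimage_set0 measure0. Qed.

Let step_ge0 A : (0 <= lebesgue_rV_step A)%E.
Proof. by rewrite /lebesgue_rV_step /pushforward; apply: measure_ge0. Qed.

Let mpre A : measurable A -> measurable (@cons_rV n @^-1` A).
Proof.
by move=> mA; rewrite -[X in measurable X]setTI; exact: measurable_cons_rV.
Qed.

Let step_sigma_additive : semi_sigma_additive lebesgue_rV_step.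
Proof.
move=> F mF tF mUF; rewrite /lebesgue_rV_step /pushforward preimage_bigcup.
apply: measure_semi_sigma_additive.
- by move=> k; exact: mpre.
- apply/trivIsetP => /= i j _ _ ij; rewrite -preimage_setI.
  by move/trivIsetP : tF => /(_ _ _ _ _ ij) ->//; rewrite preimage_set0.
- by rewrite -preimage_bigcup; exact: mpre.
Qed.

HB.instance Definition _ := isMeasure.Build _ _ _ lebesgue_rV_step
  step0 step_ge0 step_sigma_additive.

Let step_sigma_finite : sigma_finite setT lebesgue_rV_step.
Proof.
have [F [FT Foo]] : exists F : (set (measurableTypeR R * 'rV[R]_n))^nat,
    [set: measurableTypeR R * 'rV[R]_n] = \bigcup_k F k /\
    forall k, measurable (F k) /\ ((lebesgue_measure \x mu)%E (F k) < +oo)%E.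
  have /sigma_finiteP[A [TA ndA Aoo]] := sigma_finiteT (@lebesgue_measure R).
  have /sigma_finiteP[B [TB ndB Boo]] := sigma_finiteT mu.
  exists (fun k => A k `*` B k); split.
    rewrite -setXTT TA TB predeqE => -[x y]; split.
      move=> [/= [i _ Aix] [k _ Bky]]; exists (maxn i k) => //; split.
      - by move: x Aix; exact/subsetPset/ndA/leq_maxl.
      - by move: y Bky; exact/subsetPset/ndB/leq_maxr.
    by move=> [i _ []/= ? ?]; split; exists i.
  move=> k; have [? ?] := Aoo k; have [? ?] := Boo k.
  split; first exact: measurableX.
  by rewrite product_measure1E// lte_mul_pinfty// ge0_fin_numE.
pose uncons (x : 'rV[R]_n.+1) : measurableTypeR R * 'rV[R]_n :=
  (x 0 0, \row_j x 0 (lift 0 j)).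
have unconsK : cancel uncons (@cons_rV n).
  move=> x; apply/rowP => j; rewrite /cons_rV mxE.
  case: fintype.splitP => k jk; rewrite !mxE.
    by congr (x _ _); apply/val_inj; rewrite /= jk ord1.
  by congr (x _ _); apply/val_inj; rewrite /= jk.
have consK : cancel (@cons_rV n) uncons.
  move=> [a y]; rewrite /uncons /cons_rV; congr pair.
    by rewrite mxE; case: fintype.splitP => k //= _; rewrite mxE.
  apply/rowP => j; rewrite !mxE; case: fintype.splitP => k /= jk.
    by have := ltn_ord k; rewrite -jk.
  by congr (y _ _); apply/val_inj/eqP; rewrite -(eqn_add2l 1) -jk.
have muncons : measurable_fun setT uncons.
  apply/measurable_fun_pairP; split => /=.
    exact: (@measurable_mx_coor _ R 1 n.+1 0 0).
  apply: measurable_fun_mx => i j.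
  rewrite (_ : (fun _ => _) = (fun x : 'rV[R]_n.+1 => x 0 (lift 0 j))); last first.
    by apply/funext => x /=; rewrite mxE.
  exact: measurable_mx_coor.
exists (fun k => uncons @^-1` F k).
  by rewrite -preimage_bigcup -FT preimage_setT.
move=> k; have [mF Fk] := Foo k; split.
  by rewrite -[X in measurable X]setTI; exact: muncons.
rewrite /lebesgue_rV_step /pushforward.
by rewrite (_ : _ @^-1` _ = F k)//; apply/seteqP; split => z /=; rewrite consK.
Qed.

HB.instance Definition _ := Measure_isSigmaFinite.Build _ _ _ lebesgue_rV_step
  step_sigma_finite.

End step.

Fixpoint lebesgue_rV n : {sigma_finite_measure set 'rV[R]_n -> \bar R} :=
  match n with
  | 0 => \d_(0 : 'rV[R]_0)
  | n'.+1 => lebesgue_rV_step (lebesgue_rV n')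
  end.

End lebesgue_rV.

(** * Square integrable functions *)

Section L2.
Context {R : realType}.

(* Frobenius inner product; for row vectors, the Euclidean one *)
Definition frob m n (A B : 'M[R]_(m, n)) : R := \sum_i \sum_j A i j * B i j.

Definition enorm n (x : 'rV[R]_n) : R := Num.sqrt (frob x x).

Definition L2 d (T : measurableType d) (mu : {measure set T -> \bar R})
    (D : set T) (f : T -> R) : Prop :=
  measurable_fun D f /\ mu.-integrable D (fun x => (f x ^+ 2)%:E).

Definition L2mx d (T : measurableType d) (mu : {measure set T -> \bar R})
    (D : set T) m n (f : T -> 'M[R]_(m, n)) : Prop :=
  forall i j, L2 mu D (fun x => f x i j).

Context {d : nat}.

(* Space-time functions are curried, [u t x].  The space L^2(J; L^2(Omega)) is
   identified with L^2(J x Omega). *)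
Definition lebesgue_st :
    {measure set (measurableTypeR R * 'rV[R]_d)%type -> \bar R} :=
  (lebesgue_measure \x lebesgue_rV d)%E.

Definition L2st (J : set R) (Omega : set 'rV[R]_d) (p : R -> 'rV[R]_d -> R) :=
  L2 lebesgue_st (J `*` Omega) (fun z => p z.1 z.2).

Definition L2mxst (J : set R) (Omega : set 'rV[R]_d) m n
    (u : R -> 'rV[R]_d -> 'M[R]_(m, n)) :=
  L2mx lebesgue_st (J `*` Omega) (fun z => u z.1 z.2).

Definition inner (Omega : set 'rV[R]_d) m n (u v : 'rV[R]_d -> 'M[R]_(m, n)) : R :=
  \int[lebesgue_rV d]_(x in Omega) frob (u x) (v x).

Definition sinner (Omega : set 'rV[R]_d) (p q : 'rV[R]_d -> R) : R :=
  \int[lebesgue_rV d]_(x in Omega) (p x * q x).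

Definition inner_st (J : set R) (Omega : set 'rV[R]_d) m n
    (u v : R -> 'rV[R]_d -> 'M[R]_(m, n)) : R :=
  \int[lebesgue_measure]_(t in J) inner Omega (u t) (v t).

Definition sinner_st (J : set R) (Omega : set 'rV[R]_d)
    (p q : R -> 'rV[R]_d -> R) : R :=
  \int[lebesgue_measure]_(t in J) sinner Omega (p t) (q t).

(* Norms are extended-real valued: they are +oo on functions that are not
   square integrable. *)
Definition normL2 (Omega : set 'rV[R]_d) m n (u : 'rV[R]_d -> 'M[R]_(m, n)) :
    \bar R :=
  ((\int[lebesgue_rV d]_(x in Omega) (frob (u x) (u x))%:E) `^ 2^-1)%E.

Definition snormL2 (Omega : set 'rV[R]_d) (p : 'rV[R]_d -> R) : \bar R :=
  ((\int[lebesgue_rV d]_(x in Omega) (p x ^+ 2)%:E) `^ 2^-1)%E.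

Definition normL2_st (J : set R) (Omega : set 'rV[R]_d) m n
    (u : R -> 'rV[R]_d -> 'M[R]_(m, n)) : \bar R :=
  ((\int[lebesgue_measure]_(t in J)
     \int[lebesgue_rV d]_(x in Omega) (frob (u t x) (u t x))%:E) `^ 2^-1)%E.

Definition L20 (Omega : set 'rV[R]_d) (p : 'rV[R]_d -> R) : Prop :=
  L2 (lebesgue_rV d) Omega p /\ \int[lebesgue_rV d]_(x in Omega) p x = 0.

Definition ae_on (Omega : set 'rV[R]_d) (P : 'rV[R]_d -> Prop) : Prop :=
  {ae lebesgue_rV d, forall x, Omega x -> P x}.

(* One-sided limits in L^2(Omega)^d at time s, i.e. v(s^-) and v(s^+); they
   are determined up to equality almost everywhere in Omega. *)
Definition is_L2lim (F : set_system R) (Omega : set 'rV[R]_d)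
    (v : R -> 'rV[R]_d -> 'rV[R]_d) (g : 'rV[R]_d -> 'rV[R]_d) : Prop :=
  L2mx (lebesgue_rV d) Omega g /\
  normL2 Omega (fun x => v t x - g x) @[t --> F] --> 0%E.

Definition lim_left Omega v (s : R) : 'rV[R]_d -> 'rV[R]_d :=
  xget (fun=> 0) [set g | is_L2lim (s^'-) Omega v g].

Definition lim_right Omega v (s : R) : 'rV[R]_d -> 'rV[R]_d :=
  xget (fun=> 0) [set g | is_L2lim (s^'+) Omega v g].

(* v in C([0,T]; L^2(Omega)^d) *)
Definition continuous_L2 (T : R) (Omega : set 'rV[R]_d)
    (v : R -> 'rV[R]_d -> 'rV[R]_d) : Prop :=
  forall s, s \in `[0, T] ->
    is_L2lim (within `[0, T] (nbhs s)) Omega v (v s).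

End L2.

(** * Sobolev spaces *)

Section sobolev.
Context {R : realType}.

(* C^oo: all iterated directional derivatives exist and are continuous. *)
Definition smooth (V : normedModType R) (f : V -> R) : Prop :=
  forall s : seq V, let g := foldr (fun v (h : V -> R) => 'D_v h) f s in
  continuous g /\ forall v x, derivable g x v.

Definition test_function (V : normedModType R) (O : set V) (f : V -> R) : Prop :=
  [/\ smooth f, compact (closure [set x | f x != 0]) &
      closure [set x | f x != 0] `<=` O].

Context {d : nat}.

Definition partial (j : 'I_d) (f : 'rV[R]_d -> R) : 'rV[R]_d -> R :=
  'D_(delta_mx 0 j) f.

Definition grad (v : 'rV[R]_d -> 'rV[R]_d) : 'rV[R]_d -> 'M[R]_d :=
  fun x => \matrix_(i, j) partial j (fun y => v y 0 i) x.

(* A Sobolev vector field w is represented by the pair of the field w.1 and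
   its weak gradient w.2, with entries (w.2 x) i j = d_j (w.1)_i (x). *)
Definition sob : Type :=
  (('rV[R]_d -> 'rV[R]_d) * ('rV[R]_d -> 'M[R]_d))%type.

HB.instance Definition _ := GRing.Lmodule.on sob.

Definition div (w : sob) : 'rV[R]_d -> R := fun x => \tr (w.2 x).

Definition is_weak_grad (Omega : set 'rV[R]_d) (w : sob) : Prop :=
  forall phi, test_function Omega phi -> forall i j,
  \int[lebesgue_rV d]_(x in Omega) (w.1 x 0 i * partial j phi x) =
  - \int[lebesgue_rV d]_(x in Omega) (w.2 x i j * phi x).

Definition H1 (Omega : set 'rV[R]_d) (w : sob) : Prop :=
  [/\ L2mx (lebesgue_rV d) Omega w.1, L2mx (lebesgue_rV d) Omega w.2 &
      is_weak_grad Omega w].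

(* closure of the test functions in H^1 *)
Definition H10 (Omega : set 'rV[R]_d) (w : sob) : Prop :=
  H1 Omega w /\
  forall eps : R, 0 < eps -> exists phi : 'rV[R]_d -> 'rV[R]_d,
    [/\ forall i, test_function Omega (fun x => phi x 0 i),
        (normL2 Omega (fun x => w.1 x - phi x)%R < eps%:E)%E &
        (normL2 Omega (fun x => w.2 x - grad phi x)%R < eps%:E)%E].

(* divergence-free fields of H^1_0 *)
Definition V1 (Omega : set 'rV[R]_d) (w : sob) : Prop :=
  H10 Omega w /\ ae_on Omega (fun x => div w x = 0).

(* L^2(J; S) for a set S of Sobolev fields *)
Definition L2sob (J : set R) (Omega : set 'rV[R]_d) (S : set sob)
    (u : R -> sob) : Prop :=
  [/\ L2mxst J Omega (fun t => (u t).1), L2mxst J Omega (fun t => (u t).2) &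
      {ae lebesgue_measure, forall t, J t -> S (u t)}].

Definition L2L20 (J : set R) (Omega : set 'rV[R]_d)
    (p : R -> 'rV[R]_d -> R) : Prop :=
  L2st J Omega p /\ {ae lebesgue_measure, forall t, J t -> L20 Omega (p t)}.

(* Distributional time derivative on (0,T): the Bochner integrals of eta' u
   and - eta ut agree in L^2(Omega)^d, which is tested against all psi. *)
Definition is_time_derivative (T : R) (Omega : set 'rV[R]_d)
    (u ut : R -> 'rV[R]_d -> 'rV[R]_d) : Prop :=
  forall eta : R -> R, test_function (`]0, T[) eta ->
  forall psi : 'rV[R]_d -> 'rV[R]_d, L2mx (lebesgue_rV d) Omega psi ->
  \int[lebesgue_measure]_(t in `]0, T[) (derive1 eta t * inner Omega (u t) psi) =
  - \int[lebesgue_measure]_(t in `]0, T[) (eta t * inner Omega (ut t) psi).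

End sobolev.
Arguments sob R d : clear implicits.

(** * Polyhedral Lipschitz domains and triangulations *)

Section domains.
Context {R : realType} {d : nat}.
Implicit Type Omega : set 'rV[R]_d.

(* For a unit vector n, the map y |-> y - <y,n> n is the projection on the
   hyperplane orthogonal to n, over which the boundary is a Lipschitz graph. *)
Definition lipschitz_boundary Omega : Prop :=
  forall x, closure Omega x -> ~ Omega x ->
  exists (n : 'rV[R]_d) (r : R) (phi : 'rV[R]_d -> R),
    [/\ enorm n = 1, 0 < r, lipschitz phi &
        forall y, enorm (y - x) < r ->
          (Omega y <-> phi (y - frob y n *: n) < frob y n)].

(* The rows of the matrix V are the d + 1 vertices of a simplex. *)
Definition nondegenerate (V : 'M[R]_(d.+1, d)) : bool :=
  row_free (row_mx (const_mx 1 : 'cV[R]_d.+1) V).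

Definition face (V : 'M[R]_(d.+1, d)) (S : {set 'I_d.+1}) : set 'rV[R]_d :=
  [set x | exists2 l : 'rV[R]_d.+1,
    [/\ forall i, 0 <= l 0 i, \sum_i l 0 i = 1 &
        forall i, i \notin S -> l 0 i = 0] & x = l *m V].

Definition simplex (V : 'M[R]_(d.+1, d)) : set 'rV[R]_d := face V finset.setT.

Definition diam (A : set 'rV[R]_d) : R :=
  sup [set r | exists x y, [/\ A x, A y & r = enorm (x - y)]].

(* The closure of Omega is the union of the closed simplices in Th. *)
Definition simplicial_cover Omega (Th : seq 'M[R]_(d.+1, d)) : Prop :=
  (forall V, V \in Th -> nondegenerate V) /\
  closure Omega = \bigcup_(V in [set V | V \in Th]) simplex V.

Definition polyhedral_lipschitz_domain Omega : Prop :=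
  [/\ open Omega, connected Omega, Omega !=set0 & bounded_set Omega] /\
  (exists Th, simplicial_cover Omega Th) /\ lipschitz_boundary Omega.

(* Distinct simplices meet in a (possibly empty) common proper face. *)
Definition triangulation Omega (Th : seq 'M[R]_(d.+1, d)) (h : R) : Prop :=
  [/\ simplicial_cover Omega Th,
      forall V V', V \in Th -> V' \in Th -> V != V' ->
        exists S S' : {set 'I_d.+1},
          [/\ S != finset.setT, simplex V `&` simplex V' = face V S &
              face V S = face V' S'] &
      h = \big[Num.max/0]_(V <- Th) diam (simplex V)].

End domains.

(** * Continuous and discrete problems *)

Section discretization.
Context {R : realType} {d : nat}.
Implicit Type Omega : set 'rV[R]_d.

(* the time interval I = (0, T] *)
Definition itvT (T : R) : set R := `]0, T].

Definition fin_dim_subspace (E : lmodType R) (S : set E) : Prop :=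
  exists n (b : 'I_n -> E),
    S = [set v | exists c : 'I_n -> R, v = \sum_i c i *: b i].

Definition inf_sup Omega (beta : R) (Xh : set (sob R d))
    (Mh : set ('rV[R]_d -> R)) : Prop :=
  forall q, Mh q ->
  (beta%:E * snormL2 Omega q <=
   ereal_sup [set (sinner Omega q (div v) / fine (normL2 Omega v.2))%:E
             | v in [set v | Xh v /\ (0 < normL2 Omega v.2)%E]])%E.

Definition stokes_pair Omega (beta : R) (Xh : set (sob R d))
    (Mh : set ('rV[R]_d -> R)) : Prop :=
  [/\ fin_dim_subspace Xh, fin_dim_subspace Mh,
      Xh `<=` H10 Omega, Mh `<=` L20 Omega & inf_sup Omega beta Xh Mh].

Definition Vh Omega (Xh : set (sob R d)) (Mh : set ('rV[R]_d -> R)) :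
    set (sob R d) :=
  [set v | Xh v /\ forall q, Mh q -> sinner Omega (div v) q = 0].

(* The intervals of a partition t are I_m = ]t_(m-1), t_m] for 1 <= m <= M. *)
Definition Im (t : nat -> R) (m : nat) : set R := `]t m.-1, t m].

Definition step (t : nat -> R) (m : nat) : R := t m - t m.-1.

Definition tau (M : nat) (t : nat -> R) : R :=
  \big[Num.max/0]_(1 <= m < M.+1) step t m.

(* tau is itself one of the steps, hence a neutral default value here *)
Definition tau_min (M : nat) (t : nat -> R) : R :=
  \big[Num.min/tau M t]_(1 <= m < M.+1) step t m.

Definition time_partition (T c gamma kappa : R) (M : nat) (t : nat -> R) : Prop :=
  [/\ (0 < M)%N, t 0%N = 0, t M = T &
      forall m, (m < M)%N -> t m < t m.+1] /\
  [/\ c * tau M t `^ gamma <= tau_min M t,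
      forall m, (0 < m < M)%N -> kappa^-1 <= step t m / step t m.+1 <= kappa &
      tau M t <= T / 4].

(* X_tau^w(S) *)
Definition Xtau (E : lmodType R) (w M : nat) (t : nat -> R) (S : set E) :
    set (R -> E) :=
  [set v | forall m, (0 < m <= M)%N -> exists a : 'I_w.+1 -> E,
     (forall k, S (a k)) /\
     forall s, Im t m s -> v s = \sum_(k < w.+1) s ^+ k *: a k].

Definition jump Omega (v : R -> 'rV[R]_d -> 'rV[R]_d) (s : R) :
    'rV[R]_d -> 'rV[R]_d :=
  fun x => lim_right Omega v s x - lim_left Omega v s x.

Definition dt (v : R -> 'rV[R]_d -> 'rV[R]_d) : R -> 'rV[R]_d -> 'rV[R]_d :=
  fun s x => derive1 (fun r => v r x) s.

Definition Bform Omega (T : R) (M : nat) (t : nat -> R)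
    (u : R -> sob R d) (p : R -> 'rV[R]_d -> R)
    (v : R -> sob R d) (q : R -> 'rV[R]_d -> R) : R :=
  let u1 s := (u s).1 in let v1 s := (v s).1 in
  \sum_(1 <= m < M.+1) inner_st (Im t m) Omega (dt u1) v1
  + inner_st (itvT T) Omega (fun s => (u s).2) (fun s => (v s).2)
  - sinner_st (itvT T) Omega p (fun s => div (v s))
  + sinner_st (itvT T) Omega (fun s => div (u s)) q
  + \sum_(2 <= m < M.+1)
      inner Omega (jump Omega u1 (t m.-1)) (lim_right Omega v1 (t m.-1))
  + inner Omega (lim_right Omega u1 (t 0%N)) (lim_right Omega v1 (t 0%N)).

(* Weak solution (u, p) of the transient Stokes problem; ut is the time
   derivative of u, and u is the representative in C([0,T]; L^2(Omega)^d). *)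
Definition weak_solution Omega (T : R) (f : R -> 'rV[R]_d -> 'rV[R]_d)
    (u0 : sob R d) (u : R -> sob R d) (ut : R -> 'rV[R]_d -> 'rV[R]_d)
    (p : R -> 'rV[R]_d -> R) : Prop :=
  let I := itvT T in
  [/\ L2sob I Omega (V1 Omega) u,
      L2mxst I Omega ut /\ is_time_derivative T Omega (fun s => (u s).1) ut,
      L2L20 I Omega p,
      continuous_L2 T Omega (fun s => (u s).1) /\
      ae_on Omega (fun x => (u 0).1 x = u0.1 x) &
      forall v xi, L2sob I Omega (H10 Omega) v -> L2L20 I Omega xi ->
        inner_st I Omega ut (fun s => (v s).1)
        + inner_st I Omega (fun s => (u s).2) (fun s => (v s).2)
        - sinner_st I Omega p (fun s => div (v s))
        + sinner_st I Omega (fun s => div (u s)) xi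
        = inner_st I Omega f (fun s => (v s).1)].

Definition discrete_solution Omega (T : R) (w M : nat) (t : nat -> R)
    (Xh : set (sob R d)) (Mh : set ('rV[R]_d -> R))
    (f : R -> 'rV[R]_d -> 'rV[R]_d) (u0 : sob R d)
    (uh : R -> sob R d) (ph : R -> 'rV[R]_d -> R) : Prop :=
  [/\ Xtau w M t Xh uh, Xtau w M t Mh ph &
      forall v q, Xtau w M t Xh v -> Xtau w M t Mh q ->
        Bform Omega T M t uh ph v q
        = inner_st (itvT T) Omega f (fun s => (v s).1)
          + inner Omega u0.1 (lim_right Omega (fun s => (v s).1) (t 0%N))].

(* P = pi_tau v.  For w = 0 the sum is empty and the orthogonality is void. *)
Definition is_pi_tau Omega (w M : nat) (t : nat -> R)
    (v P : R -> 'rV[R]_d -> 'rV[R]_d) : Prop :=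
  Xtau w M t [set g : 'rV[R]_d -> 'rV[R]_d | L2mx (lebesgue_rV d) Omega g] P /\
  forall m, (0 < m <= M)%N ->
    ae_on Omega (fun x => lim_left Omega P (t m) x = lim_left Omega v (t m) x) /\
    forall a : 'I_w -> 'rV[R]_d -> 'rV[R]_d,
      (forall k, L2mx (lebesgue_rV d) Omega (a k)) ->
      inner_st (Im t m) Omega (fun s x => P s x - v s x)
        (fun s x => \sum_(k < w) s ^+ k *: a k x) = 0.

(* (r, s) = (R_h^S(w, phi), R_h^{S,p}(w, phi)) *)
Definition is_stokes_projection Omega (Xh : set (sob R d))
    (Mh : set ('rV[R]_d -> R)) (w : sob R d) (phi : 'rV[R]_d -> R)
    (r : sob R d) (s : 'rV[R]_d -> R) : Prop :=
  [/\ Xh r, Mh s,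
      forall v, Xh v -> inner Omega (w - r).2 v.2
                        - sinner Omega (phi - s) (div v) = 0 &
      forall q, Mh q -> sinner Omega (div (w - r)) q = 0].

(* The Stokes projection applied pointwise in time; r is a version that is
   measurable on (0,T] x Omega. *)
Definition is_stokes_projection_st Omega (T : R) (Xh : set (sob R d))
    (Mh : set ('rV[R]_d -> R)) (u : R -> sob R d) (p : R -> 'rV[R]_d -> R)
    (r : R -> sob R d) (s : R -> 'rV[R]_d -> R) : Prop :=
  (forall i, measurable_fun (itvT T `*` Omega)
     (fun z : measurableTypeR R * 'rV[R]_d => (r z.1).1 z.2 0 i)) /\
  {ae lebesgue_measure, forall t, itvT T t ->
     is_stokes_projection Omega Xh Mh (u t) (p t) (r t) (s t)}.

End discretization.

(* Main.v *)
(* The error is estimated with C = 2, without a dual problem.  Let P_h be the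
   L^2-projection onto V_h, y = P_h pi_tau u and e = u_h - y, and test both
   problems with v = A_h^-1 e, where A_h is the discrete Stokes operator:
   (grad v, grad r) = (e, r) for r in V_h.  Integration by parts on each slab
   shows that the time part of B sees pi_tau u as it sees u, so that the time
   parts of u and y tested with v agree.  By definition of R_h^S the spatial
   terms of (u, p) become (R_h^S(u, p), e), and those of u_h become (u_h, e).
   The time part of B at (e, v) is nonnegative, because (e, A_h^-1 e) behaves
   like a squared norm.  Subtracting the equations gives
   (u_h - R_h^S(u, p), e) <= 0, hence |e| <= |R_h^S(u, p) - pi_tau u|.  Finally
   |chi - y| <= |chi - pi_tau u|, and the triangle inequality concludes. *)

From HB Require Import structures.
Require Import Defs.
From mathcomp Require Import all_boot all_order all_algebra.
From mathcomp Require Import all_classical all_reals all_analysis.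
From mathcomp Require Import measurable_realfun ring lra.
Import Order.TTheory GRing.Theory Num.Theory.
Import numFieldNormedType.Exports.
Local Open Scope classical_set_scope.
Local Open Scope ring_scope.

Set Implicit Arguments.
Unset Strict Implicit.
Unset Printing Implicit Defensive.

(** * Square integrable functions *)

(** Testing with e itself would control e in the gradient norm only. With A_h^-1 e the whole
    estimate is one order weaker, so that all terms are L^2 inner products and the pressure p enters
    only through R_h^S(u, p). On a slab the test function v is a polynomial of degree at most w in
    time, so its time derivative has degree at most w - 1, which is exactly what pi_tau is
    orthogonal to; and tests in V_h do not see P_h. Two obstacles shape the development. The time
    derivative of u is only distributional, so that integration by parts against a polynomial on a
    slab has to be reached through compactly supported cut-offs, built from exp(-1/x), and the
    continuity of u in L^2. And a Sobolev field is a pair of functions, which leaves the forms on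
    V_h semidefinite: P_h and A_h^-1 come from a Riesz theorem for functionals that vanish on null
    vectors. For A_h^-1 this means that a field of H^1_0 with zero gradient vanishes in L^2, a
    qualitative substitute for Poincare's inequality. *)

Section L2_functions.
Context {R : realType} d0 {S : measurableType d0}.
Variables (mu : {measure set S -> \bar R}) (D : set S).
Hypothesis mD : measurable D.

Lemma L2_mul_integrable (f g : S -> R) : L2 mu D f -> L2 mu D g ->
  mu.-integrable D (fun x => (f x * g x)%:E).
Proof.
move=> [mf If] [mg Ig].
apply: (@le_integrable _ _ _ _ _ mD _ (fun x => (f x ^+ 2)%:E + (g x ^+ 2)%:E)%E).
- by apply/measurable_EFinP; exact: measurable_funM.
- move=> x _; rewrite -EFinD !abse_EFin lee_fin (@ger0_norm _ (_ + _)) ?addr_ge0 ?sqr_ge0//.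
  rewrite normrM; have := sqr_ge0 (`|f x| - `|g x|).
  by rewrite -(real_normK (num_real (f x))) -(real_normK (num_real (g x))); nra.
- exact: integrableD.
Qed.

Lemma L2D (f g : S -> R) : L2 mu D f -> L2 mu D g -> L2 mu D (fun x => f x + g x).
Proof.
move=> Lf Lg; have [mf If] := Lf; have [mg Ig] := Lg; split.
  exact: measurable_funD.
have Ifg := L2_mul_integrable Lf Lg.
rewrite (_ : (fun x => _) = (fun x => (f x ^+ 2)%:E + ((2 * (f x * g x))%:E + (g x ^+ 2)%:E))%E).
  apply: integrableD => //; apply: integrableD => //.
  by under eq_fun do rewrite EFinM; exact: integrableZl.
by apply/funext => x; rewrite -!EFinD; congr EFin; ring.
Qed.

Lemma L2Z (a : R) (f : S -> R) : L2 mu D f -> L2 mu D (fun x => a * f x).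
Proof.
move=> [mf If]; split.
  exact: measurable_funM.
rewrite (_ : (fun x => _) = (fun x => ((a ^+ 2)%:E * (f x ^+ 2)%:E))%E).
  exact: integrableZl.
by apply/funext => x; rewrite exprMn.
Qed.

Lemma L2_0 : L2 mu D (fun=> 0).
Proof.
by split=> //; rewrite expr0n/=; exact: integrable0.
Qed.

Lemma L2_sum (I : Type) (s : seq I) (P : pred I) (f : I -> S -> R) :
  (forall i, P i -> L2 mu D (f i)) -> L2 mu D (fun x => \sum_(i <- s | P i) f i x).
Proof.
move=> Lf; elim: s => [|i s IH].
  by under eq_fun do rewrite big_nil; exact: L2_0.
under eq_fun do rewrite big_cons.
by case Pi: (P i) => //; apply: L2D => //; exact: Lf.
Qed.

Lemma eq_L2 (f g : S -> R) : {in D, f =1 g} -> L2 mu D f -> L2 mu D g.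
Proof.
move=> fg [mf If]; split; first exact: eq_measurable_fun mf.
by apply: eq_integrable If => // x xD; rewrite fg.
Qed.

Lemma Rintegral_sum (I : Type) (s : seq I) (f : I -> S -> R) :
  (forall i, mu.-integrable D (EFin \o f i)) ->
  \int[mu]_(x in D) (\sum_(i <- s) f i x) = \sum_(i <- s) \int[mu]_(x in D) f i x.
Proof.
move=> If; have Is r : mu.-integrable D (EFin \o (fun x => \sum_(i <- r) f i x)).
  rewrite (_ : _ \o _ = (fun x => \sum_(i <- r) (f i x)%:E)%E); last first.
    by apply/funext => x; rewrite /= sumEFin.
  by apply: integrable_sum => // i _; exact: If.
elim: s => [|i s IH].
  rewrite big_nil (@eq_Rintegral _ _ _ _ _ (fun=> 0)) ?Rintegral_cst ?mul0r//.
  by move=> x _; rewrite big_nil.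
rewrite big_cons -IH -RintegralD//.
by apply: eq_Rintegral => x _; rewrite big_cons.
Qed.

Context {m n : nat}.
Implicit Types u v : S -> 'M[R]_(m, n).

Lemma eq_L2mx u v : {in D, u =1 v} -> L2mx mu D u -> L2mx mu D v.
Proof. by move=> uv Lu i j; apply: eq_L2 (Lu i j) => x xD; rewrite uv. Qed.

Lemma L2mxD u v : L2mx mu D u -> L2mx mu D v -> L2mx mu D (u \+ v).
Proof.
by move=> Lu Lv i j; under eq_fun do rewrite mxE; exact: L2D (Lu _ _) (Lv _ _).
Qed.

Lemma L2mxZ a u : L2mx mu D u -> L2mx mu D (a \*: u).
Proof.
by move=> Lu i j; under eq_fun do rewrite mxE; exact: L2Z (Lu _ _).
Qed.

Lemma L2mx0 : L2mx mu D (fun=> 0 : 'M[R]_(m, n)).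
Proof. by move=> i j; under eq_fun do rewrite mxE; exact: L2_0. Qed.

Lemma L2mxB u v : L2mx mu D u -> L2mx mu D v -> L2mx mu D (u \- v).
Proof.
move=> Lu Lv; rewrite (_ : u \- v = u \+ (-1 \*: v)).
  by apply: L2mxD => //; exact: L2mxZ.
by apply/funext => x /=; rewrite scaleN1r.
Qed.

Lemma L2mx_sum (I : Type) (s : seq I) (P : pred I) (f : I -> S -> 'M[R]_(m, n)) :
  (forall i, P i -> L2mx mu D (f i)) ->
  L2mx mu D (fun x => \sum_(i <- s | P i) f i x).
Proof.
move=> Lf i j; under eq_fun do rewrite summxE.
by apply: L2_sum => k Pk; exact: Lf.
Qed.

Definition L2inner u v : R := \int[mu]_(x in D) frob (u x) (v x).

Lemma frob_integrable u v : L2mx mu D u -> L2mx mu D v ->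
  mu.-integrable D (fun x => (frob (u x) (v x))%:E).
Proof.
move=> Lu Lv; rewrite /frob; under eq_fun do rewrite -sumEFin.
apply: integrable_sum => // i _; under eq_fun do rewrite -sumEFin.
by apply: integrable_sum => // j _; exact: L2_mul_integrable.
Qed.

Lemma frobC (A B : 'M[R]_(m, n)) : frob A B = frob B A.
Proof. by apply: eq_bigr => i _; apply: eq_bigr => j _; rewrite mulrC. Qed.

Lemma frobDl (A B C : 'M[R]_(m, n)) : frob (A + B) C = frob A C + frob B C.
Proof.
rewrite -big_split; apply: eq_bigr => i _; rewrite -big_split.
by apply: eq_bigr => j _; rewrite mxE mulrDl.
Qed.

Lemma frobZl a (A C : 'M[R]_(m, n)) : frob (a *: A) C = a * frob A C.
Proof.
rewrite mulr_sumr; apply: eq_bigr => i _; rewrite mulr_sumr.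
by apply: eq_bigr => j _; rewrite mxE mulrA.
Qed.

Lemma frob_ge0 (A : 'M[R]_(m, n)) : 0 <= frob A A.
Proof. by apply: sumr_ge0 => i _; apply: sumr_ge0 => j _; rewrite -expr2 sqr_ge0. Qed.

Lemma frob_eq0 (A : 'M[R]_(m, n)) : frob A A = 0 -> A = 0.
Proof.
move/eqP; rewrite psumr_eq0 => [/allP A0|i _]; last first.
  by apply: sumr_ge0 => j _; rewrite -expr2 sqr_ge0.
apply/matrixP => i j; rewrite mxE; have := A0 i.
rewrite mem_index_enum => /(_ erefl)/=.
rewrite psumr_eq0 => [/allP/(_ j)|k _]; last by rewrite -expr2 sqr_ge0.
by rewrite mem_index_enum => /(_ erefl)/=; rewrite mulf_eq0 orbb => /eqP.
Qed.

Lemma ipC u v : L2inner u v = L2inner v u.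
Proof. by apply: eq_Rintegral => x _; rewrite frobC. Qed.

Lemma eq_ip u u' v v' : {in D, u =1 u'} -> {in D, v =1 v'} -> L2inner u v = L2inner u' v'.
Proof. by move=> uu vv; apply: eq_Rintegral => x xD; rewrite uu// vv. Qed.

Lemma ae_ipl u u' v : L2mx mu D u -> L2mx mu D u' -> L2mx mu D v ->
  {ae mu, forall x, D x -> u x = u' x} -> L2inner u v = L2inner u' v.
Proof.
move=> Lu Lu' Lv uu'; rewrite /L2inner /Rintegral; congr fine.
apply: ae_eq_integral => //.
- by have /integrableP[] := frob_integrable Lu Lv.
- by have /integrableP[] := frob_integrable Lu' Lv.
- by apply: filterS uu' => x /[apply] ->.
Qed.

Lemma ipDl u v z : L2mx mu D u -> L2mx mu D v -> L2mx mu D z ->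
  L2inner (u \+ v) z = L2inner u z + L2inner v z.
Proof.
move=> Lu Lv Lz; rewrite -RintegralD//; last 2 first.
- exact: frob_integrable.
- exact: frob_integrable.
by apply: eq_Rintegral => x _; rewrite frobDl.
Qed.

Lemma ipZl a u z : L2mx mu D u -> L2mx mu D z -> L2inner (a \*: u) z = a * L2inner u z.
Proof.
move=> Lu Lz; rewrite -RintegralZl//; last exact: frob_integrable.
by apply: eq_Rintegral => x _; rewrite frobZl.
Qed.

Lemma ipDr u v z : L2mx mu D u -> L2mx mu D v -> L2mx mu D z ->
  L2inner z (u \+ v) = L2inner z u + L2inner z v.
Proof. by move=> Lu Lv Lz; rewrite ipC ipDl// !(ipC _ z). Qed.

Lemma ipZr a u z : L2mx mu D u -> L2mx mu D z -> L2inner z (a \*: u) = a * L2inner z u.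
Proof. by move=> Lu Lz; rewrite ipC ipZl// (ipC z). Qed.

Lemma ipBl u v z : L2mx mu D u -> L2mx mu D v -> L2mx mu D z ->
  L2inner (u \- v) z = L2inner u z - L2inner v z.
Proof.
move=> Lu Lv Lz; rewrite (_ : u \- v = u \+ (-1 \*: v)).
  by rewrite ipDl ?ipZl ?mulN1r//; exact: L2mxZ.
by apply/funext => x /=; rewrite scaleN1r.
Qed.

Lemma ipBr u v z : L2mx mu D u -> L2mx mu D v -> L2mx mu D z ->
  L2inner z (u \- v) = L2inner z u - L2inner z v.
Proof. by move=> Lu Lv Lz; rewrite ipC ipBl// !(ipC _ z). Qed.

Lemma ip0l z : L2inner (fun=> 0) z = 0.
Proof.
rewrite /L2inner (@eq_Rintegral _ _ _ _ _ (fun=> 0)); last first.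
  by move=> x _; apply: big1 => i _; apply: big1 => j _; rewrite mxE mul0r.
by rewrite Rintegral_cst// mul0r.
Qed.

Lemma ip_suml (I : Type) (s : seq I) (P : pred I) (f : I -> S -> 'M[R]_(m, n)) z :
  (forall i, P i -> L2mx mu D (f i)) -> L2mx mu D z ->
  L2inner (fun x => \sum_(i <- s | P i) f i x) z = \sum_(i <- s | P i) L2inner (f i) z.
Proof.
move=> Lf Lz; elim: s => [|i s IH].
  by rewrite big_nil -[RHS](ip0l z); apply: eq_ip => // x _; rewrite big_nil.
rewrite big_cons -IH; case: ifPn => Pi.
  rewrite -ipDl//; [|exact: Lf|exact: L2mx_sum].
  by apply: eq_ip => // x _; rewrite big_cons Pi.
by apply: eq_ip => // x _; rewrite big_cons (negbTE Pi).
Qed.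

Lemma ip_ge0 u : 0 <= L2inner u u.
Proof. by apply: Rintegral_ge0 => x _; exact: frob_ge0. Qed.

Lemma integral_frob u : L2mx mu D u ->
  (\int[mu]_(x in D) (frob (u x) (u x))%:E)%E = (L2inner u u)%:E.
Proof.
move=> Lu; rewrite /L2inner /Rintegral fineK//.
by apply: integrable_fin_num => //; exact: frob_integrable.
Qed.

Lemma ip_eq0 u : L2mx mu D u -> L2inner u u = 0 -> {ae mu, forall x, D x -> u x = 0}.
Proof.
move=> Lu u0; have /ae_eq_integral_abs : measurable_fun D (fun x => (frob (u x) (u x))%:E).
  by have /integrableP[] := frob_integrable Lu Lu.
move=> /(_ mu mD)[+ _]; rewrite (eq_integral (fun x => (frob (u x) (u x))%:E)); last first.
  by move=> x _; rewrite gee0_abs// lee_fin frob_ge0.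
rewrite integral_frob// u0 => /(_ erefl).
by apply: filterS => x /[apply] -[]/frob_eq0.
Qed.

Lemma ip_CS u v : L2mx mu D u -> L2mx mu D v -> L2inner u v ^+ 2 <= L2inner u u * L2inner v v.
Proof.
move=> Lu Lv.
have quad a : 0 <= L2inner u u + 2 * a * L2inner u v + a ^+ 2 * L2inner v v.
  have := ip_ge0 (u \+ (a \*: v)).
  have Lav := L2mxZ a Lv; have Luav := L2mxD Lu Lav.
  rewrite ipDl// !ipDr// ipZl// !ipZr// ipZl// (ipC v u); nra.
have [v0|v0] := eqVneq (L2inner v v) 0.
  rewrite v0 mulr0; have [->|uv0] := eqVneq (L2inner u v) 0; first by rewrite expr0n.
  (* As (v, v) = 0, the form is affine in [a]; at this [a] it would equal -1. *)
  have := quad (- (L2inner u u + 1) / (2 * L2inner u v)); rewrite v0 mulr0 addr0.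
  rewrite (_ : 2 * _ * _ = - (L2inner u u + 1)) ; last by field.
  by lra.
(* The minimiser of the quadratic. *)
have := quad (- L2inner u v / L2inner v v); have vpos : 0 < L2inner v v by rewrite lt0r v0 ip_ge0.
rewrite (_ : _ + _ = (L2inner u u * L2inner v v - L2inner u v ^+ 2) / L2inner v v); last by field.
by rewrite pmulr_lge0 ?invr_gt0// subr_ge0.
Qed.

Definition L2norm u : R := Num.sqrt (L2inner u u).

Lemma L2norm_ge0 u : 0 <= L2norm u.
Proof. exact: sqrtr_ge0. Qed.

Lemma sqr_L2norm u : L2norm u ^+ 2 = L2inner u u.
Proof. by rewrite sqr_sqrtr ?ip_ge0. Qed.

Lemma ip_le_L2norm u v : L2mx mu D u -> L2mx mu D v -> `|L2inner u v| <= L2norm u * L2norm v.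
Proof.
move=> Lu Lv; rewrite -(@ler_sqr R) ?nnegrE ?mulr_ge0 ?L2norm_ge0//.
by rewrite exprMn !sqr_L2norm real_normK ?num_real//; exact: ip_CS.
Qed.

Lemma L2normD u v : L2mx mu D u -> L2mx mu D v -> L2norm (u \+ v) <= L2norm u + L2norm v.
Proof.
move=> Lu Lv; rewrite -(@ler_sqr R) ?nnegrE ?addr_ge0 ?L2norm_ge0//.
rewrite sqr_L2norm sqrrD !sqr_L2norm ipDl//; last exact: L2mxD.
rewrite !ipDr// (ipC v u).
have := ip_le_L2norm Lu Lv; have := ler_norm (L2inner u v); lra.
Qed.

Lemma L2normB u v : L2norm (u \- v) = L2norm (v \- u).
Proof.
rewrite /L2norm; congr Num.sqrt; apply: eq_Rintegral => x _ /=.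
rewrite -[u x - v x]opprB -scaleN1r frobZl frobC frobZl.
by rewrite mulrA mulrNN !mul1r.
Qed.

Lemma L2norm_triangle z u v : L2mx mu D u -> L2mx mu D v -> L2mx mu D z ->
  L2norm (u \- v) <= L2norm (u \- z) + L2norm (z \- v).
Proof.
move=> Lu Lv Lz; rewrite (_ : u \- v = (u \- z) \+ (z \- v)).
  by apply: L2normD; exact: L2mxB.
by apply/funext => x /=; rewrite addrA subrK.
Qed.

Lemma poweR_ip u : ((L2inner u u)%:E `^ 2^-1)%E = (L2norm u)%:E.
Proof. by rewrite poweR_EFin powR12_sqrt ?ip_ge0. Qed.

(** Cancel |u| in |u|^2 <= (v, u) <= |v| |u|. Both bounds of [discrete_error] end this way. *)
Lemma L2norm_le_of_ip u v : L2mx mu D u -> L2mx mu D v -> L2inner u u <= L2inner v u ->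
  L2norm u <= L2norm v.
Proof.
move=> Lu Lv uv; have [->|u0] := eqVneq (L2norm u) 0; first exact: L2norm_ge0.
have := ip_le_L2norm Lv Lu; have := ler_norm (L2inner v u); rewrite -sqr_L2norm in uv.
by move: (L2norm_ge0 u) (L2norm_ge0 v); rewrite le0r (negbTE u0)/=; nra.
Qed.

End L2_functions.

(** * Open sets of R^d are measurable *)

Section open_measurable.
Context {R : realType} {d : nat}.

Definition rat_box (ab : 'rV[rat]_d * 'rV[rat]_d) : set 'rV[R]_d :=
  \bigcap_(j in [set: 'I_d])
    (fun x : 'rV[R]_d => x 0 j) @^-1` `]ratr (ab.1 0 j), ratr (ab.2 0 j)[.

Lemma measurable_rat_box ab : measurable (rat_box ab).
Proof.
apply: fin_bigcap_measurable => // j _.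
rewrite -[X in measurable X]setTI; apply: measurable_mx_coor => //.
Qed.

(** The sigma-algebra is generated by the coordinates, not by the open sets, so an open set is
    exhausted by countably many boxes with rational corners. *)
Lemma open_measurable_rV (O : set 'rV[R]_d) : open O -> measurable O.
Proof.
(* A box that sticks out of [O] contributes the empty set, so that the union runs over the whole
   countable type of pairs of corners. *)
move=> oO; pose F ab := [set x | rat_box ab `<=` O /\ rat_box ab x].
have -> : O = \bigcup_ab F ab.
  apply/seteqP; split => [x Ox|x [ab _ [sub abx]]]; last exact: sub.
  have /nbhs_ballP[e /= e0 xeO] : nbhs x O by exact: open_nbhs_nbhs.
  have /all_sig[a aP] (j : 'I_d) : {q : rat | ratr q \in `]x 0 j - e, x 0 j[}.
    by apply: cid; apply: rat_in_itvoo; rewrite ltrBlDr ltrDl.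
  have /all_sig[b bP] (j : 'I_d) : {q : rat | ratr q \in `]x 0 j, x 0 j + e[}.
    by apply: cid; apply: rat_in_itvoo; rewrite ltrDl.
  exists (\row_j a j, \row_j b j) => //; split.
    move=> y boxy; apply: xeO; split => // i j; rewrite (ord1 i).
    have := boxy j Logic.I; rewrite /= !mxE !in_itv/= => /andP[ay yb].
    move: (aP j) (bP j); rewrite !in_itv/= => /andP[? ?] /andP[? ?].
    by rewrite /ball/= ltr_norml; apply/andP; split; lra.
  move=> j _; rewrite /= !mxE in_itv/=.
  by move: (aP j) (bP j); rewrite !in_itv/= => /andP[_ ->] /andP[-> _].
apply: countable_bigcupT_measurable; first exact: countableP.
move=> ab.
have [sub|nsub] := pselect (rat_box ab `<=` O).
  rewrite (_ : F ab = rat_box ab); first exact: measurable_rat_box.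
  by apply/seteqP; split => [x []|x abx].
by rewrite (_ : F ab = set0)//; apply/seteqP; split => [x []|].
Qed.

End open_measurable.

(** * Integrals over J x Omega as iterated integrals *)

Section space_time.
Context {R : realType} {d : nat}.
Variables (J : set (measurableTypeR R)) (Omega : set 'rV[R]_d).
Hypotheses (mJ : measurable J) (mO : measurable Omega).

Let mJO : measurable (J `*` Omega : set (measurableTypeR R * 'rV[R]_d)).
Proof. exact: measurableX. Qed.

(** Fubini and Tonelli are applied on the full product, to integrands extended by zero. *)
Let sectionE (f : measurableTypeR R * 'rV[R]_d -> \bar R) :
  @fubini_F _ _ (measurableTypeR R) _ _ (lebesgue_rV d) (f \_ (J `*` Omega)) =
  ((fun s => \int[lebesgue_rV d]_(x in Omega) f (s, x))%E \_ J).
Proof.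
apply/funext => s; rewrite /fubini_F patchE; case: ifPn => [sJ|sJ].
  rewrite [RHS]integral_mkcond; apply: eq_integral => x _.
  by rewrite !patchE in_setX sJ.
by apply: integral0_eq => x _; rewrite patchE in_setX (negbTE sJ).
Qed.

(** For a null set of times the integral over Omega may be infinite, and its real-valued version
    then has a default value. So the integrability of the real-valued version is part of the
    conclusion, and the two versions are compared almost everywhere. *)
Lemma fubini_st (f : R -> 'rV[R]_d -> R) :
  lebesgue_st.-integrable (J `*` Omega) (fun z => (f z.1 z.2)%:E) ->
  lebesgue_measure.-integrable J
    (fun s => (\int[lebesgue_rV d]_(x in Omega) f s x)%:E) /\
  \int[lebesgue_st]_(z in J `*` Omega) f z.1 z.2 =
  \int[lebesgue_measure]_(s in J) \int[lebesgue_rV d]_(x in Omega) f s x.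
Proof.
move=> /(integrable_mkcond _ mJO) If.
have := @integrable_fubini_F _ _ (measurableTypeR R) 'rV[R]_d R
  lebesgue_measure (lebesgue_rV d) _ If.
have := @integral12_prod_meas1 _ _ (measurableTypeR R) 'rV[R]_d R
  lebesgue_measure (lebesgue_rV d) _ If.
rewrite sectionE -!integral_mkcond => FE /(@integrable_mkcond _ (measurableTypeR R) R lebesgue_measure J _ mJ).
set F := (fun s => _) => IF.
have [mF _] := integrableP _ _ _ IF.
have mfF : measurable_fun (J : set (measurableTypeR R)) (fun s => (fine (F s))%:E).
  apply/measurable_EFinP.
  have mfine : measurable_fun [set: \bar R] (@fine R) := fine_measurable measurableT.
  exact: (measurableT_comp mfine mF).
split.
  apply: (@le_integrable _ (measurableTypeR R) R lebesgue_measure J mJ _ F mfF _ IF) => s _.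
  by case: (F s) => [r||]//=; rewrite normr0 leey.
rewrite /Rintegral -FE; congr fine; apply: ae_eq_integral => //.
have := integrable_ae mJ IF; apply: filterS => s /[apply] Fs.
by rewrite fineK.
Qed.

Lemma tonelli_st (f : R -> 'rV[R]_d -> R) :
  measurable_fun (J `*` Omega : set (measurableTypeR R * 'rV[R]_d))
    (fun z => f z.1 z.2) ->
  (forall s x, 0 <= f s x) ->
  (\int[lebesgue_st]_(z in J `*` Omega) (f z.1 z.2)%:E =
   \int[lebesgue_measure]_(s in J) \int[lebesgue_rV d]_(x in Omega) (f s x)%:E)%E.
Proof.
move=> mf f0; rewrite integral_mkcond [RHS]integral_mkcond.
rewrite /lebesgue_st fubini_tonelli1.
- by rewrite sectionE.
- by apply/(measurable_restrictT _ mJO); exact/measurable_EFinP.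
- by move=> z; rewrite patchE; case: ifPn => //; rewrite lee_fin.
Qed.

Lemma L2mxst_ip m n (u v : R -> 'rV[R]_d -> 'M[R]_(m, n)) :
  L2mxst J Omega u -> L2mxst J Omega v ->
  lebesgue_measure.-integrable J (fun s => (inner Omega (u s) (v s))%:E) /\
  inner_st J Omega u v =
  L2inner lebesgue_st (J `*` Omega) (fun z => u z.1 z.2) (fun z => v z.1 z.2).
Proof.
move=> Lu Lv.
have [I E] := @fubini_st (fun s x => frob (u s x) (v s x)) (frob_integrable mJO Lu Lv).
by split=> //; rewrite /inner_st /inner -E.
Qed.

Lemma measurable_frob_st m n (u : R -> 'rV[R]_d -> 'M[R]_(m, n)) :
  (forall i j, measurable_fun (J `*` Omega : set (measurableTypeR R * 'rV[R]_d))
    (fun z => u z.1 z.2 i j)) ->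
  measurable_fun (J `*` Omega : set (measurableTypeR R * 'rV[R]_d))
    (fun z => frob (u z.1 z.2) (u z.1 z.2)).
Proof.
move=> mu; apply: measurable_sum => i; apply: measurable_sum => j.
exact: measurable_funM.
Qed.

Lemma normL2_stE m n (u : R -> 'rV[R]_d -> 'M[R]_(m, n)) : L2mxst J Omega u ->
  normL2_st J Omega u =
  (L2norm lebesgue_st (J `*` Omega) (fun z => u z.1 z.2))%:E.
Proof.
move=> Lu; rewrite /normL2_st -(@tonelli_st (fun s x => frob (u s x) (u s x))).
- by rewrite integral_frob// poweR_ip.
- by apply: measurable_frob_st => i j; have [] := Lu i j.
- by move=> s x; exact: frob_ge0.
Qed.

(** The square of each entry is bounded by the Frobenius square. This is how R_h^S(u, p), given only
    as a measurable function satisfying the projection equations, is seen to be square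
    integrable. *)
Lemma normL2_st_lty m n (u : R -> 'rV[R]_d -> 'M[R]_(m, n)) :
  (forall i j, measurable_fun (J `*` Omega : set (measurableTypeR R * 'rV[R]_d))
    (fun z => u z.1 z.2 i j)) ->
  (normL2_st J Omega u < +oo)%E -> L2mxst J Omega u.
Proof.
move=> mu uoo i j; split=> //.
have mf := measurable_frob_st mu.
have : lebesgue_st.-integrable (J `*` Omega) (fun z => (frob (u z.1 z.2) (u z.1 z.2))%:E).
  apply/integrableP; split; first exact/measurable_EFinP.
  under eq_integral do rewrite gee0_abs ?lee_fin ?frob_ge0//.
  rewrite (@tonelli_st (fun s x => frob (u s x) (u s x)))//; last first.
    by move=> s x; exact: frob_ge0.
  move: uoo; rewrite /normL2_st; case: (integral _ _ _) => [r _||]/=.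
  - exact: ltry.
  (* The square root of +oo is +oo, against [uoo]. *)
  - by rewrite ifF// invr_eq0 pnatr_eq0.
  - by [].
apply: (le_integrable mJO).
  by apply/measurable_EFinP; exact: measurable_funX.
move=> z _; rewrite !abse_EFin lee_fin normrX real_normK ?num_real// ger0_norm ?frob_ge0//.
rewrite /frob (bigD1 i)//= (bigD1 j)//= -expr2 -addrA lerDl addr_ge0//.
  by apply: sumr_ge0 => k _; rewrite -expr2 sqr_ge0.
by apply: sumr_ge0 => k _; apply: sumr_ge0 => l _; rewrite -expr2 sqr_ge0.
Qed.

Lemma L2_space_time (g : 'rV[R]_d -> R) : (lebesgue_measure J < +oo)%E ->
  L2 (lebesgue_rV d) Omega g -> L2st J Omega (fun=> g).
Proof.
move=> Joo [mg Ig].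
have mgs : measurable_fun (J `*` Omega : set (measurableTypeR R * 'rV[R]_d))
    (fun z => g z.2).
  apply: (@eq_measurable_fun _ _ _ _ _ (fun z => (g \_ Omega) z.2)).
    by move=> z; rewrite in_setX => /andP[_ zO]; rewrite /= patchE zO.
  apply: (@measurable_funTS _ _ (measurableTypeR R * 'rV[R]_d)%type).
  apply: (measurableT_comp _ measurable_snd).
  exact/(measurable_restrictT _ mO).
split=> //; apply/integrableP; split.
  by apply/measurable_EFinP; exact: measurable_funX.
under eq_integral do rewrite gee0_abs ?lee_fin ?sqr_ge0//.
rewrite (@tonelli_st (fun s x => g x ^+ 2)).
- rewrite integral_cst//; apply: lte_mul_pinfty => //.
  + by apply: integral_ge0 => x _; rewrite lee_fin sqr_ge0.
  + exact: integrable_fin_num.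
- exact: measurable_funX.
- by move=> s x; exact: sqr_ge0.
Qed.

Lemma L2mxst_separated (K : R) (phi : R -> R) m n (a : 'rV[R]_d -> 'M[R]_(m, n)) :
  (lebesgue_measure J < +oo)%E -> measurable_fun setT phi ->
  (forall s, J s -> `|phi s| <= K) ->
  L2mx (lebesgue_rV d) Omega a -> L2mxst J Omega (fun s x => phi s *: a x).
Proof.
move=> Joo mphi phiK La i j.
have [ma Ia] := L2_space_time Joo (La i j).
have mpa : measurable_fun (J `*` Omega : set (measurableTypeR R * 'rV[R]_d))
    (fun z => phi z.1 * a z.2 i j).
  apply: measurable_funM => //.
  apply: (@measurable_funTS _ _ (measurableTypeR R * 'rV[R]_d)%type).
  exact: (measurableT_comp mphi measurable_fst).
apply: (@eq_L2 _ _ _ _ _ mJO (fun z => phi z.1 * a z.2 i j)).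
  by move=> z _; rewrite mxE.
split=> //; have := integrableZl mJO (K ^+ 2) Ia; apply: (le_integrable mJO).
  by apply/measurable_EFinP; exact: measurable_funX.
move=> z [Jz _]; rewrite -EFinM !abse_EFin lee_fin.
have -> : `|(phi z.1 * a z.2 i j) ^+ 2| = phi z.1 ^+ 2 * a z.2 i j ^+ 2.
  by rewrite ger0_norm ?sqr_ge0// exprMn.
rewrite (ger0_norm (mulr_ge0 (sqr_ge0 K) (sqr_ge0 (a z.2 i j)))) ler_wpM2r ?sqr_ge0//.
have K0 : 0 <= K := le_trans (normr_ge0 _) (phiK _ Jz).
by rewrite -(real_normK (num_real (phi z.1))) lerXn2r ?nnegrE ?phiK.
Qed.

End space_time.

Lemma L2_setU {R : realType} d0 {S : measurableType d0}
    (mu : {measure set S -> \bar R}) (D E : set S) (f : S -> R) :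
  measurable D -> measurable E -> [disjoint D & E] ->
  L2 mu D f -> L2 mu E f -> L2 mu (D `|` E) f.
Proof.
move=> mD mE DE [mf If] [mg Ig].
have mfDE : measurable_fun (D `|` E) f by apply/measurable_funU.
split=> //; apply/integrableP; split.
  by apply/measurable_EFinP; exact: measurable_funX.
rewrite ge0_integral_setU//; last first.
  by apply: measurableT_comp => //; apply/measurable_EFinP; exact: measurable_funX.
by apply: lte_add_pinfty; [case/integrableP : If|case/integrableP : Ig].
Qed.

(** * Smooth functions and cut-offs *)

Section smooth_functions.
Context {R : realType} {V : normedModType R}.
Implicit Types f g : V -> R.

(** Coinduction for [smooth]: instead of computing all iterated derivatives of a function, exhibit a
    class that contains it and is closed under directional derivatives. *)
Lemma smooth_coind (P : (V -> R) -> Prop) :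
  (forall f, P f -> continuous f) ->
  (forall f, P f -> forall v x, derivable f x v) ->
  (forall f, P f -> forall v, P ('D_v f)) ->
  forall f, P f -> smooth f.
Proof.
move=> Pc Pd PD f Pf s; suff Ps : P (foldr (fun v (h : V -> R) => 'D_v h) f s).
  by split; [exact: Pc|exact: Pd].
by elim: s => //= v s IH; exact: (PD _ IH v).
Qed.

Lemma smooth_continuous f : smooth f -> continuous f.
Proof. by move=> /(_ [::])[]. Qed.

Lemma smooth_derivable f : smooth f -> forall v x, derivable f x v.
Proof. by move=> /(_ [::])[]. Qed.

(** [foldr] applies the last direction of the list first, hence [rcons]. *)
Lemma smooth_derive f v : smooth f -> smooth ('D_v f).
Proof. by move=> sf s; have := sf (rcons s v); rewrite foldr_rcons. Qed.

(* This class is closed under directional derivatives, so that [smooth_coind]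
   applies to it; smooth functions themselves are not visibly closed under
   products before this is known. *)
Inductive smooth_alg : (V -> R) -> Prop :=
| smooth_alg_base f : smooth f -> smooth_alg f
| smooth_algD f g : smooth_alg f -> smooth_alg g -> smooth_alg (f + g)
| smooth_algM f g : smooth_alg f -> smooth_alg g -> smooth_alg (f * g)
| smooth_algV f : smooth_alg f -> (forall x, f x != 0) ->
    smooth_alg (fun x => (f x)^-1).

Lemma smooth_alg_continuous f : smooth_alg f -> continuous f.
Proof.
elim=> {f} [f|f g _ cf _ cg|f g _ cf _ cg|f _ cf f0] => [|x|x|x].
- exact: smooth_continuous.
- by apply: continuousD; [exact: cf|exact: cg].
- by apply: continuousM; [exact: cf|exact: cg].
- by apply: continuousV; [exact: f0|exact: cf].
Qed.

Lemma smooth_alg_derivable f : smooth_alg f -> forall v x, derivable f x v.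
Proof.
elim=> {f} [f|f g _ df _ dg|f g _ df _ dg|f _ df f0] => [|v x|v x|v x].
- exact: smooth_derivable.
- exact: derivableD.
- exact: derivableM.
- exact: derivableV.
Qed.

Lemma smooth_cst (a : R) : smooth (cst a : V -> R).
Proof.
apply: (@smooth_coind (fun f => exists b, f = cst b)); last by exists a.
- by move=> _ [b ->] x; exact: cvg_cst.
- by move=> _ [b ->] v x; exact: derivable_cst.
- by move=> _ [b ->] v; exists 0; apply/funext => x; rewrite derive_cst.
Qed.

Lemma smooth_alg_derive f : smooth_alg f -> forall v, smooth_alg ('D_v f).
Proof.
elim=> {f} [f sf|f g sf IHf sg IHg|f g sf IHf sg IHg|f sf IHf f0] v.
- exact/smooth_alg_base/smooth_derive.
- rewrite (_ : 'D_v _ = 'D_v f + 'D_v g); first exact: smooth_algD.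
  by apply/funext => x; rewrite deriveD//; exact: smooth_alg_derivable.
- rewrite (_ : 'D_v _ = f * 'D_v g + g * 'D_v f).
    by apply: smooth_algD; apply: smooth_algM.
  by apply/funext => x; rewrite deriveM//; exact: smooth_alg_derivable.
- have sV := smooth_algV sf f0.
  rewrite (_ : 'D_v _ = cst (-1) * ((fun x => (f x)^-1) * (fun x => (f x)^-1) * 'D_v f)).
    apply: smooth_algM; first exact/smooth_alg_base/smooth_cst.
    by apply: smooth_algM => //; exact: smooth_algM.
  apply/funext => x; rewrite deriveV//; last exact: smooth_alg_derivable.
  by rewrite !fctE /= mulN1r /GRing.scale/= mulNr expr2 invfM.
Qed.

Lemma smooth_alg_smooth f : smooth_alg f -> smooth f.
Proof.
apply: smooth_coind; [exact: smooth_alg_continuous|exact: smooth_alg_derivable|].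
exact: smooth_alg_derive.
Qed.

Lemma smoothD f g : smooth f -> smooth g -> smooth (f + g).
Proof. by move=> sf sg; apply: smooth_alg_smooth; apply: smooth_algD; exact: smooth_alg_base. Qed.

Lemma smoothM f g : smooth f -> smooth g -> smooth (f * g).
Proof. by move=> sf sg; apply: smooth_alg_smooth; apply: smooth_algM; exact: smooth_alg_base. Qed.

Lemma smoothV f : smooth f -> (forall x, f x != 0) -> smooth (fun x => (f x)^-1).
Proof. by move=> sf f0; apply: smooth_alg_smooth; apply: smooth_algV => //; exact: smooth_alg_base. Qed.

Lemma smoothN f : smooth f -> smooth (- f).
Proof.
move=> sf; rewrite (_ : - f = cst (-1) * f).
  by apply: smoothM => //; exact: smooth_cst.
by apply/funext => x; rewrite !fctE mulN1r.
Qed.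

Lemma smooth_linear (f : {linear V -> R}) : continuous f -> smooth f.
Proof.
move=> cf.
have fd x : differentiable f x by apply: linear_differentiable; exact: cf.
apply: (@smooth_coind (fun g => g = f :> (V -> R) \/ exists b, g = cst b)); last by left.
- by move=> _ [->//|[b ->]] x; exact: cvg_cst.
- by move=> _ [->|[b ->]] v x; [exact: diff_derivable|exact: derivable_cst].
- move=> _ [->|[b ->]] v; right; [exists (f v)|exists 0]; apply/funext => x.
    by rewrite deriveE// diff_lin.
  by rewrite derive_cst.
Qed.

End smooth_functions.

Section smooth_step.
Context {R : realType}.
Implicit Types (p : {poly R}) (x : R).

Lemma smooth_id : smooth (fun x => x).
Proof.
apply: (@smooth_coind R R (fun g => g = id \/ exists b, g = cst b)); last by left.
- by move=> _ [->|[b ->]] x; [exact: cvg_id|exact: cvg_cst].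
- by move=> _ [->|[b ->]] v x; [exact: derivable_id|exact: derivable_cst].
- move=> _ [->|[b ->]] v; right; [exists v|exists 0]; apply/funext => x.
    by rewrite derive_id.
  by rewrite derive_cst.
Qed.

Lemma smooth_horner p : smooth (fun x => p.[x]).
Proof.
elim/poly_ind: p => [|p c IH].
  rewrite (_ : (fun x => _) = cst 0); first exact: smooth_cst.
  by apply/funext => x; rewrite horner0.
rewrite (_ : (fun x => _) = (fun x => p.[x]) * (fun x => x) + cst c).
  by apply: smoothD; [apply: smoothM => //; exact: smooth_id|exact: smooth_cst].
by apply/funext => x; rewrite hornerMXaddC.
Qed.

Lemma derivable_is_derive1 (f : R -> R) (x a : R) : is_derive x 1 f a ->
  forall v, is_derive x v f (v * a).
Proof.
move=> [df fa] v; have diff_f : differentiable f x by apply/derivable1_diffP.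
split; first exact: diff_derivable.
by rewrite deriveE// deriv1E// /= derive1E fa.
Qed.

Lemma is_derive_affine (a b x : R) : is_derive x 1 (fun y => a * y + b) a.
Proof. by apply: is_derive_eq; rewrite ?scaler0 ?addr0; exact: mulr1. Qed.

Lemma smooth_comp_affine (f : R -> R) (a b : R) : smooth f ->
  smooth (fun x => f (a * x + b)).
Proof.
pose P g := exists2 h : R -> R, smooth h & g = (fun x => h (a * x + b)).
move=> sf; apply: (@smooth_coind R R P); last by exists f.
- move=> _ [h sh ->] x; apply: continuous_comp; last exact: smooth_continuous.
  by apply: cvgD; [apply: cvgM; [exact: cvg_cst|exact: cvg_id]|exact: cvg_cst].
- move=> _ [h sh ->] v x.
  have dh : is_derive (a * x + b) 1 h ('D_1 h (a * x + b)).
    exact/derivableP/smooth_derivable.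
  have da := is_derive_affine a b x.
  have [? _] := derivable_is_derive1 (@is_derive1_comp R h (fun y => a * y + b) _ _ _ dh da) v.
  by [].
(* The factor [a] of the chain rule is absorbed in the direction, which keeps the derivative in the
   class [P]. *)
- move=> _ [h sh ->] v; exists ('D_(v * a) h); first exact: smooth_derive.
  apply/funext => x.
  have dh : is_derive (a * x + b) 1 h ('D_1 h (a * x + b)).
    exact/derivableP/smooth_derivable.
  have da := is_derive_affine a b x.
  have [_ ->] := derivable_is_derive1 (@is_derive1_comp R h (fun y => a * y + b) _ _ _ dh da) v.
  have [_ ->] := derivable_is_derive1 dh (v * a).
  by rewrite mulrA mulrAC.
Qed.

(* The derivatives of exp(-1/x) are of this form. *)
Definition flat p x : R := if 0 < x then p.[x^-1] * expR (- x^-1) else 0.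

(** With y = 1/x, the inequality y^(i+2) <= (i+2)! exp(y) bounds y^i exp(-y) by (i+2)! x^2. The
    power 2 makes the difference quotient of [flat p] at 0 tend to 0. *)
Lemma horner_exp_bound p : exists2 K, 0 <= K &
  forall x, 0 < x <= 1 -> `|p.[x^-1] * expR (- x^-1)| <= K * x ^+ 2.
Proof.
exists (\sum_(i < size p) `|p`_i| * i.+2`!%:R).
  by apply: sumr_ge0 => i _; rewrite mulr_ge0.
move=> x /andP[x0 x1]; rewrite horner_coef mulr_suml mulr_suml.
apply: (le_trans (ler_norm_sum _ _ _)); apply: ler_sum => i _.
rewrite !normrM -!mulrA ler_wpM2l// (ger0_norm (expR_ge0 _)).
have y0 : 0 < x^-1 by rewrite invr_gt0.
rewrite ger0_norm ?exprn_ge0 ?(ltW y0)// expRN ler_pdivrMr ?expR_gt0//.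
have yexp := expR_ge1Dxn i.+1 (ltW y0).
have {}yexp : x^-1 ^+ i.+2 <= i.+2`!%:R * expR x^-1.
  rewrite -ler_pdivrMl ?ltr0n ?fact_gt0// mulrC (le_trans _ yexp)//.
  by rewrite lerDr ler01.
rewrite -mulrA mulrCA; apply: (@le_trans _ _ (x ^+ 2 * x^-1 ^+ i.+2)).
  by rewrite -[i.+2]addn2 exprD mulrCA -exprMn divff ?gt_eqF// expr1n mulr1.
by rewrite ler_wpM2l ?sqr_ge0//.
Qed.

(** For x > 0, differentiating p(1/x) exp(-1/x) gives (p - p')(1/x) x^-2 exp(-1/x), again of the
    form [flat]; at 0 the quadratic bound takes over. *)
Lemma is_derive_flat p x : is_derive x 1 (flat p) (flat ('X^2 * (p - p^`())) x).
Proof.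
have [x0|x0|->] := ltrgtP x 0.
- have E : \near x, cst 0 x = flat p x.
    near=> y; rewrite /flat ltNge ltW//=; near: y; exact: lt_nbhsl.
  rewrite /flat ltNge ltW//=.
  exact: (near_eq_is_derive E (is_derive_cst 0 _ _)).
- have E : \near x, p.[x^-1] * expR (- x^-1) = flat p x.
    near=> y; rewrite /flat ifT//; near: y; exact: lt_nbhsr.
  rewrite /flat x0 !hornerE.
  apply: (near_eq_is_derive E).
  have x0' : x != 0 by rewrite gt_eqF.
  have dV : is_derive x 1 (fun y : R => y^-1) (- x ^- 2).
    have did : derivable (id : R -> R) x 1 by exact: derivable_id.
    split; first exact: (derivableV x0' did).
    by rewrite (deriveV x0' did) derive_id; exact: mulr1.
  have dNV : is_derive x 1 (fun y : R => - y^-1) (x ^- 2).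
    by have := is_deriveN dV; rewrite opprK.
  have dp : is_derive x 1 (fun y => p.[y^-1]) (p^`().[x^-1] * (- x ^- 2)).
    exact: (@is_derive1_comp R (horner p) (fun y => y^-1)).
  have de : is_derive x 1 (fun y => expR (- y^-1)) (expR (- x^-1) * x ^- 2).
    exact: (@is_derive1_comp R expR (fun y => - y^-1)).
  have [d1 d2] := is_deriveM dp de; split=> //.
  rewrite d2 /GRing.scale/=; field.
  by [].
- rewrite {2}/flat ltxx.
  have [K K0 pK] := horner_exp_bound p.
  have K1 : 0 < K + 1 by rewrite ltr_wpDl.
  have L : h^-1 *: ((flat p \o shift 0) (h *: 1) - flat p 0) @[h --> 0^'] --> 0.
    apply/cvgrPdist_le => e e0; near=> h; rewrite sub0r normrN /=.
    rewrite addr0 [h *: 1]mulr1 [X in _ - X]/flat ltxx subr0.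
    have h0 : h != 0 by near: h; exact: nbhs_dnbhs_neq.
    (* The quadratic bound holds up to 1; [K + 1] avoids a division by zero. *)
    have hn : `|h| < Num.min 1 (e / (K + 1)).
      near: h; apply: dnbhs0_lt; rewrite lt_min ltr01/=.
      by rewrite divr_gt0.
    move: hn; rewrite lt_min ltr_pdivlMr// => /andP[h1 he].
    rewrite normrM normfV ler_pdivrMl ?normr_gt0// /flat.
    case: ifPn => hp; last by rewrite normr0 mulr_ge0// ltW.
    move: h1 he; rewrite (gtr0_norm hp) => h1 he.
    rewrite (le_trans (pK _ _)) ?hp ?(ltW h1)//.
    rewrite expr2 mulrCA ler_wpM2l ?(ltW hp)//.
    by nra.
  split; first by apply/cvg_ex; exists 0.
  exact: cvg_lim L.
Unshelve. all: by end_near. Qed.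

Lemma smooth_flat p : smooth (flat p).
Proof.
apply: (@smooth_coind R R (fun f => exists q, f = flat q)); last by exists p.
- move=> _ [q ->] x; apply: differentiable_continuous; apply/derivable1_diffP.
  by have [] := is_derive_flat q x.
- by move=> _ [q ->] v x; have [] := derivable_is_derive1 (is_derive_flat q x) v.
- move=> _ [q ->] v; exists (v *: ('X^2 * (q - q^`()))); apply/funext => x.
  have [_ ->] := derivable_is_derive1 (is_derive_flat q x) v.
  by rewrite /flat; case: ifP => _; rewrite ?mulr0// hornerZ mulrA.
Qed.

(** The standard smooth transition from 0 on x <= 0 to 1 on x >= 1; [flat 1 x] is exp(-1/x) for x >
    0. *)
Definition smooth_step x := flat 1 x / (flat 1 x + flat 1 (1 - x)).

Lemma flat1_gt0 x : 0 < x -> 0 < flat 1 x.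
Proof. by move=> x0; rewrite /flat x0 hornerC mul1r expR_gt0. Qed.

Lemma flat_le0 p x : x <= 0 -> flat p x = 0.
Proof. by rewrite /flat ltNge => ->. Qed.

Lemma flat1_ge0 x : 0 <= flat 1 x.
Proof. by have [/flat1_gt0/ltW//|/flat_le0->] := ltP 0 x. Qed.

Lemma smooth_step_denom_gt0 x : 0 < flat 1 x + flat 1 (1 - x).
Proof.
have [/flat1_gt0 x0|x0] := ltP 0 x; first exact: ltr_wpDr (flat1_ge0 _) x0.
by rewrite flat_le0// add0r flat1_gt0// subr_gt0 (le_lt_trans x0).
Qed.

Lemma smooth_smooth_step : smooth smooth_step.
Proof.
have sr : smooth (fun x => flat 1 (1 - x)).
  rewrite (_ : (fun x => _) = (fun x => flat 1 (-1 * x + 1))).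
    exact: smooth_comp_affine (smooth_flat 1).
  by apply/funext => x; congr flat; rewrite mulN1r addrC.
apply: smoothM; first exact: smooth_flat.
apply: smoothV; first by apply: smoothD => //; exact: smooth_flat.
by move=> x; rewrite gt_eqF// smooth_step_denom_gt0.
Qed.

Lemma smooth_step_le0 x : x <= 0 -> smooth_step x = 0.
Proof. by move=> x0; rewrite /smooth_step flat_le0// mul0r. Qed.

Lemma smooth_step_ge1 x : 1 <= x -> smooth_step x = 1.
Proof.
move=> x1; rewrite /smooth_step (@flat_le0 _ (1 - x)) ?subr_le0// addr0 divff//.
by rewrite gt_eqF// flat1_gt0// (lt_le_trans ltr01).
Qed.

Lemma smooth_step_norm x : `|smooth_step x| <= 1.
Proof.
rewrite ger0_norm; first by rewrite ler_pdivrMr ?smooth_step_denom_gt0// mul1r lerDl flat1_ge0.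
by rewrite divr_ge0 ?flat1_ge0// ltW// smooth_step_denom_gt0.
Qed.

Lemma derive_smooth_step0 x : x < 0 \/ 1 < x -> derive1 smooth_step x = 0.
Proof.
rewrite derive1E => -[x0|x1].
- rewrite (@near_eq_derive R R R _ (cst (0 : R))) ?derive_cst//.
  near=> y; rewrite smooth_step_le0// ltW//; near: y; exact: lt_nbhsl.
- rewrite (@near_eq_derive R R R _ (cst (1 : R))) ?derive_cst//.
  near=> y; rewrite smooth_step_ge1// ltW//; near: y; exact: lt_nbhsr.
Unshelve. all: by end_near. Qed.

End smooth_step.

(** * Integration by parts for weak derivatives in time *)

Section weak_time_derivative.
Context {R : realType}.
Implicit Types (f g h k : R -> R) (a b c x : R) (p : {poly R}).

Lemma derive1_smooth_continuous f : smooth f -> continuous (derive1 f).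
Proof.
move=> sf; rewrite (_ : derive1 f = 'D_1 f).
  by apply: smooth_continuous; exact: smooth_derive.
by apply/funext => x; rewrite derive1E.
Qed.

Lemma Rintegral_derive1 f a b : smooth f -> a < b ->
  \int[lebesgue_measure]_(x in `[a, b]) derive1 f x = f b - f a.
Proof.
move=> sf ab; rewrite /Rintegral (@continuous_FTC2 _ _ f)//.
- by move=> x; apply: continuous_subspaceT; exact: derive1_smooth_continuous.
- split.
  + by move=> x _; exact: smooth_derivable.
  + by apply: cvg_at_right_filter; exact: smooth_continuous.
  + by apply: cvg_at_left_filter; exact: smooth_continuous.
Qed.

Lemma derive1_smooth_step_bounded : exists2 K, 0 < K & forall x, `|derive1 smooth_step x| <= K :> R.
Proof.
have [|c _ cP] := @EVT_max R (fun x => `|derive1 smooth_step x|) 0 1 ler01.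
  move=> x; apply: continuous_subspaceT => y.
  apply: cvg_norm; exact: derive1_smooth_continuous smooth_smooth_step _.
(* The added 1 makes the bound positive: tolerances are divided by it in [cvg_window_average]. *)
exists (`|derive1 smooth_step c| + 1); first by rewrite ltr_wpDl.
move=> x; have [x01|x01] := boolP (x \in `[0, 1]).
  by rewrite (le_trans (cP x x01))// lerDl.
rewrite derive_smooth_step0 ?normr0 ?addr_ge0//.
move: x01; rewrite in_itv/= negb_and -!ltNge => /orP[]; [by left|by right].
Qed.

(** The step rises on [c, c + e]. It is written as a composition with an affine map to fit
    [smooth_comp_affine]. *)
Definition scaled_step c e x : R := smooth_step (e^-1 * x + (- (e^-1 * c))).

Lemma scaled_stepE c e x : scaled_step c e x = smooth_step ((x - c) / e).
Proof. by rewrite /scaled_step -mulrBr mulrC. Qed.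

Lemma smooth_scaled_step c e : smooth (scaled_step c e).
Proof. exact: smooth_comp_affine smooth_smooth_step. Qed.

Lemma derive1_scaled_step c e x :
  derive1 (scaled_step c e) x = e^-1 * derive1 smooth_step ((x - c) / e).
Proof.
have ds : is_derive (e^-1 * x + - (e^-1 * c)) 1 smooth_step
    ('D_1 smooth_step (e^-1 * x + - (e^-1 * c))).
  exact/derivableP/smooth_derivable/smooth_smooth_step.
have da := is_derive_affine e^-1 (- (e^-1 * c)) x.
have [_ d] := @is_derive1_comp R smooth_step (fun y => e^-1 * y + - (e^-1 * c)) _ _ _ ds da.
have -> : (x - c) / e = e^-1 * x - e^-1 * c by rewrite -mulrBr mulrC.
by rewrite derive1E [LHS]d mulrC derive1E.
Qed.

Lemma scaled_step_le c e x : 0 < e -> x <= c -> scaled_step c e x = 0.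
Proof.
by move=> e0 xc; rewrite scaled_stepE smooth_step_le0// ler_pdivrMr// mul0r subr_le0.
Qed.

Lemma scaled_step_ge c e x : 0 < e -> c + e <= x -> scaled_step c e x = 1.
Proof.
by move=> e0 xc; rewrite scaled_stepE smooth_step_ge1// ler_pdivlMr// mul1r lerBrDl.
Qed.

Lemma derive1_scaled_step0 c e x : 0 < e -> x \notin `[c, c + e] ->
  derive1 (scaled_step c e) x = 0.
Proof.
move=> e0 xc; rewrite derive1_scaled_step derive_smooth_step0 ?mulr0//.
rewrite ltr_pdivrMr// ltr_pdivlMr// mul0r mul1r subr_lt0 ltrBrDl.
by move: xc; rewrite in_itv/= negb_and -!ltNge => /orP[]; [left|right].
Qed.

Lemma integrable_continuous_itv f a b : {within `[a, b], continuous f} ->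
  lebesgue_measure.-integrable `[a, b] (EFin \o f).
Proof. by move=> cf; apply: continuous_compact_integrable => //; exact: segment_compact. Qed.

(** The derivative of the step is an approximate point mass: it lives on [c, c + e], has integral 1
    and size at most K / e. Integrated against g - l it gives at most e (K / e) eps. *)
Lemma scaled_step_average (K : R) : (forall x, `|derive1 smooth_step x| <= K) ->
  forall (D : set R) g c e l eps, 0 < e -> `[c, c + e] `<=` D ->
  {within `[c, c + e], continuous g} ->
  (forall x, x \in `[c, c + e] -> `|g x - l| <= eps) ->
  `|\int[lebesgue_measure]_(x in D) (derive1 (scaled_step c e) x * g x) - l|
    <= K * eps.
Proof.
move=> sK D g c e l eps e0 cD cg gl.
set s := derive1 (scaled_step c e).
have cs : continuous s by exact/derive1_smooth_continuous/smooth_scaled_step.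
have -> : \int[lebesgue_measure]_(x in D) (s x * g x) =
    \int[lebesgue_measure]_(x in `[c, c + e]) (s x * g x).
  rewrite Rintegral_mkcond [RHS]Rintegral_mkcond; apply: eq_Rintegral => x _.
  rewrite !patchE; have [xc|xc] := boolP (x \in `[c, c + e]).
    by rewrite !mem_set//; exact: cD.
  rewrite [in RHS]ifF; last by apply/negbTE; apply: contra xc => /set_mem.
  by case: ifP => // _; rewrite /s derive1_scaled_step0// mul0r.
have s1 : \int[lebesgue_measure]_(x in `[c, c + e]) s x = 1.
  rewrite Rintegral_derive1 ?ltrDl//; last exact: smooth_scaled_step.
  by rewrite scaled_step_ge// scaled_step_le// subr0.
have Is : lebesgue_measure.-integrable `[c, c + e] (EFin \o s).
  by apply: integrable_continuous_itv; exact: continuous_subspaceT.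
have Isg : lebesgue_measure.-integrable `[c, c + e] (EFin \o (fun x => s x * g x)).
  apply: integrable_continuous_itv => x; apply: cvgM; last exact: cg.
  by apply: continuous_subspaceT; exact: cs.
have Il : lebesgue_measure.-integrable `[c, c + e] (EFin \o (fun x => l * s x)).
  by rewrite (_ : EFin \o _ = (fun x => l%:E * (s x)%:E)%E)//; exact: integrableZl.
have -> : \int[lebesgue_measure]_(x in `[c, c + e]) (s x * g x) - l =
    \int[lebesgue_measure]_(x in `[c, c + e]) (s x * g x - l * s x).
  by rewrite RintegralB// RintegralZl// s1 mulr1.
have Id : lebesgue_measure.-integrable `[c, c + e] (EFin \o (fun x => s x * g x - l * s x)).
  rewrite (_ : EFin \o _ = (fun x => (s x * g x)%:E - (l * s x)%:E)%E)//.
  exact: integrableB.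
apply: (le_trans (le_normr_Rintegral _ Id)) => //.
apply: (@le_trans _ _ (\int[lebesgue_measure]_(x in `[c, c + e]) cst (e^-1 * K * eps) x)).
  apply: le_Rintegral => //.
  - exact: integrable_norm.
  - by apply: integrable_continuous_itv; apply: continuous_subspaceT => x; exact: cvg_cst.
  move=> x xc; rewrite mulrC -mulrBl normrM mulrC.
  apply: ler_pM => //; last exact: gl.
  rewrite /s derive1_scaled_step normrM gtr0_norm ?invr_gt0//.
  by rewrite ler_wpM2l ?invr_ge0 ?(ltW e0).
have itvE : lebesgue_measure (`[c, c + e] : set R) = e%:E.
  by rewrite lebesgue_measure_itv/= lte_fin ltrDl e0 -EFinB addrAC subrr add0r.
rewrite Rintegral_cst// [X in fine X](_ : _ = e%:E)/=; last exact: itvE.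
by rewrite mulrC !mulrA divff ?gt_eqF// mul1r.
Qed.

Lemma measurable_fun_TypeR f : measurable_fun setT f ->
  measurable_fun (setT : set (measurableTypeR R)) f.
Proof. by move=> mf mT Y mY; exact: (mf mT Y mY). Qed.

Lemma cvg_Rintegral_mul (D : set (measurableTypeR R)) (X : nat -> R -> R) (X0 k : R -> R)
    (B : R) : measurable D ->
  (forall n, measurable_fun setT (X n)) -> measurable_fun setT X0 ->
  (forall n x, `|X n x| <= B) ->
  (forall x, D x -> X n x @[n --> \oo] --> X0 x) ->
  lebesgue_measure.-integrable D (EFin \o k) ->
  \int[lebesgue_measure]_(x in D) (X n x * k x) @[n --> \oo] -->
    \int[lebesgue_measure]_(x in D) (X0 x * k x).
Proof.
move=> mD mX mX0 XB XX0 Ik.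
have [mk _] := integrableP _ _ _ Ik.
have mk' : measurable_fun D k by exact/measurable_EFinP.
have mXk n : measurable_fun D (fun x => (X n x * k x)%:E).
  apply/measurable_EFinP; apply: measurable_funM => //.
  have mXn := measurable_funTS (measurable_fun_TypeR (mX n)); exact: mXn.
have mX0k : measurable_fun D (fun x => (X0 x * k x)%:E).
  apply/measurable_EFinP; apply: measurable_funM => //.
  exact: (measurable_funTS (measurable_fun_TypeR mX0)).
have [|||I0 _ cvgI] := @dominated_convergence _ _ _ lebesgue_measure D mD
    (fun n x => (X n x * k x)%:E) (fun x => (X0 x * k x)%:E)
    (fun x => (B%:E * `|(k x)%:E|)%E) mXk mX0k.
- apply: aeW => x Dx; apply: cvg_EFin; first by near=> n.
  by apply: cvgMl; exact: XX0.
- by apply: integrableZl => //; exact: integrable_abse.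
- apply: aeW => x n Dx; rewrite !abse_EFin -EFinM lee_fin normrM.
  by rewrite ler_wpM2r.
rewrite /Rintegral; apply: fine_cvg; rewrite fineK; first exact: cvgI.
exact: integrable_fin_num.
Unshelve. all: by end_near. Qed.

(* A test function on ]a, b[ that tends to the indicator of ]a, b[. *)
Definition window a b (n : nat) x : R :=
  let e := (b - a) / 4 / n.+1%:R in
  scaled_step (a + e) e x - scaled_step (b - 2 * e) e x.

(** The window rises on [a + e, a + 2e] and falls on [b - 2e, b - e]. This bound puts the rise
    before the fall; the margins of width e keep the support compact in ]a, b[. *)
Lemma window_width n a b : a < b -> 4 * ((b - a) / 4 / n.+1%:R) <= b - a.
Proof.
move=> ab; have -> : 4 * ((b - a) / 4 / n.+1%:R) = (b - a) / n.+1%:R.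
  by field; rewrite ?nat1r ?natr1 pnatr_eq0.
by rewrite ler_pdivrMr// ler_peMr ?subr_ge0 ?(ltW ab)// ler1n.
Qed.

Lemma window_itv a b n x : a < b -> let e := (b - a) / 4 / n.+1%:R in
  x \notin `[a + e, b - e] -> window a b n x = 0.
Proof.
move=> ab e; have e0 : 0 < e by rewrite !divr_gt0 ?subr_gt0.
have e4 : 4 * e <= b - a := window_width n ab.
rewrite in_itv/= negb_and -!ltNge /window -/e => /orP[xa|xb].
  by rewrite !scaled_step_le ?subrr//; lra.
by rewrite !scaled_step_ge ?subrr//; lra.
Qed.

Lemma smooth_window a b n : smooth (window a b n).
Proof. by apply: smoothD; [|apply: smoothN]; exact: smooth_scaled_step. Qed.

Lemma window_norm a b n x : `|window a b n x| <= 2.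
Proof.
rewrite (le_trans (ler_normB _ _))// -[leRHS]/(1 + 1) lerD//.
all: by rewrite scaled_stepE smooth_step_norm.
Qed.

Lemma window_cvg a b x : a < b ->
  window a b n x @[n --> \oo] --> (\1_(`]a, b[ : set R) x : R).
Proof.
move=> ab; pose e n : R := (b - a) / 4 / n.+1%:R.
have e0 n : 0 < e n by rewrite !divr_gt0 ?subr_gt0.
have [xab|xab] := boolP (x \in `]a, b[); last first.
  rewrite indicE mem_setE (negbTE xab).
  apply: cvg_near_cst; near=> n.
  apply: window_itv => //; apply: contra xab; rewrite !in_itv/= => /andP[ax xb].
  by rewrite (lt_le_trans _ ax) ?ltrDl ?e0//= (le_lt_trans xb)// gtrBl e0.
rewrite indicE mem_setE xab; move: xab; rewrite in_itv/= => /andP[ax xb].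
have e_cvg : e n @[n --> \oo] --> 0.
  by rewrite -(mulr0 ((b - a) / 4)); apply: cvgMr; exact: cvg_harmonic.
apply: cvg_near_cst; near=> n.
(* Once 2e is at most x - a and b - x, the rise is over at x and the fall has not begun, so the
   window equals 1 there. *)
have eax : e n <= (x - a) / 2.
  near: n; move/cvgr_le : e_cvg; apply.
  by rewrite divr_gt0 ?subr_gt0.
have exb : e n <= (b - x) / 2.
  near: n; move/cvgr_le : e_cvg; apply.
  by rewrite divr_gt0 ?subr_gt0.
rewrite /window -/(e n) scaled_step_ge//; last by lra.
by rewrite scaled_step_le ?subr0//; lra.
Unshelve. all: by end_near. Qed.

Definition weak_derivative (T : R) g h := forall eta, test_function (`]0, T[) eta ->
  \int[lebesgue_measure]_(t in `]0, T[) (derive1 eta t * g t) =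
  - \int[lebesgue_measure]_(t in `]0, T[) (eta t * h t).

(** The two pieces of the derivative of the window tend to point masses at a and b. Both approach
    from inside [a, b], so that a = 0 and b = T are allowed. *)
Lemma cvg_window_average (T : R) g a b :
  0 <= a -> a < b -> b <= T -> {within `[0, T], continuous g} ->
  let e n : R := (b - a) / 4 / n.+1%:R in
  \int[lebesgue_measure]_(t in `]0, T[) (derive1 (scaled_step (a + e n) (e n)) t * g t)
    @[n --> \oo] --> g a /\
  \int[lebesgue_measure]_(t in `]0, T[) (derive1 (scaled_step (b - 2 * e n) (e n)) t * g t)
    @[n --> \oo] --> g b.
Proof.
move=> a0 ab bT cg e.
have e0 n : 0 < e n by rewrite !divr_gt0 ?subr_gt0.
have e4 n : 4 * e n <= b - a := window_width n ab.
have e_cvg : e n @[n --> \oo] --> 0.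
  by rewrite -(mulr0 ((b - a) / 4)); apply: cvgMr; exact: cvg_harmonic.
have [K K0 sK] := derive1_smooth_step_bounded.
have gz (z eps : R) : z \in `[0, T] -> 0 < eps ->
    exists2 r, 0 < r & forall x, x \in `[0, T] -> `|x - z| < r -> `|g x - g z| <= eps.
  move=> zT eps0; move/subspace_continuousP: cg => /(_ z zT)/cvgrPdist_le/(_ eps eps0).
  move=> /nbhs_ballP[r /= r0 gr]; exists r => // x xT xr.
  by rewrite distrC; apply: gr => //=; rewrite /ball/= distrC.
split; apply/cvgrPdist_le => eps eps0.
- have [|//|r r0 gr] := gz a (eps / K); first by rewrite in_itv/= a0 (le_trans (ltW ab)).
    by rewrite divr_gt0.
  near=> n.
  (* The averaging interval [a + e, a + 2e] then lies within r of a. The tolerance eps / K offsets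
     the factor K of [scaled_step_average]. *)
  have er : e n < r / 2 by near: n; move/cvgr_lt : e_cvg; apply; rewrite divr_gt0.
  rewrite distrC (le_trans (@scaled_step_average _ sK _ _ _ _ _ (eps / K) _ _ _ _))//.
  + move=> x; rewrite /= !in_itv/= => /andP[? ?]; move: (e0 n) (e4 n) => ? ?.
    by apply/andP; split; lra.
  + apply: continuous_subspaceW cg => x; rewrite /= !in_itv/= => /andP[? ?].
    by move: (e0 n) (e4 n) => ? ?; apply/andP; split; lra.
  + move=> x; rewrite in_itv/= => /andP[? ?]; move: (e0 n) (e4 n) => ? ?.
    apply: gr; first by rewrite in_itv/=; apply/andP; split; lra.
    by rewrite ltr_norml; apply/andP; split; lra.
  + by rewrite mulrC divfK// gt_eqF.
- have [|//|r r0 gr] := gz b (eps / K); first by rewrite in_itv/= bT (le_trans a0 (ltW ab)).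
    by rewrite divr_gt0.
  near=> n.
  have er : e n < r / 2 by near: n; move/cvgr_lt : e_cvg; apply; rewrite divr_gt0.
  rewrite distrC (le_trans (@scaled_step_average _ sK _ _ _ _ _ (eps / K) _ _ _ _))//.
  + move=> x; rewrite /= !in_itv/= => /andP[? ?]; move: (e0 n) (e4 n) => ? ?.
    by apply/andP; split; lra.
  + apply: continuous_subspaceW cg => x; rewrite /= !in_itv/= => /andP[? ?].
    by move: (e0 n) (e4 n) => ? ?; apply/andP; split; lra.
  + move=> x; rewrite in_itv/= => /andP[? ?]; move: (e0 n) (e4 n) => ? ?.
    apply: gr; first by rewrite in_itv/=; apply/andP; split; lra.
    by rewrite ltr_norml; apply/andP; split; lra.
  + by rewrite mulrC divfK// gt_eqF.
Unshelve. all: by end_near. Qed.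

Lemma test_function_window (T : R) p a b n : 0 <= a -> a < b -> b <= T ->
  test_function (`]0, T[) (fun x => p.[x] * window a b n x).
Proof.
move=> a0 ab bT.
pose e : R := (b - a) / 4 / n.+1%:R.
have e0 : 0 < e by rewrite !divr_gt0 ?subr_gt0.
have supp : closure [set x | p.[x] * window a b n x != 0] `<=` `[a + e, b - e].
  rewrite (_ : `[a + e, b - e]%classic = closure `[a + e, b - e]); last first.
    by apply/closure_id; exact: interval_closed.
  apply: closureS => x /= px; apply: contraNT px => xab.
  by rewrite (window_itv ab xab) mulr0.
split.
- by apply: smoothM; [exact: smooth_horner|exact: smooth_window].
- apply: subclosed_compact supp; first exact: closed_closure.
  exact: segment_compact.
- apply: (subset_trans supp) => x; rewrite /= !in_itv/= => /andP[? ?].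
  by apply/andP; split; lra.
Qed.

Lemma derive1_horner p x : derive1 (horner p) x = p^`().[x].
Proof. by rewrite derive1E derive_val. Qed.

Lemma measurable_smooth f : smooth f -> measurable_fun setT f.
Proof. by move=> sf; apply: continuous_measurable_fun; exact: smooth_continuous. Qed.

Lemma integrable_continuousM (D : set (measurableTypeR R)) (T : R) f k :
  measurable D -> 0 <= T -> D `<=` `[0, T] -> continuous f ->
  lebesgue_measure.-integrable D (EFin \o k) ->
  lebesgue_measure.-integrable D (EFin \o (fun t => f t * k t)).
Proof.
move=> mD T0 DT cf Ik.
have [|c _ cP] := @EVT_max R (fun x => `|f x|) 0 T T0.
  by move=> x; apply: cvg_norm; exact: continuous_subspaceT.
have [mk _] := integrableP _ _ _ Ik.
apply: (le_integrable mD _ _ (integrableZl mD `|f c| Ik)).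
  apply/measurable_EFinP; apply: measurable_funM; last exact/measurable_EFinP.
  have mf := measurable_funTS (measurable_fun_TypeR (continuous_measurable_fun cf)).
  exact: mf.
move=> x xT; rewrite /= lee_fin !normrM ler_wpM2r// normr_id cP//.
exact: DT.
Qed.

(** The product of p and the window is an admissible test function. In the limit the derivative of p
    yields the integral over ]a, b], and the derivatives of the two steps yield the boundary values
    of p g. *)
Lemma weak_derivative_by_parts (T : R) g h p a b :
  {within `[0, T], continuous g} ->
  lebesgue_measure.-integrable `]0, T[ (EFin \o h) -> weak_derivative T g h ->
  0 <= a -> a < b -> b <= T ->
  \int[lebesgue_measure]_(t in `]a, b]) (p.[t] * h t) =
  p.[b] * g b - p.[a] * g a - \int[lebesgue_measure]_(t in `]a, b]) (p^`().[t] * g t).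
Proof.
move=> cg Ih gh a0 ab bT.
have mT : measurable (`]0, T[ : set (measurableTypeR R)) by exact: measurable_itv.
have Ig : lebesgue_measure.-integrable `]0, T[ (EFin \o g).
  apply: integrableS (integrable_continuous_itv cg) => //.
  by apply: subset_itv; rewrite bnd_simp.
have T0 : 0 <= T by rewrite (le_trans a0)// (le_trans (ltW ab)).
have sT : (`]0, T[ : set R) `<=` `[0, T] by apply: subset_itv; rewrite bnd_simp.
have chorner (q : {poly R}) : continuous (fun x : R => q.[x]).
  by apply: smooth_continuous; exact: smooth_horner.
have Ipk q k (Ik : lebesgue_measure.-integrable `]0, T[ (EFin \o k)) :=
  integrable_continuousM mT T0 sT (chorner q) Ik.
pose W n := window a b n.
pose e n : R := (b - a) / 4 / n.+1%:R.
have WI k : lebesgue_measure.-integrable `]0, T[ (EFin \o k) ->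
    \int[lebesgue_measure]_(x in `]0, T[) (W n x * k x) @[n --> \oo] -->
    \int[lebesgue_measure]_(t in `]a, b]) k t.
  move=> Ik.
  have sub : `]a, b[ `<=` `]0, T[.
    by apply: subset_itv; rewrite bnd_simp.
  have -> : \int[lebesgue_measure]_(t in `]a, b]) k t =
      \int[lebesgue_measure]_(x in `]0, T[) (\1_(`]a, b[ : set R) x * k x).
    rewrite -Rintegral_itv_bndo_bndc; last first.
      exact: (@integrableS _ (measurableTypeR R) R lebesgue_measure _ _ _ mT _ sub Ik).
    rewrite Rintegral_mkcond [RHS]Rintegral_mkcond; apply: eq_Rintegral => x _.
    rewrite !patchE indicE; case: ifPn => xab.
      by rewrite ifT ?mul1r//; apply/mem_set/sub/set_mem.
    by rewrite mul0r if_same.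
  apply: (@cvg_Rintegral_mul _ _ _ _ 2) => //.
  - by move=> n; apply: measurable_smooth; exact: smooth_window.
  - exact: window_norm.
  - by move=> x _; exact: window_cvg.
have IW k n (Ik : lebesgue_measure.-integrable `]0, T[ (EFin \o k)) :=
  integrable_continuousM mT T0 sT (smooth_continuous (smooth_window a b n)) Ik.
have Is c r k (Ik : lebesgue_measure.-integrable `]0, T[ (EFin \o k)) :=
  integrable_continuousM mT T0 sT (derive1_smooth_continuous (smooth_scaled_step c r)) Ik.
have dW n x : derive1 (fun x => p.[x] * W n x) x = W n x * p^`().[x] +
   (derive1 (scaled_step (a + e n) (e n)) x - derive1 (scaled_step (b - 2 * e n) (e n)) x) * p.[x].
  rewrite derive1E (@deriveM R R (fun x => p.[x]) (W n)); last 2 first.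
  - by apply: smooth_derivable; exact: smooth_horner.
  - by apply: smooth_derivable; exact: smooth_window.
  rewrite -!derive1E derive1_horner /GRing.scale/= addrC; congr (_ + _).
  rewrite mulrC; congr (_ * _).
  rewrite derive1E (@deriveB R R R (scaled_step (a + e n) (e n)) (scaled_step (b - 2 * e n) (e n))) -?derive1E//.
  - by apply: smooth_derivable; exact: smooth_scaled_step.
  - by apply: smooth_derivable; exact: smooth_scaled_step.
have lhsE n : \int[lebesgue_measure]_(x in `]0, T[) (derive1 (fun x => p.[x] * W n x) x * g x) =
    \int[lebesgue_measure]_(x in `]0, T[) (W n x * (p^`().[x] * g x)) +
    (\int[lebesgue_measure]_(x in `]0, T[) (derive1 (scaled_step (a + e n) (e n)) x * (p.[x] * g x)) -
     \int[lebesgue_measure]_(x in `]0, T[) (derive1 (scaled_step (b - 2 * e n) (e n)) x * (p.[x] * g x))).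
  rewrite -RintegralB//; [|by apply: Is; exact: Ipk..].
  rewrite -RintegralD//; [|by apply: IW; exact: Ipk|]; last first.
    rewrite (_ : EFin \o _ = (fun x => (derive1 (scaled_step (a + e n) (e n)) x * (p.[x] * g x))%:E
        - (derive1 (scaled_step (b - 2 * e n) (e n)) x * (p.[x] * g x))%:E)%E)//.
    by apply: integrableB => //; apply: Is; exact: Ipk.
  by apply: eq_Rintegral => x _; rewrite dW; ring.
have cpg : {within `[0, T], continuous (fun x => p.[x] * g x)}.
  move=> x; apply: cvgM; last exact: cg.
  by apply: continuous_subspaceT; exact: chorner.
have [La Lb] := cvg_window_average a0 ab bT cpg.
have L1 := cvgD (WI _ (Ipk p^`() g Ig)) (cvgB La Lb).
have L2 := cvgN (WI _ (Ipk p h Ih)).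
have : \int[lebesgue_measure]_(t in `]a, b]) (p^`().[t] * g t) + (p.[a] * g a - p.[b] * g b) =
    - \int[lebesgue_measure]_(t in `]a, b]) (p.[t] * h t).
  have <- := cvg_lim (@Rhausdorff R) (L1 _ _); have <- := cvg_lim (@Rhausdorff R) (L2 _).
  congr (lim (_ @ \oo)).
  apply/funext => n; apply: (eq_trans (esym (lhsE n))).
  rewrite gh; last exact: test_function_window.
  by congr (- _); apply: eq_Rintegral => x _; rewrite mulrA (mulrC p.[x]).
by move=> E; rewrite -[LHS]opprK -E; ring.
Qed.

End weak_time_derivative.

(** * Measurability, norms and coordinates on R^d *)

Section rV_functions.
Context {R : realType} {d : nat}.

Lemma continuous_measurable_rV (f : 'rV[R]_d -> R) :
  continuous f -> measurable_fun setT f.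
Proof.
move=> /continuousP cf.
apply: (measurability (@RGenOpens.G R)); first exact: RGenOpens.measurableE.
move=> _ [_ [a [b ->]] <-]; rewrite setTI.
by apply: open_measurable_rV; apply: cf; exact: interval_open.
Qed.

Definition coor (j : 'I_d) (x : 'rV[R]_d) : R := x 0 j.

Lemma coor_is_linear j : linear (coor j).
Proof. by move=> a u v; rewrite /coor !mxE. Qed.

HB.instance Definition _ j :=
  GRing.isLinear.Build R 'rV[R]_d R _ (coor j) (@coor_is_linear j).

Lemma coor_continuous j : continuous (coor j).
Proof. exact: coord_continuous. Qed.

Lemma normL2_lty_L2mx (Omega : set 'rV[R]_d) m n (u : 'rV[R]_d -> 'M[R]_(m, n)) :
  measurable Omega -> (forall i j, measurable_fun Omega (fun x => u x i j)) ->
  (normL2 Omega u < +oo)%E -> L2mx (lebesgue_rV d) Omega u.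
Proof.
move=> mO mu uoo i j; split=> //.
have mf : measurable_fun Omega (fun x => frob (u x) (u x)).
  apply: measurable_sum => k; apply: measurable_sum => l.
  exact: measurable_funM.
have : (lebesgue_rV d).-integrable Omega (fun x => (frob (u x) (u x))%:E).
  apply/integrableP; split; first exact/measurable_EFinP.
  under eq_integral do rewrite gee0_abs ?lee_fin ?frob_ge0//.
  move: uoo; rewrite /normL2; case: (integral _ _ _) => [r _||]/=.
  - exact: ltry.
  - by rewrite ifF// invr_eq0 pnatr_eq0.
  - by [].
apply: (le_integrable mO).
  by apply/measurable_EFinP; exact: measurable_funX.
move=> z _; rewrite !abse_EFin lee_fin normrX real_normK ?num_real// ger0_norm ?frob_ge0//.
rewrite /frob (bigD1 i)//= (bigD1 j)//= -expr2 -addrA lerDl addr_ge0//.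
  by apply: sumr_ge0 => k _; rewrite -expr2 sqr_ge0.
by apply: sumr_ge0 => k _; apply: sumr_ge0 => l _; rewrite -expr2 sqr_ge0.
Qed.

Lemma normL2E (Omega : set 'rV[R]_d) m n (u : 'rV[R]_d -> 'M[R]_(m, n)) :
  measurable Omega -> L2mx (lebesgue_rV d) Omega u ->
  normL2 Omega u = (L2norm (lebesgue_rV d) Omega u)%:E.
Proof. by move=> mO Lu; rewrite /normL2 integral_frob// poweR_ip. Qed.

Lemma partial_coorM j (f : 'rV[R]_d -> R) x : smooth f ->
  partial j (coor j * f) x = f x + coor j x * partial j f x.
Proof.
move=> sf; rewrite /partial deriveM.
- rewrite addrC; congr (_ + _); rewrite deriveE; last first.
    by apply: linear_differentiable; exact: coor_continuous.
  rewrite diff_lin; last exact: coor_continuous.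
  transitivity (f x * 1); last exact: mulr1.
  by congr (_ * _); rewrite [LHS]mxE !eqxx.
- by apply: diff_derivable; apply: linear_differentiable; exact: coor_continuous.
- exact: smooth_derivable.
Qed.

Lemma test_function_coorM (O : set 'rV[R]_d) j (f : 'rV[R]_d -> R) :
  test_function O f -> test_function O (coor j * f).
Proof.
move=> [sf cf fO].
have sub : closure [set x | (coor j * f) x != 0] `<=` closure [set x | f x != 0].
  by apply: closureS => x /=; rewrite mulf_eq0 negb_or => /andP[].
split.
- by apply: smoothM => //; apply: smooth_linear; exact: coor_continuous.
- by apply: subclosed_compact sub => //; exact: closed_closure.
- exact: subset_trans fO.
Qed.

End rV_functions.

(** * Fields of H^1_0 with vanishing gradient *)

Section zero_gradient.
Context {R : realType} {d : nat} (Omega : set 'rV[R]_d) (j : 'I_d).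
Hypotheses (mO : measurable Omega) (bO : bounded_set Omega).
Local Notation mu := (lebesgue_rV d).
Local Notation ip := (L2inner mu Omega).
Local Notation L2norm := (L2norm mu Omega).

Lemma bounded_coor : exists2 B, 0 <= B & forall x, Omega x -> `|coor j x| <= B.
Proof.
have [M [_ MP]] := bO; exists (`|M| + 1) => // x Ox.
have xM := MP (`|M| + 1) _ x Ox; apply: (le_trans _ (xM _)); last first.
  by rewrite (le_lt_trans (ler_norm M))// ltrDl.
rewrite [leRHS]mx_normrE; exact: (le_bigmax _ (fun ij => `|x ij.1 ij.2|) (0, j)).
Qed.

(** Test the weak gradient of z, which is zero, with x_j phi_i and expand d_j (x_j phi_i) = phi_i +
    x_j d_j phi_i. *)
Lemma weak_grad_coor (z : sob R d) (phi : 'rV[R]_d -> 'rV[R]_d) :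
  H1 Omega z -> {ae mu, forall x, Omega x -> z.2 x = 0} ->
  (forall i, test_function Omega (fun x => phi x 0 i)) ->
  L2mx mu Omega phi ->
  L2mx mu Omega (fun x => \row_i (coor j x * grad phi x i j)) ->
  ip z.1 phi = - ip z.1 (fun x => \row_i (coor j x * grad phi x i j)).
Proof.
move=> [Lz Lgz wz] gz0 tphi Lphi Lq.
have ipE (v : 'rV[R]_d -> 'rV[R]_d) : L2mx mu Omega v ->
    ip z.1 v = \sum_i \int[mu]_(x in Omega) (z.1 x 0 i * v x 0 i).
  move=> Lv; rewrite -Rintegral_sum//; last by move=> i; exact: L2_mul_integrable.
  by apply: eq_Rintegral => x _; rewrite /frob big_ord1.
rewrite !ipE// -sumrN; apply: eq_bigr => i _.
have [sphi _ _] := tphi i.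
have := wz _ (test_function_coorM j (tphi i)) i j.
have -> : \int[mu]_(x in Omega) (z.2 x i j * (coor j * (fun x => phi x 0 i)) x) = 0.
  rewrite /Rintegral (@ae_eq_integral _ _ _ _ _ (fun=> 0%:E)) ?integral0//.
    apply/measurable_EFinP; apply: measurable_funM; first by have [] := Lgz i j.
    apply: measurable_funTS; apply: continuous_measurable_rV; apply: smooth_continuous.
    by have [] := test_function_coorM j (tphi i).
  by apply: filterS gz0 => x /[apply] ->; rewrite mxE mul0r.
rewrite oppr0 => wz0.
apply/eqP; rewrite -subr_eq0 opprK -RintegralD//; last 2 first.
- exact: L2_mul_integrable.
- exact: L2_mul_integrable.
rewrite -[X in _ == X]wz0; apply/eqP/eq_Rintegral => x _.
by rewrite partial_coorM// !mxE -mulrDr.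
Qed.

(* By [weak_grad_coor] with phi -> z in H^1, (z, z) is the limit of
   - (z, x_j d_j phi), which vanishes as grad phi -> grad z = 0. *)
Lemma H10_zero_gradient (z : sob R d) : H10 Omega z -> ip z.2 z.2 = 0 ->
  ip z.1 z.1 = 0.
Proof.
move=> [Hz aprx] gz0; have [Lz Lgz _] := Hz.
have gzae := ip_eq0 mO Lgz gz0.
have [B B0 coorB] := bounded_coor.
(* With q = x_j d_j phi, (z, z) = (z, z - phi) - (z, q), where |z - phi| < eps and |q| <= B eps. *)
have small (eps : R) : 0 < eps -> ip z.1 z.1 <= eps * ((B + 1) * L2norm z.1).
  move=> eps0; have [phi [tphi zphi gphi]] := aprx eps eps0.
  have cphi i : continuous (fun x => phi x 0 i) by have [/smooth_continuous] := tphi i.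
  have mphi i k : measurable_fun Omega (fun x => phi x i k).
    rewrite (ord1 i); apply: measurable_funTS; exact: continuous_measurable_rV.
  have mgphi i k : measurable_fun Omega (fun x => grad phi x i k).
    apply: measurable_funTS; under eq_fun do rewrite mxE.
    apply: continuous_measurable_rV; apply: smooth_continuous; apply: smooth_derive.
    by have [] := tphi i.
  have Ldz : L2mx mu Omega (z.1 \- phi).
    apply: normL2_lty_L2mx => //; last by rewrite (lt_trans zphi)// ltry.
    move=> i k; under eq_fun do rewrite !mxE.
    by apply: measurable_funB => //; have [] := Lz i k.
  have Lphi : L2mx mu Omega phi.
    apply: (@eq_L2mx _ _ _ _ _ mO _ _ (z.1 \- (z.1 \- phi))); last exact: L2mxB.
    by move=> x _ /=; rewrite opprB addrC subrK.
  have Ldg : L2mx mu Omega (z.2 \- grad phi).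
    apply: normL2_lty_L2mx => //; last by rewrite (lt_trans gphi)// ltry.
    move=> i k; under eq_fun do rewrite mxE [X in _ + X]mxE.
    by apply: measurable_funB; [have [] := Lgz i k|exact: mgphi].
  have Lg : L2mx mu Omega (grad phi).
    apply: (@eq_L2mx _ _ _ _ _ mO _ _ (z.2 \- (z.2 \- grad phi))); last exact: L2mxB.
    by move=> x _ /=; rewrite opprB addrC subrK.
  pose q x : 'rV[R]_d := \row_i (coor j x * grad phi x i j).
  have frobq x : Omega x -> frob (q x) (q x) <= B ^+ 2 * frob (grad phi x) (grad phi x).
    move=> Ox; rewrite /frob big_ord1 mulr_sumr; apply: ler_sum => i _.
    apply: (@le_trans _ _ (B ^+ 2 * (grad phi x i j * grad phi x i j))).
      rewrite /q mxE -!expr2 exprMn ler_wpM2r ?sqr_ge0//.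
      by rewrite -(real_normK (num_real (coor j x))) lerXn2r ?nnegrE ?coorB.
    rewrite ler_wpM2l ?sqr_ge0// (bigD1 j)//= lerDl.
    by apply: sumr_ge0 => k _; rewrite -expr2 sqr_ge0.
  have mq i k : measurable_fun Omega (fun x => q x i k).
    under eq_fun do rewrite mxE; apply: measurable_funM => //.
    apply: measurable_funTS; apply: continuous_measurable_rV; exact: coor_continuous.
  have IBg : mu.-integrable Omega (fun x => (B ^+ 2 * frob (grad phi x) (grad phi x))%:E).
    by under eq_fun do rewrite EFinM; apply: integrableZl => //; exact: frob_integrable.
  have Lq : L2mx mu Omega q.
    move=> i k; split=> //; apply: (le_integrable mO _ _ IBg).
      by apply/measurable_EFinP; exact: measurable_funX.
    move=> x Ox; rewrite !abse_EFin lee_fin ger0_norm ?sqr_ge0//.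
    rewrite ger0_norm; last by rewrite mulr_ge0 ?sqr_ge0 ?frob_ge0.
    rewrite (le_trans _ (frobq x Ox))// (ord1 i) /frob big_ord1 (bigD1 k)//= -expr2 lerDl.
    by apply: sumr_ge0 => l _; rewrite -expr2 sqr_ge0.
  (* The gradient of z vanishes almost everywhere, so |grad phi| is the distance from grad phi to
     it. *)
  have ngphi : L2norm (grad phi) < eps.
    rewrite -lte_fin -normL2E// (le_lt_trans _ gphi)// !normL2E// lee_fin.
    rewrite le_eqVlt; apply/orP; left; apply/eqP; rewrite L2normB /L2norm; congr Num.sqrt.
    have gphi0 : {ae mu, forall x, Omega x -> grad phi x = (grad phi \- z.2) x}.
      by apply: filterS gzae => x /[apply] zx; rewrite /= zx subr0.
    have Ldg' : L2mx mu Omega (grad phi \- z.2) by exact: L2mxB.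
    rewrite (@ae_ipl _ _ _ _ _ mO _ _ _ (grad phi \- z.2))//.
    by rewrite ipC (@ae_ipl _ _ _ _ _ mO _ _ _ (grad phi \- z.2)).
  have nq : L2norm q <= B * eps.
    apply: (@le_trans _ _ (B * L2norm (grad phi))); last exact: (ler_wpM2l B0 (ltW ngphi)).
    rewrite -(@ler_sqr R) ?nnegrE ?mulr_ge0 ?L2norm_ge0// exprMn !sqr_L2norm.
    rewrite -RintegralZl//; last exact: frob_integrable.
    by apply: le_Rintegral => //; exact: frob_integrable.
  have ndz : L2norm (z.1 \- phi) < eps by rewrite -lte_fin -normL2E.
  have -> : ip z.1 z.1 = ip z.1 (z.1 \- phi) - ip z.1 q.
    rewrite ipBr// (weak_grad_coor Hz gzae tphi Lphi Lq) opprK addrK//.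
  have := ip_le_L2norm mO Lz Ldz; have := ip_le_L2norm mO Lz Lq.
  have := L2norm_ge0 mu Omega z.1.
  move: (ler_norm (ip z.1 (z.1 \- phi))) (ler_norm (- ip z.1 q)).
  rewrite normrN; nra.
apply/eqP; rewrite eq_le ip_ge0 andbT leNgt; apply/negP => zz.
have N0 : 0 <= (B + 1) * L2norm z.1 by rewrite mulr_ge0 ?L2norm_ge0 ?addr_ge0.
set N := _ * _ in small N0.
(* For this eps, [small] would give (z, z) (N + 2) <= (z, z) N. *)
have e0 : 0 < ip z.1 z.1 / (N + 2) by rewrite divr_gt0// ltr_wpDl.
have := small _ e0; rewrite mulrAC ler_pdivlMr ?ltr_wpDl//.
by rewrite mulrDr; nra.
Qed.

End zero_gradient.

(** * Riesz representation on finite-dimensional spaces *)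

Section finite_dimensional.
Context {R : realType} {E : lmodType R}.
Implicit Types (S : set E) (b : E -> E -> R) (l : E -> R).

Definition subspace_of S : Prop :=
  S 0 /\ forall (a : R) u v, S u -> S v -> S (a *: u + v).

Lemma subspace_sum S : subspace_of S -> forall n (c : 'I_n -> R) (e : 'I_n -> E),
  (forall i, S (e i)) -> S (\sum_i c i *: e i).
Proof.
move=> [S0 SD]; elim=> [|n IH] c e Se; first by rewrite big_ord0.
by rewrite big_ord_recl; apply: SD => //; exact: IH.
Qed.

Lemma fin_dim_subspace_of S : fin_dim_subspace S -> subspace_of S.
Proof.
move=> [n [b ->]]; split.
  by exists (fun=> 0); rewrite big1// => i _; rewrite scale0r.
move=> a _ _ [c ->] [c' ->]; exists (fun i => a * c i + c' i).
rewrite scaler_sumr -big_split/=; apply: eq_bigr => i _.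
by rewrite scalerA scalerDl.
Qed.

(** Induction on the generators. S' consists of the elements of S that can be written without
    [e ord0]; either it is all of S, or one further element of S, involving [e ord0], generates S
    together with S'. This gives generators of V_h inside X_h. *)
Lemma subspace_fin_dim n (e : 'I_n -> E) S : subspace_of S ->
  S `<=` [set v | exists c : 'I_n -> R, v = \sum_i c i *: e i] ->
  fin_dim_subspace S.
Proof.
elim: n e S => [|n IH] e S sS Se.
  exists 0%N, e; apply/seteqP; split=> // v [c ->].
  by rewrite big_ord0; have [] := sS.
have [S0 SD] := sS.
pose S' := [set v | S v /\ exists c : 'I_n -> R, v = \sum_i c i *: e (lift ord0 i)].
have sS' : subspace_of S'.
  split; first by split=> //; exists (fun=> 0); rewrite big1// => i _; rewrite scale0r.
  move=> a u v [Su [c uE]] [Sv [c' vE]]; split; first exact: SD.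
  exists (fun i => a * c i + c' i).
  rewrite uE vE scaler_sumr -big_split/=; apply: eq_bigr => i _.
  by rewrite scalerA scalerDl.
have [m [f S'E]] := IH (fun i => e (lift ord0 i)) S' sS' (fun v => @proj2 _ _).
have [[v0 [Sv0 [c0 c00 v0E]]]|nov] := pselect (exists v0, S v0 /\
    exists2 c : 'I_n.+1 -> R, c ord0 != 0 & v0 = \sum_i c i *: e i); last first.
  exists m, f; rewrite -S'E; apply/seteqP; split=> [v Sv|v []//]; split=> //.
  have [c vE] := Se v Sv; have [cz|cnz] := eqVneq (c ord0) 0; last first.
    by exfalso; apply: nov; exists v; split=> //; exists c.
  by exists (fun i => c (lift ord0 i)); rewrite vE big_ord_recl cz scale0r add0r.
exists m.+1, (fun i => if unlift ord0 i is Some j then f j else v0).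
apply/seteqP; split=> [v Sv|v [c ->]].
  have [c vE] := Se v Sv.
  have : S' (v - (c ord0 / c0 ord0) *: v0).
    split; first by rewrite addrC -scaleNr; apply: SD.
    exists (fun i => c (lift ord0 i) - c ord0 / c0 ord0 * c0 (lift ord0 i)).
    rewrite vE v0E scaler_sumr -sumrB big_ord_recl scalerA divfK// subrr add0r.
    by apply: eq_bigr => i _; rewrite scalerA scalerBl.
  rewrite S'E => -[a aE].
  exists (fun i => if unlift ord0 i is Some j then a j else c ord0 / c0 ord0).
  rewrite big_ord_recl unlift_none.
  under eq_bigr do rewrite liftK.
  by rewrite -aE addrC subrK.
rewrite big_ord_recl unlift_none; apply: SD => //.
under eq_bigr do rewrite liftK.
have : [set v | exists c : 'I_m -> R, v = \sum_i c i *: f i] (\sum_(i < m) c (lift ord0 i) *: f i).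
  by exists (fun i => c (lift ord0 i)).
by rewrite -S'E => -[].
Qed.

(* Only semidefinite: elements of [sob] are functions, not classes of functions
   equal almost everywhere. *)
Definition psd_form S b : Prop :=
  [/\ forall u v, S u -> S v -> b u v = b v u,
      forall (a : R) u v z, S u -> S v -> S z -> b (a *: u + v) z = a * b u z + b v z &
      forall u, S u -> 0 <= b u u].

Definition linear_on S l : Prop :=
  forall (a : R) u v, S u -> S v -> l (a *: u + v) = a * l u + l v.

Lemma psd_form_null S b u v : subspace_of S -> psd_form S b -> S u -> S v ->
  b v v = 0 -> b u v = 0.
Proof.
move=> [S0 SD] [bC bD b0] Su Sv vv.
have [//|uv] := eqVneq (b u v) 0.
have Sw (a : R) : S (a *: v + u) by exact: SD.
(* Since b v v = 0, the form would equal -1 at this combination. *)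
have := b0 _ (Sw (- (b u u + 1) / (2 * b u v))).
set a := - _ / _; rewrite bD// (bC v)// (bC u (a *: v + u))// !bD// vv.
rewrite (bC v u)// mulr0 add0r addrA -mulr2n -mulrnAl.
rewrite (_ : a *+ 2 * b u v = - (b u u + 1)); last by rewrite /a -mulr_natr; field.
lra.
Qed.

(** Gram-Schmidt by induction on the generators, which may be dependent. The assumption that l
    vanishes on null vectors takes the place of definiteness. *)
Lemma riesz_fin_dim S b l : fin_dim_subspace S -> psd_form S b ->
  linear_on S l -> (forall v, S v -> b v v = 0 -> l v = 0) ->
  exists2 z, S z & forall v, S v -> b z v = l v.
Proof.
move=> [n [e SE]].
elim: n e S SE l => [|n IH] e S SE l bS lS l0.
  have sS : subspace_of S by apply: fin_dim_subspace_of; exists 0%N, e.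
  have [S0 SD] := sS.
  exists 0 => // v; rewrite SE => -[c ->]; rewrite big_ord0.
  have b00 : b 0 0 = 0.
    have [_ bD _] := bS; have := bD (-1) 0 0 0 S0 S0 S0.
    by rewrite scaler0 addr0 mulN1r addNr.
  by rewrite b00 l0.
have sS : subspace_of S by apply: fin_dim_subspace_of; exists n.+1, e.
have [S0 SD] := sS.
pose S' := [set v | exists c : 'I_n -> R, v = \sum_i c i *: e (lift ord0 i)].
have S'S : S' `<=` S.
  move=> _ [c ->]; rewrite SE.
  exists (fun i => if unlift ord0 i is Some j then c j else 0).
  rewrite big_ord_recl unlift_none scale0r add0r.
  by under [RHS]eq_bigr do rewrite liftK.
have [bC bD b0] := bS.
have bS' : psd_form S' b.
  by split=> [u v Su Sv|a u v z Su Sv Sz|u Su]; [apply: bC|apply: bD|apply: b0]; exact: S'S.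
have Se0 : S (e ord0).
  rewrite SE; exists (fun i => (i == ord0)%:R).
  rewrite (bigD1 ord0)//= scale1r big1 ?addr0// => i i0.
  by rewrite (negbTE i0) scale0r.
(* First use of the induction hypothesis: the functional b(e_0, .) is represented by the projection
   p of e_0 onto S', so that f = e_0 - p is orthogonal to S'. *)
have [|v Sv vv|p S'p pP] := IH (fun i => e (lift ord0 i)) S' erefl (b (e ord0)) bS'.
- move=> a u v Su Sv; have [Su' Sv'] := (S'S _ Su, S'S _ Sv).
  by rewrite bC// ?bD// ?(bC _ (e ord0))//; exact: SD.
- exact: (@psd_form_null S) (S'S _ Sv) vv.
have Sp := S'S _ S'p.
pose f := -1 *: p + e ord0.
have Sf : S f by exact: SD.
have f_orth v : S' v -> b f v = 0.
  by move=> S'v; rewrite bD// ?pP// ?mulN1r ?addNr//; exact: S'S.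
have [|v Sv vv|z S'z zP] := IH (fun i => e (lift ord0 i)) S' erefl l bS'.
- by move=> a u v Su Sv; apply: lS; exact: S'S.
- by apply: l0 => //; exact: S'S.
have Sz := S'S _ S'z.
(* If f is a null vector then l f = 0 and the coefficient 0 will do. *)
have [al alP] : exists al, al * b f f = l f.
  have [ff|ff] := eqVneq (b f f) 0; first by exists 0; rewrite ff mulr0 l0.
  by exists (l f / b f f); rewrite divfK.
exists (al *: f + z); first exact: SD.
move=> v Sv.
have [c [w [S'w vE]]] : exists c w, S' w /\ v = c *: f + w.
  move: Sv; rewrite SE => -[c ->]; rewrite big_ord_recl.
  exists (c ord0), (c ord0 *: p + \sum_(i < n) c (lift ord0 i) *: e (lift ord0 i)).
  split; last by rewrite scalerDr scaleN1r scalerN addrACA addNr add0r.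
  have sS' : subspace_of S'.
    by apply: fin_dim_subspace_of; exists n, (fun i => e (lift ord0 i)).
  by apply: (proj2 sS') => //; exists (fun i => c (lift ord0 i)).
have Sw := S'S _ S'w.
have Scfw : S (c *: f + w) by exact: SD.
have bfE : b f (c *: f + w) = c * b f f by rewrite (bC f)// bD// (bC w f)// (f_orth w)// addr0.
have bzE : b z (c *: f + w) = l w.
  by rewrite (bC z)// bD// (f_orth z)// mulr0 add0r (bC w z)// zP.
rewrite vE lS// bD// bfE bzE -alP; ring.
Qed.

End finite_dimensional.

(** * Functions that are piecewise polynomial in time *)

Section linear_combinations.
Context {R : realType} d0 {S : measurableType d0}.
Variables (mu : {measure set S -> \bar R}) (D : set S).
Hypothesis mD : measurable D.
Context {m n : nat}.
Implicit Types a : S -> 'M[R]_(m, n).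

Lemma L2mx_lincomb N (c : 'I_N -> R) (a : 'I_N -> S -> 'M[R]_(m, n)) :
  (forall k, L2mx mu D (a k)) -> L2mx mu D (\sum_k c k *: a k).
Proof.
move=> La; rewrite (_ : \sum_k _ = (fun x => \sum_k (c k *: a k) x)).
  by apply: L2mx_sum => // k _; exact: L2mxZ.
by apply/funext => x; rewrite fct_sumE.
Qed.

Lemma ip_lincombl N (c : 'I_N -> R) (a : 'I_N -> S -> 'M[R]_(m, n)) z :
  (forall k, L2mx mu D (a k)) -> L2mx mu D z ->
  L2inner mu D (\sum_k c k *: a k) z = \sum_k c k * L2inner mu D (a k) z.
Proof.
move=> La Lz; rewrite (_ : \sum_k _ = (fun x => \sum_k (c k *: a k) x)).
  rewrite ip_suml//; last by move=> k _; exact: L2mxZ.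
  by apply: eq_bigr => k _; rewrite -ipZl.
by apply/funext => x; rewrite fct_sumE.
Qed.

Lemma ip_lincomb N N' (c : 'I_N -> R) (a : 'I_N -> S -> 'M[R]_(m, n))
    (c' : 'I_N' -> R) (a' : 'I_N' -> S -> 'M[R]_(m, n)) :
  (forall k, L2mx mu D (a k)) -> (forall k, L2mx mu D (a' k)) ->
  L2inner mu D (\sum_k c k *: a k) (\sum_l c' l *: a' l) =
  \sum_k \sum_l c k * c' l * L2inner mu D (a k) (a' l).
Proof.
move=> La La'; rewrite ip_lincombl//; last exact: L2mx_lincomb.
apply: eq_bigr => k _; rewrite ipC ip_lincombl// mulr_sumr.
by apply: eq_bigr => l _; rewrite mulrA ipC.
Qed.

End linear_combinations.

Section time_polynomials.
Context {R : realType}.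

Definition tpoly (E : lmodType R) n (a : 'I_n -> E) (s : R) : E :=
  \sum_(k < n) s ^+ k *: a k.

(** The time derivative of [tpoly a]; the formal derivative of X^k treats k = 0 like the other
    powers. *)
Definition dtpoly (E : lmodType R) n (a : 'I_n -> E) (s : R) : E :=
  \sum_(k < n) ('X^k : {poly R})^`().[s] *: a k.

Lemma fst_lincomb (E E' : lmodType R) n (c : 'I_n -> R) (a : 'I_n -> E * E') :
  (\sum_k c k *: a k).1 = \sum_k c k *: (a k).1.
Proof. exact: (big_morph fst (id1 := 0) (op1 := +%R)). Qed.

Lemma snd_lincomb (E E' : lmodType R) n (c : 'I_n -> R) (a : 'I_n -> E * E') :
  (\sum_k c k *: a k).2 = \sum_k c k *: (a k).2.
Proof. exact: (big_morph snd (id1 := 0) (op1 := +%R)). Qed.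

Context {d : nat} (Omega : set 'rV[R]_d).
Hypothesis mO : measurable Omega.
Local Notation mu := (lebesgue_rV d).
Local Notation L2O := (L2mx mu Omega).
Local Notation ip := (L2inner mu Omega).

(* Its derivative at [s] is the inner product of [dtpoly a s] and [tpoly b s]
   plus the symmetric term. *)
Definition ip_poly n n' m p (a : 'I_n -> 'rV[R]_d -> 'M[R]_(m, p))
    (b : 'I_n' -> 'rV[R]_d -> 'M[R]_(m, p)) : {poly R} :=
  \sum_(k < n) \sum_(l < n') ip (a k) (b l) *: ('X^k * 'X^l).

Definition ip_dpoly n n' m p (a : 'I_n -> 'rV[R]_d -> 'M[R]_(m, p))
    (b : 'I_n' -> 'rV[R]_d -> 'M[R]_(m, p)) : {poly R} :=
  \sum_(k < n) \sum_(l < n') ip (a k) (b l) *: (('X^k)^`() * 'X^l).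

Section ip_poly.
Context {n n' m p : nat} (a : 'I_n -> 'rV[R]_d -> 'M[R]_(m, p))
    (b : 'I_n' -> 'rV[R]_d -> 'M[R]_(m, p)).
Hypotheses (La : forall k, L2O (a k)) (Lb : forall k, L2O (b k)).

Lemma horner_ip_poly s : (ip_poly a b).[s] = ip (tpoly a s) (tpoly b s).
Proof.
rewrite ip_lincomb// horner_sum; apply: eq_bigr => k _.
by rewrite horner_sum; apply: eq_bigr => l _; rewrite hornerZ hornerM !hornerXn mulrC.
Qed.

Lemma horner_ip_dpoly s : (ip_dpoly a b).[s] = ip (dtpoly a s) (tpoly b s).
Proof.
rewrite ip_lincomb// horner_sum; apply: eq_bigr => k _.
by rewrite horner_sum; apply: eq_bigr => l _; rewrite hornerZ hornerM hornerXn mulrC.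
Qed.

Lemma deriv_ip_poly : (ip_poly a b)^`() = ip_dpoly a b + ip_dpoly b a.
Proof.
rewrite /ip_poly /ip_dpoly [X in _ + X]exchange_big -big_split/= raddf_sum.
apply: eq_bigr => k _; rewrite raddf_sum -big_split/=; apply: eq_bigr => l _.
rewrite derivZ derivM scalerDr; congr (_ + _).
by rewrite [in RHS]ipC [in RHS]mulrC.
Qed.

Lemma Rintegral_ip_poly (s0 s1 : R) : s0 < s1 ->
  \int[lebesgue_measure]_(s in `]s0, s1]) (ip_dpoly a b).[s] +
  \int[lebesgue_measure]_(s in `]s0, s1]) (ip_dpoly b a).[s] =
  ip (tpoly a s1) (tpoly b s1) - ip (tpoly a s0) (tpoly b s0).
Proof.
move=> s01.
have Iq (q : {poly R}) : lebesgue_measure.-integrable `[s0, s1] (EFin \o horner q).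
  apply: integrable_continuous_itv; apply: continuous_subspaceT.
  by apply: smooth_continuous; exact: smooth_horner.
have Iq' (q : {poly R}) : lebesgue_measure.-integrable `]s0, s1] (EFin \o horner q).
  by apply: integrableS (Iq q) => //; apply: subset_itv; rewrite bnd_simp.
rewrite -RintegralD//; [|exact: Iq'..].
rewrite -!horner_ip_poly -(@Rintegral_derive1 _ (horner (ip_poly a b)))//; last exact: smooth_horner.
rewrite Rintegral_itv_obnd_cbnd; last first.
  rewrite (_ : _ \o _ = EFin \o horner (ip_dpoly a b + ip_dpoly b a)); first exact: Iq'.
  by apply/funext => s; rewrite /= hornerD.
by apply: eq_Rintegral => s _; rewrite derive1_horner deriv_ip_poly hornerD.
Qed.

End ip_poly.

(** The squared L^2 distance to the value at s0 is a real polynomial in s that vanishes at s0. *)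
Lemma is_L2lim_tpoly n (F : set_system R) {FF : Filter F} (s0 : R)
    (a : 'I_n -> 'rV[R]_d -> 'rV[R]_d) v :
  (forall k, L2O (a k)) -> F --> s0 -> (\forall s \near F, v s = tpoly a s) ->
  is_L2lim F Omega v (tpoly a s0).
Proof.
move=> La Fs0 va; split; first exact: L2mx_lincomb.
pose q : {poly R} := \sum_(k < n) \sum_(l < n) ip (a k) (a l) *:
  (('X^k - (s0 ^+ k)%:P) * ('X^l - (s0 ^+ l)%:P)).
have nE s : L2norm mu Omega (tpoly a s \- tpoly a s0) = Num.sqrt q.[s].
  rewrite /L2norm; congr Num.sqrt.
  rewrite (_ : _ \- _ = \sum_(k < n) (s ^+ k - s0 ^+ k) *: a k); last first.
    apply/funext => x /=; rewrite /tpoly !fct_sumE -sumrB.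
    by apply: eq_bigr => k _; rewrite /= scalerBl.
  rewrite ip_lincomb// horner_sum; apply: eq_bigr => k _.
  rewrite horner_sum; apply: eq_bigr => l _.
  by rewrite hornerZ hornerM !hornerD !hornerN !hornerXn !hornerC mulrC.
have q0 : Num.sqrt q.[s0] = 0.
  rewrite horner_sum big1 ?sqrtr0// => k _; rewrite horner_sum big1// => l _.
  by rewrite hornerZ hornerM !hornerD !hornerN !hornerXn !hornerC !subrr !mulr0.
have cq : (Num.sqrt q.[s])%:E @[s --> F] --> 0%:E.
  apply: cvg_EFin; first by near=> s.
  have cc : Num.sqrt q.[r] @[r --> s0] --> Num.sqrt q.[s0].
    apply: (@continuous_comp _ _ _ (fun r : R => q.[r]) Num.sqrt s0).
      exact: (smooth_continuous (smooth_horner q)).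
    exact: sqrt_continuous.
  by rewrite -q0; apply: cvg_trans cc; exact: cvg_app.
apply: cvg_trans cq; apply: near_eq_cvg; near=> s.
rewrite -nE -normL2E//; last by apply: L2mxB => //; exact: L2mx_lincomb.
by congr normL2; apply/funext => x; rewrite (near va s).
Unshelve. all: by end_near. Qed.

(** [lim_left] and [lim_right] pick an arbitrary limit, so all that can be said of their values
    holds almost everywhere in Omega. *)
Lemma is_L2lim_unique (F : set_system R) {FF : ProperFilter F}
    (v : R -> 'rV[R]_d -> 'rV[R]_d) g g' :
  (\forall s \near F, L2O (v s)) ->
  is_L2lim F Omega v g -> is_L2lim F Omega v g' ->
  {ae mu, forall x, Omega x -> g x = g' x}.
Proof.
move=> Lv [Lg vg] [Lg' vg'].
have Lgg' : L2O (g \- g') by exact: L2mxB.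
suff : ip (g \- g') (g \- g') = 0.
  by move/(ip_eq0 mO Lgg'); apply: filterS => x /[apply] /eqP; rewrite subr_eq0 => /eqP.
suff /eqP : L2norm mu Omega (g \- g') = 0 by move=> /eqP n0; rewrite -sqr_L2norm n0 expr0n.
apply/eqP; rewrite eq_le L2norm_ge0 andbT; apply/ler_addgt0Pl => e e0; rewrite addr0.
have nb : nbhs 0%E [set y | (y < (e / 2)%:E)%E].
  by apply: (@nbhs_open_ereal_lt _ _ (fun=> e / 2)); rewrite divr_gt0.
have /filter_ex[s [[Lvs n1] n2]] :
    F ([set s | L2O (v s) /\ (normL2 Omega (fun x => (v s x - g x)%R) < (e / 2)%:E)%E] `&`
       [set s | (normL2 Omega (fun x => (v s x - g' x)%R) < (e / 2)%:E)%E]).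
  apply: filterI; first apply: filterI => //.
  - exact: (vg _ nb).
  - exact: (vg' _ nb).
have L1 : L2O (v s \- g) by exact: L2mxB.
have L2 : L2O (v s \- g') by exact: L2mxB.
have {}n1 : L2norm mu Omega (v s \- g) < e / 2 by rewrite -lte_fin -normL2E.
have {}n2 : L2norm mu Omega (v s \- g') < e / 2 by rewrite -lte_fin -normL2E.
rewrite L2normB in n1.
by rewrite (le_trans (L2norm_triangle mO Lg Lg' Lvs))//; lra.
Qed.

Lemma lim_leftP v g s : is_L2lim s^'- Omega v g -> is_L2lim s^'- Omega v (lim_left Omega v s).
Proof. by move=> vg; exact: (@xgetPex _ (fun=> 0) [set g | is_L2lim s^'- Omega v g] (ex_intro _ _ vg)). Qed.

Lemma lim_rightP v g s : is_L2lim s^'+ Omega v g -> is_L2lim s^'+ Omega v (lim_right Omega v s).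
Proof. by move=> vg; exact: (@xgetPex _ (fun=> 0) [set g | is_L2lim s^'+ Omega v g] (ex_intro _ _ vg)). Qed.

Lemma lim_right_tpoly n (a : 'I_n -> 'rV[R]_d -> 'rV[R]_d) v (s0 s1 : R) :
  s0 < s1 -> (forall k, L2O (a k)) ->
  (forall s, s \in `]s0, s1] -> v s = tpoly a s) ->
  L2O (lim_right Omega v s0) /\
  {ae mu, forall x, Omega x -> lim_right Omega v s0 x = tpoly a s0 x}.
Proof.
move=> s01 La va.
have nv : \forall s \near s0^'+, v s = tpoly a s.
  by near=> s; apply: va; rewrite in_itv/=; apply/andP; split=> //; near: s; exact: nbhs_right_le.
have lim : is_L2lim s0^'+ Omega v (tpoly a s0).
  by apply: is_L2lim_tpoly => //; apply: cvg_at_right_filter; exact: cvg_id.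
have lim' := lim_rightP lim; split; first by have [] := lim'.
apply: is_L2lim_unique lim' lim.
by apply: filterS nv => s ->; exact: L2mx_lincomb.
Unshelve. all: by end_near. Qed.

Lemma lim_left_tpoly n (a : 'I_n -> 'rV[R]_d -> 'rV[R]_d) v (s0 s1 : R) :
  s0 < s1 -> (forall k, L2O (a k)) ->
  (forall s, s \in `]s0, s1] -> v s = tpoly a s) ->
  L2O (lim_left Omega v s1) /\
  {ae mu, forall x, Omega x -> lim_left Omega v s1 x = tpoly a s1 x}.
Proof.
move=> s01 La va.
have nv : \forall s \near s1^'-, v s = tpoly a s.
  near=> s; apply: va; rewrite in_itv/=; apply/andP; split; last by rewrite ltW.
  by near: s; exact: nbhs_left_gt.
have lim : is_L2lim s1^'- Omega v (tpoly a s1).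
  by apply: is_L2lim_tpoly => //; apply: cvg_at_left_filter; exact: cvg_id.
have lim' := lim_leftP lim; split; first by have [] := lim'.
apply: is_L2lim_unique lim' lim.
by apply: filterS nv => s ->; exact: L2mx_lincomb.
Unshelve. all: by end_near. Qed.

Lemma lim_left_continuous_L2 (T : R) v s : continuous_L2 T Omega v -> 0 < s <= T ->
  L2O (lim_left Omega v s) /\
  {ae mu, forall x, Omega x -> lim_left Omega v s x = v s x}.
Proof.
move=> cv /andP[s0 sT].
have sI : s \in `[0, T] by rewrite in_itv/= (ltW s0).
have nI : \forall r \near s^'-, r \in `[0, T].
  near=> r; rewrite in_itv/=; apply/andP; split.
    by apply/ltW; near: r; exact: nbhs_left_gt.
  by rewrite (le_trans _ sT)// ltW.
have [Lvs vs] := cv s sI.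
have lim : is_L2lim s^'- Omega v (v s).
  split=> //; apply: cvg_trans vs; apply: cvg_app => A nA.
  have nA' := @cvg_within _ (nbhs s) _ (fun r => r < s) _ nA.
  have nA2 : \forall r \near s^'-, `[0, T]%classic r -> A r by exact: nA'.
  by near=> r; apply: (near nA2 r) => //; exact: (near nI r).
have lim' := lim_leftP lim; split; first by have [] := lim'.
apply: is_L2lim_unique lim' lim.
by apply: filterS nI => r rI; have [] := cv r rI.
Unshelve. all: by end_near. Qed.

(** The end point s1 is excluded: a two-sided derivative there also depends on v after s1. *)
Lemma dt_tpoly n (a : 'I_n -> 'rV[R]_d -> 'rV[R]_d) v (s0 s1 s : R) :
  (forall s, s \in `]s0, s1] -> v s = tpoly a s) -> s \in `]s0, s1[ ->
  dt v s = dtpoly a s.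
Proof.
move=> va sI; apply/funext => x; rewrite /dt.
have E : \forall r \near s, tpoly a r x = v r x.
  near=> r; rewrite va//; apply: subset_itv_oo_oc.
  by near: r; apply: near_in_itvoo.
rewrite derive1E -(near_eq_derive (1 : R) E).
rewrite (_ : (fun r => tpoly a r x) = (\sum_(k < n) (fun r => r ^+ k *: a k x))); last first.
  by apply/funext => r; rewrite /tpoly !fct_sumE.
have dk (k : 'I_n) : differentiable (fun r : R => r ^+ k) s by apply/derivable1_diffP; exact: exprn_derivable.
rewrite derive_sum; last first.
  by move=> k; apply: diff_derivable; exact: differentiableZl.
rewrite /dtpoly fct_sumE; apply: eq_bigr => k _ /=.
rewrite deriveE; last exact: differentiableZl.
rewrite diffZl// -deriveE// -derive1E; congr (_ *: _).
rewrite -derive1_horner; congr (derive1 _ _); apply/funext => r; by rewrite hornerXn.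
Unshelve. all: by end_near. Qed.

End time_polynomials.

(** * Slabs of the time partition *)

Section slabs.
Local Notation Im := Defs.Im.
Context {R : realType}.
Variables (M : nat) (t : nat -> R).
Hypothesis t_incr : forall m, (m < M)%N -> t m < t m.+1.

Lemma partition_lt i j : (i < j)%N -> (j <= M)%N -> t i < t j.
Proof.
elim: j => // j IH; rewrite ltnS leq_eqVlt => /predU1P[->|ij] jM; first exact: t_incr.
by apply: lt_trans (t_incr jM); apply: IH => //; exact: ltnW.
Qed.

Lemma partition_le i j : (i <= j)%N -> (j <= M)%N -> t i <= t j.
Proof.
by rewrite leq_eqVlt => /predU1P[->//|ij] jM; rewrite ltW// partition_lt.
Qed.

Lemma slab_lt m : (0 < m <= M)%N -> t m.-1 < t m.
Proof. by case: m => // m /=; exact: t_incr. Qed.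

Lemma slab_cover s : t 0%N < s <= t M -> exists2 m, (0 < m <= M)%N & Im t m s.
Proof.
move=> /andP[s0]; have : (M <= M)%N by [].
elim: {-2}M => [_ /(lt_le_trans s0)|n IH nM sn]; first by rewrite ltxx.
have [sn'|ns] := leP s (t n).
  by have [m /andP[m0 mn] ms] := IH (ltnW nM) sn'; exists m => //; rewrite m0 (leq_trans mn) ?(ltnW nM).
have sI : s \in `]t n, t n.+1] by rewrite in_itv/= ns.
by exists n.+1; [rewrite /= leqnn|exact: sI].
Qed.

Lemma slab_unique m m' s : (0 < m <= M)%N -> (0 < m' <= M)%N ->
  Im t m s -> Im t m' s -> m = m'.
Proof.
wlog mm : m m' / (m <= m')%N.
  by move=> H mM mM' ms ms'; have [/H|/ltnW/H H'] := leqP m m'; [exact|apply/esym/H'].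
move: mm; rewrite leq_eqVlt => /predU1P[//|mm] /andP[m0 mM] /andP[m'0 m'M].
rewrite /Im /= !in_itv/= => /andP[_ sm] /andP[ms _].
have : t m <= t m'.-1.
  by apply: partition_le; [rewrite -ltnS prednK|rewrite (leq_trans (leq_pred _))].
by move=> /(le_trans sm)/(lt_le_trans ms); rewrite ltxx.
Qed.

(** The default 0 is not the index of a slab: these start at 1. *)
Definition slab (s : R) : nat := xget 0%N [set m | (0 < m <= M)%N /\ Im t m s].

Lemma slabE m s : (0 < m <= M)%N -> Im t m s -> slab s = m.
Proof.
move=> mM ms; rewrite /slab; case: xgetP => [m' _ [mM' ms']|/(_ m)[]//].
exact: slab_unique ms' ms.
Qed.

Definition piecewise (E : lmodType R) n (a : nat -> 'I_n -> E) (s : R) : E :=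
  tpoly (a (slab s)) s.

Lemma piecewiseE (E : lmodType R) n (a : nat -> 'I_n -> E) m s :
  (0 < m <= M)%N -> Im t m s -> piecewise a s = tpoly (a m) s.
Proof. by move=> mM ms; rewrite /piecewise (slabE mM ms). Qed.

Lemma Rintegral_slabs (f : R -> R) n : (n <= M)%N ->
  lebesgue_measure.-integrable `]t 0%N, t n] (EFin \o f) ->
  \int[lebesgue_measure]_(s in `]t 0%N, t n]) f s =
  \sum_(1 <= m < n.+1) \int[lebesgue_measure]_(s in Im t m) f s.
Proof.
elim: n => [_ _|n IH nM If].
  by rewrite big_nil set_itv_ge ?Rintegral_set0// bnd_simp ltxx.
have tn : t 0%N <= t n by apply: partition_le => //; exact: ltnW.
have tn1 := t_incr nM.
have E : `]t 0%N, t n.+1]%classic = `]t 0%N, t n] `|` Im t n.+1.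
  apply/seteqP; split => s /=; rewrite /Im /= !in_itv/=.
    by move=> /andP[-> ->]; case: (leP s (t n)) => _; [left|right].
  by move=> [/andP[-> /le_trans->//]|/andP[/(le_lt_trans tn)-> ->//]]; rewrite ltW.
rewrite big_nat_recr//= -IH//; last 2 first.
- exact: ltnW.
- apply: integrableS If => //.
  by apply: subset_itv; rewrite bnd_simp// ltW.
rewrite E Rintegral_setU; [by []|exact: measurable_itv|exact: measurable_itv|by rewrite -E|].
apply/disj_setPS => s [/=]; rewrite /Im /= !in_itv/= => /andP[_ sn] /andP[ns _].
by move: (lt_le_trans ns sn); rewrite ltxx.
Qed.

Section space_time_polynomials.
Context {d : nat} (Omega : set 'rV[R]_d).
Hypothesis mO : measurable Omega.
Local Notation L2O := (L2mx (lebesgue_rV d) Omega).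

Lemma L2mxst_tpoly (a b : R) m n N (c : 'I_N -> 'rV[R]_d -> 'M[R]_(m, n)) :
  (forall k, L2O (c k)) -> L2mxst `]a, b] Omega (tpoly c).
Proof.
move=> Lc.
have mJ : measurable (`]a, b] : set (measurableTypeR R)) by exact: measurable_itv.
have mJO : measurable (`]a, b] `*` Omega : set (measurableTypeR R * 'rV[R]_d)).
  exact: measurableX.
apply: (@eq_L2mx _ _ _ _ _ mJO _ _ (fun z => \sum_(k < N) z.1 ^+ k *: c k z.2)).
  by move=> z _; rewrite /tpoly fct_sumE.
apply: L2mx_sum => // k _.
apply: (@L2mxst_separated _ _ _ _ mJ mO ((`|a| + `|b|) ^+ k) (fun s => s ^+ k)) => //.
- have : lebesgue_measure (`]a, b] : set R) = (if (a < b)%R then (b - a)%R%:E else 0%E).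
    by rewrite lebesgue_measure_itv/= lte_fin; case: ifP.
  by move=> E; rewrite [X in (X < _)%E]E; case: ifP => _; rewrite ltry.
- move=> s /=; rewrite in_itv/= => /andP[as_ sb]; rewrite normrX lerXn2r ?nnegrE ?addr_ge0//.
  rewrite ler_norml; move: (ler_norm b) (ler_norm (- a)) (normr_ge0 a) (normr_ge0 b).
  by rewrite normrN => *; apply/andP; split; lra.
Qed.

Lemma L2mxst_piecewise m n N (v : R -> 'rV[R]_d -> 'M[R]_(m, n)) :
  t 0%N < t M ->
  (forall k, (0 < k <= M)%N -> exists c : 'I_N -> 'rV[R]_d -> 'M[R]_(m, n),
    (forall l, L2O (c l)) /\ forall s, Im t k s -> v s = tpoly c s) ->
  L2mxst `]t 0%N, t M] Omega v.
Proof.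
move=> t0M cv.
have Ls k : (0 < k <= M)%N -> L2mxst (Im t k) Omega v.
  move=> kM; have [c [Lc vc]] := cv k kM.
  have mkO : measurable (Im t k `*` Omega : set (measurableTypeR R * 'rV[R]_d)).
    by apply: measurableX => //; exact: measurable_itv.
  apply: (@eq_L2mx _ _ _ _ _ mkO _ _ (fun z => tpoly c z.1 z.2)).
  - by move=> z /set_mem[zk _]; rewrite vc.
  - exact: L2mxst_tpoly.
have M0 : (0 < M)%N by case: (M) t0M => //; rewrite ltxx.
suff : forall k, (0 < k <= M)%N -> L2mxst `]t 0%N, t k] Omega v by apply; rewrite M0/=.
elim=> // -[_ kM|k IH kM]; first exact: (Ls 1%N).
have {}IH := IH (ltnW kM).
have E : (`]t 0%N, t k.+2]%classic `*` Omega) =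
    (`]t 0%N, t k.+1] `*` Omega) `|` (Im t k.+2 `*` Omega).
  have t0k : t 0%N < t k.+1 by apply: partition_lt => //; exact: ltnW.
  have tk := t_incr kM.
  apply/seteqP; split => -[s x]; rewrite /setX /Im /= !in_itv/=.
    by move=> [/andP[-> ->] Ox]; case: (leP s (t k.+1)) => _; [left|right].
  move=> [[/andP[-> sk] Ox]|[/andP[ks ->] Ox]]; split=> //.
    by rewrite (le_trans sk)// ltW.
  by rewrite (lt_trans t0k).
move=> i j; rewrite /L2mxst E; apply: L2_setU.
- by apply: measurableX => //; exact: measurable_itv.
- by apply: measurableX => //; exact: measurable_itv.
- apply/disj_setPS => -[s x] [] /=; rewrite /setX /Im /= !in_itv/=.
  by move=> [/andP[_ sn] _] [/andP[ns _] _]; move: (lt_le_trans ns sn); rewrite ltxx.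
- exact: IH.
- exact: Ls.
Qed.

(** Passing to the open slab, which leaves the integrals unchanged, removes the end point where
    [dt v] is not the derivative of the slab polynomial. *)
Lemma inner_st_dt N (a z : 'I_N -> 'rV[R]_d -> 'rV[R]_d)
    (v y : R -> 'rV[R]_d -> 'rV[R]_d) (s0 s1 : R) : s0 < s1 ->
  (forall k, L2O (a k)) -> (forall k, L2O (z k)) ->
  (forall s, s \in `]s0, s1] -> v s = tpoly a s) ->
  (forall s, s \in `]s0, s1] -> y s = tpoly z s) ->
  inner_st `]s0, s1] Omega (dt v) y =
  \int[lebesgue_measure]_(s in `]s0, s1]) (ip_dpoly Omega a z).[s].
Proof.
move=> s01 La Lz va yz.
have Ip : lebesgue_measure.-integrable `]s0, s1[ (EFin \o horner (ip_dpoly Omega a z)).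
  have I2 : lebesgue_measure.-integrable `[s0, s1] (EFin \o horner (ip_dpoly Omega a z)).
    apply: integrable_continuous_itv; apply: continuous_subspaceT.
    by apply: smooth_continuous; exact: smooth_horner.
  by apply: integrableS I2 => //; apply: subset_itv; rewrite bnd_simp.
have E : {in `]s0, s1[, forall s, (ip_dpoly Omega a z).[s] = inner Omega (dt v s) (y s)}.
  move=> s sI; rewrite horner_ip_dpoly// (dt_tpoly va sI) yz//.
  exact: subset_itv_oo_oc sI.
rewrite /inner_st -[LHS]Rintegral_itv_bndo_bndc; last first.
  apply: eq_integrable Ip => //.
  by move=> s /set_mem sI; rewrite /= E.
rewrite -[RHS]Rintegral_itv_bndo_bndc//.
by apply: eq_Rintegral => s /set_mem sI; rewrite E.
Qed.

End space_time_polynomials.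

End slabs.

(** * The time part of the bilinear form *)

Section discrete_time_form.
Context {R : realType}.
Local Notation Im := Defs.Im.
Variables (M : nat) (t : nat -> R).
Hypothesis t_incr : forall m, (m < M)%N -> t m < t m.+1.
Context {d : nat} (Omega : set 'rV[R]_d) {N : nat}.
Hypothesis mO : measurable Omega.
Local Notation mu := (lebesgue_rV d).
Local Notation L2O := (L2mx mu Omega).
Local Notation ip := (L2inner mu Omega).

Lemma tpolyB (E : lmodType R) (a b : 'I_N -> E) s :
  tpoly (fun k => a k - b k) s = tpoly a s - tpoly b s.
Proof. by rewrite -sumrB; apply: eq_bigr => k _; rewrite scalerBr. Qed.

Lemma dtpolyB (E : lmodType R) (a b : 'I_N -> E) s :
  dtpoly (fun k => a k - b k) s = dtpoly a s - dtpoly b s.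
Proof. by rewrite -sumrB; apply: eq_bigr => k _; rewrite scalerBr. Qed.

(** The time part of [Bform] in terms of slab polynomials: the one-sided limits at t_(m-1) become
    values of the polynomials of slabs m and m - 1. The number n of slabs is a parameter so that
    induction is possible. *)
Definition time_form (n : nat) (a z : nat -> 'I_N -> 'rV[R]_d -> 'rV[R]_d) : R :=
  \sum_(1 <= m < n.+1) \int[lebesgue_measure]_(s in Im t m) (ip_dpoly Omega (a m) (z m)).[s]
  + \sum_(2 <= m < n.+1)
      (ip (tpoly (a m) (t m.-1)) (tpoly (z m) (t m.-1))
       - ip (tpoly (a m.-1) (t m.-1)) (tpoly (z m) (t m.-1)))
  + ip (tpoly (a 1%N) (t 0%N)) (tpoly (z 1%N) (t 0%N)).

Lemma integrable_horner (q : {poly R}) (a b : R) :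
  lebesgue_measure.-integrable `]a, b] (EFin \o horner q).
Proof.
have I2 : lebesgue_measure.-integrable `[a, b] (EFin \o horner q).
  apply: integrable_continuous_itv; apply: continuous_subspaceT.
  by apply: smooth_continuous; exact: smooth_horner.
by apply: integrableS I2 => //; apply: subset_itv; rewrite bnd_simp.
Qed.

Lemma time_form_recr n a z : (0 < n)%N -> time_form n.+1 a z = time_form n a z +
  (\int[lebesgue_measure]_(s in Im t n.+1) (ip_dpoly Omega (a n.+1) (z n.+1)).[s] +
   (ip (tpoly (a n.+1) (t n)) (tpoly (z n.+1) (t n)) -
    ip (tpoly (a n) (t n)) (tpoly (z n.+1) (t n)))).
Proof.
have gen (a1 a2 b1 b2 b3 c : R) : a1 + a2 + (b1 + (b2 - b3)) + c =
  a1 + b1 + c + (a2 + (b2 - b3)) by ring.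
by move=> n0; rewrite /time_form big_nat_recr//= [X in _ + X + _ = _]big_nat_recr//=; exact: gen.
Qed.

Lemma time_formB n (a b z : nat -> 'I_N -> 'rV[R]_d -> 'rV[R]_d) :
  (forall m k, L2O (a m k)) -> (forall m k, L2O (b m k)) ->
  (forall m k, L2O (z m k)) ->
  time_form n (fun m k => a m k - b m k) z = time_form n a z - time_form n b z.
Proof.
move=> La Lb Lz.
have Lt (c : nat -> 'I_N -> 'rV[R]_d -> 'rV[R]_d) m s :
    (forall m k, L2O (c m k)) -> L2O (tpoly (c m) s).
  by move=> Lc; apply: L2mx_lincomb.
have Ldt (c : nat -> 'I_N -> 'rV[R]_d -> 'rV[R]_d) m s :
    (forall m k, L2O (c m k)) -> L2O (dtpoly (c m) s).
  by move=> Lc; apply: L2mx_lincomb.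
have ipBt m m' s s' : ip (tpoly (fun k => a m k - b m k) s) (tpoly (z m') s') =
    ip (tpoly (a m) s) (tpoly (z m') s') - ip (tpoly (b m) s) (tpoly (z m') s').
  by rewrite tpolyB ipBl//; exact: Lt.
have intB m : \int[lebesgue_measure]_(s in Im t m)
      (ip_dpoly Omega (fun k => a m k - b m k) (z m)).[s] =
    \int[lebesgue_measure]_(s in Im t m) (ip_dpoly Omega (a m) (z m)).[s] -
    \int[lebesgue_measure]_(s in Im t m) (ip_dpoly Omega (b m) (z m)).[s].
  rewrite -RintegralB; [|exact: measurable_itv|exact: integrable_horner|exact: integrable_horner].
  apply: eq_Rintegral => s _; rewrite !horner_ip_dpoly//; last first.
    by move=> k; exact: L2mxB.
  by rewrite dtpolyB ipBl//; [exact: Ldt|exact: Ldt|exact: Lt].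
have S1 : \sum_(1 <= m < n.+1) \int[lebesgue_measure]_(s in Im t m)
      (ip_dpoly Omega (fun k => a m k - b m k) (z m)).[s] =
    \sum_(1 <= m < n.+1) \int[lebesgue_measure]_(s in Im t m) (ip_dpoly Omega (a m) (z m)).[s] -
    \sum_(1 <= m < n.+1) \int[lebesgue_measure]_(s in Im t m) (ip_dpoly Omega (b m) (z m)).[s].
  by rewrite -sumrB; apply: eq_bigr.
pose J (c : nat -> 'I_N -> 'rV[R]_d -> 'rV[R]_d) m :=
  ip (tpoly (c m) (t m.-1)) (tpoly (z m) (t m.-1)) -
  ip (tpoly (c m.-1) (t m.-1)) (tpoly (z m) (t m.-1)).
have S2 : \sum_(2 <= m < n.+1) J (fun m k => a m k - b m k) m =
    \sum_(2 <= m < n.+1) J a m - \sum_(2 <= m < n.+1) J b m.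
  have gen (a1 a2 b1 b2 : R) : a1 - a2 - (b1 - b2) = a1 - b1 - (a2 - b2) by ring.
  by rewrite -sumrB; apply: eq_bigr => m _; rewrite /J !ipBt; exact: gen.
have gen (x x1 x2 y y1 y2 z' z1 z2 : R) : x = x1 - x2 -> y = y1 - y2 -> z' = z1 - z2 ->
    x + y + z' = x1 + y1 + z1 - (x2 + y2 + z2) by move=> -> -> ->; ring.
exact: gen S1 S2 (ipBt _ _ _ _).
Qed.

(* [e] and [z] stand for the error and its discrete Stokes inverse: the hypothesis
   [ez] makes (e, z) symmetric and turns [time_form] into the one of dG for
   grad z. *)
Section energy.
Variables (e z : nat -> 'I_N -> sob R d).
Hypotheses (Le : forall m k, L2O (e m k).1) (Lz : forall m k, L2O (z m k).1)
  (Lgz : forall m k, L2O (z m k).2).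
Hypothesis ez : forall m k m' l,
  ip (e m k).1 (z m' l).1 = ip (z m k).2 (z m' l).2.

Let e1 m k := (e m k).1.
Let z1 m k := (z m k).1.
Let z2 m k := (z m k).2.

Lemma energy_cross m m' s s' :
  ip (tpoly (e1 m) s) (tpoly (z1 m') s') = ip (tpoly (z2 m) s) (tpoly (z2 m') s').
Proof.
rewrite (ip_lincomb mO _ _ (Le m) (Lz m')) (ip_lincomb mO _ _ (Lgz m) (Lgz m')).
apply: eq_bigr => k _; apply: eq_bigr => l _.
by rewrite ez.
Qed.

(** By [ez] the integrands (e', z) and (z', e) agree, hence each is half the derivative of (e, z) =
    |grad z|^2. *)
Lemma energy_slab m : (0 < m <= M)%N ->
  \int[lebesgue_measure]_(s in Im t m) (ip_dpoly Omega (e1 m) (z1 m)).[s] =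
  (ip (tpoly (z2 m) (t m)) (tpoly (z2 m) (t m)) -
   ip (tpoly (z2 m) (t m.-1)) (tpoly (z2 m) (t m.-1))) / 2.
Proof.
move=> mM; have := Rintegral_ip_poly mO (Le m) (Lz m) (slab_lt t_incr mM).
have -> : ip_dpoly Omega (fun k => (z m k).1) (fun k => (e m k).1) =
    ip_dpoly Omega (e1 m) (z1 m).
  by apply: eq_bigr => k _; apply: eq_bigr => l _; rewrite ipC ez ipC -ez.
by rewrite !energy_cross => <-; field.
Qed.

(** The induction needs the stronger bound by half of |grad z|^2 at the end of the last slab. On the
    first slab the initial term |grad z(0+)|^2 makes up for the half that is subtracted. *)
Lemma time_form_ge0 : (0 < M)%N -> 0 <= time_form M e1 z1.
Proof.
move=> M0.
suff H n : (n < M)%N ->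
    ip (tpoly (z2 n.+1) (t n.+1)) (tpoly (z2 n.+1) (t n.+1)) / 2 <= time_form n.+1 e1 z1.
  rewrite -(prednK M0) (le_trans _ (H _ _)) ?prednK//.
  by rewrite divr_ge0// ip_ge0.
elim: n => [_|n IH nM].
  rewrite /time_form big_nat1 big_geq// energy_slab/=; last by rewrite M0.
  rewrite energy_cross; have := ip_ge0 mu Omega (tpoly (z2 1%N) (t 0%N)); lra.
have {}IH := IH (ltnW nM); rewrite time_form_recr// energy_slab// !energy_cross/=; move: IH.
set A := tpoly (z2 n.+1) _; set B := tpoly (z2 n.+2) (t n.+1).
have LA : L2O A by apply: L2mx_lincomb => //; exact: Lgz.
have LB : L2O B by apply: L2mx_lincomb => //; exact: Lgz.
have := ip_ge0 mu Omega (A \- B).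
rewrite ipBl//; last exact: L2mxB.
rewrite (ipBr mO LA LB LA) (ipBr mO LA LB LB) (ipC _ _ B A).
(* The new slab and its jump add (cc - bb) / 2 + (bb - ab), which is (cc - aa) / 2 plus half the
   square of the jump of grad z. *)
have gen (aa ab bb cc F : R) : 0 <= aa - ab - (ab - bb) -> aa / 2 <= F ->
  cc / 2 <= F + ((cc - bb) / 2 + (bb - ab)) by move=> ? ?; lra.
exact: gen.
Qed.

End energy.

End discrete_time_form.

(** * Integration by parts for u on one slab *)

Section time_by_parts.
Context {R : realType} {d : nat} (Omega : set 'rV[R]_d).
Hypothesis mO : measurable Omega.
Local Notation mu := (lebesgue_rV d).
Local Notation L2O := (L2mx mu Omega).
Local Notation ip := (L2inner mu Omega).

(** Fubini for the square of each entry; the finitely many entries share one exceptional null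
    set. *)
Lemma L2mxst_ae (J : set (measurableTypeR R)) m n (u : R -> 'rV[R]_d -> 'M[R]_(m, n)) :
  measurable J -> L2mxst J Omega u ->
  {ae lebesgue_measure, forall s, J s -> L2O (u s)}.
Proof.
move=> mJ Lu.
have mJO : measurable (J `*` Omega : set (measurableTypeR R * 'rV[R]_d)) by exact: measurableX.
suff H i j : {ae lebesgue_measure, forall s, J s -> L2 mu Omega (fun x => u s x i j)}.
  have : {ae lebesgue_measure, forall s, forall ij : 'I_m * 'I_n,
      J s -> L2 mu Omega (fun x => u s x ij.1 ij.2)}.
    by apply: filter_forall => -[i j]; exact: H.
  by apply: filterS => s Hs sJ i j; exact: (Hs (i, j)).
have [muij Iuij] := Lu i j.
have mrestr : measurable_fun setT ((fun z : measurableTypeR R * 'rV[R]_d => u z.1 z.2 i j) \_ (J `*` Omega)).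
  exact/(measurable_restrictT _ mJO).
move/(integrable_mkcond _ mJO) : Iuij => Iuij.
have := @ae_integrable1 _ _ (measurableTypeR R) 'rV[R]_d R lebesgue_measure (lebesgue_rV d) _ Iuij.
apply: filterS => s Is sJ.
have sE x : Omega x -> (J `*` Omega) (s, x) by [].
split.
  apply/(measurable_restrictT _ mO).
  have := measurableT_comp mrestr (pair1_measurable s).
  apply: eq_measurable_fun => x _; rewrite /= !patchE in_setX mem_set//.
apply/(integrable_mkcond _ mO); apply: eq_integrable Is => // x _.
by rewrite !patchE in_setX mem_set.
Qed.

Lemma L2mxstS (J K : set (measurableTypeR R)) m n (u : R -> 'rV[R]_d -> 'M[R]_(m, n)) :
  measurable J -> measurable K -> K `<=` J -> L2mxst J Omega u -> L2mxst K Omega u.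
Proof.
move=> mJ mK KJ Lu i j; have [mu Iu] := Lu i j.
have mJO : measurable (J `*` Omega : set (measurableTypeR R * 'rV[R]_d)) by exact: measurableX.
have mKO : measurable (K `*` Omega : set (measurableTypeR R * 'rV[R]_d)) by exact: measurableX.
have sub : K `*` Omega `<=` J `*` Omega by move=> z [zK zO]; split=> //; exact: KJ.
split; first exact: measurable_funS mu.
exact: integrableS Iu.
Qed.

(** Reduces u to scalar functions of time, to which [weak_derivative_by_parts] applies. *)
Lemma continuous_ip (T : R) (u : R -> 'rV[R]_d -> 'rV[R]_d) z :
  continuous_L2 T Omega u -> L2O z ->
  {within `[0, T], continuous (fun s => ip (u s) z)}.
Proof.
move=> cu Lz; apply/subspace_continuousP => s sI.
have [Lus us] := cu s sI.
have nz : (L2norm mu Omega (u r \- u s))%:E @[r --> within `[0, T] (nbhs s)] --> 0%E.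
  apply: cvg_trans us; apply: near_eq_cvg.
  apply: filterS (withinT _ _) => r rI.
  by rewrite -normL2E//; apply: L2mxB => //; have [] := cu r rI.
have {}nz : L2norm mu Omega (u r \- u s) @[r --> within `[0, T] (nbhs s)] --> 0.
  exact: (fine_cvg nz).
have nz' : L2norm mu Omega (u r \- u s) * L2norm mu Omega z @[r --> within `[0, T] (nbhs s)] --> 0 * L2norm mu Omega z.
  by apply: cvgMl; exact: nz.
rewrite mul0r in nz'.
apply/cvgrPdist_le => eps eps0; move/cvgrPdist_le : nz' => /(_ _ eps0).
apply: filterS2 (withinT _ _) => r rI.
rewrite sub0r normrN ger0_norm ?mulr_ge0 ?L2norm_ge0// => h.
have Lur : L2O (u r) by have [] := cu r rI.
rewrite distrC -ipBl// (le_trans _ h)// ip_le_L2norm//; exact: L2mxB.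
Qed.

Variables (T : R) (u ut : R -> 'rV[R]_d -> 'rV[R]_d).
Hypotheses (T0 : 0 < T) (cu : continuous_L2 T Omega u) (Lut : L2mxst `]0, T] Omega ut)
  (uut : is_time_derivative T Omega u ut).

Lemma inner_const_integrable z : L2O z ->
  lebesgue_measure.-integrable `]0, T] (fun s => (inner Omega (ut s) z)%:E).
Proof.
move=> Lz; have mJ : measurable (`]0, T] : set (measurableTypeR R)) by exact: measurable_itv.
have [] // := @L2mxst_ip _ _ _ _ mJ mO _ _ ut (fun=> z).
move=> i j; apply: (@L2_space_time _ _ _ _ mJ mO (fun x => z x i j)) => //.
have : lebesgue_measure (`]0, T] : set R) = T%:E.
  by rewrite lebesgue_measure_itv/= lte_fin T0 oppr0 adde0.
by move=> E; rewrite [X in (X < _)%E]E ltry.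
Qed.

(** Move the derivative from u to v, replace u by y both at s1 ([yend]) and against the derivative
    of v ([yorth]), and move the derivative back onto y. What remains is the mismatch at s0, where u
    and y need not agree. *)
Lemma slab_by_parts N (y z : 'I_N -> 'rV[R]_d -> 'rV[R]_d) v (s0 s1 : R) :
  0 <= s0 -> s0 < s1 -> s1 <= T ->
  (forall k, L2O (y k)) -> (forall k, L2O (z k)) ->
  (forall s, s \in `]s0, s1] -> v s = tpoly z s) ->
  (forall l, ip (u s1) (z l) = ip (tpoly y s1) (z l)) ->
  (forall (k l : 'I_N), \int[lebesgue_measure]_(s in `]s0, s1])
      (('X^k : {poly R})^`().[s] * ip (u s) (z l)) =
    \int[lebesgue_measure]_(s in `]s0, s1])
      (('X^k : {poly R})^`().[s] * ip (tpoly y s) (z l))) ->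
  inner_st `]s0, s1] Omega ut v =
  \int[lebesgue_measure]_(s in `]s0, s1]) (ip_dpoly Omega y z).[s] +
  ip (tpoly y s0) (tpoly z s0) - ip (u s0) (tpoly z s0).
Proof.
move=> s00 s01 s1T Ly Lz vz yend yorth.
have mJ : measurable (`]s0, s1] : set (measurableTypeR R)) by exact: measurable_itv.
have sub : (`]s0, s1] : set R) `<=` `]0, T].
  by apply: subset_itv; rewrite bnd_simp.
have Ih l : lebesgue_measure.-integrable `]0, T[ (EFin \o (fun s => inner Omega (ut s) (z l))).
  apply: integrableS (inner_const_integrable (Lz l)) => //.
  by apply: subset_itv; rewrite bnd_simp.
have Lus s : s \in `[0, T] -> L2O (u s) by move=> /cu[].
have part (l : 'I_N) : \int[lebesgue_measure]_(s in `]s0, s1]) (s ^+ l * inner Omega (ut s) (z l)) =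
    s1 ^+ l * ip (u s1) (z l) - s0 ^+ l * ip (u s0) (z l) -
    \int[lebesgue_measure]_(s in `]s0, s1]) (('X^l : {poly R})^`().[s] * ip (tpoly y s) (z l)).
  have := @weak_derivative_by_parts _ _ _ _ 'X^l s0 s1 (continuous_ip cu (Lz l)) (Ih l)
    (fun eta teta => uut teta (Lz l)) s00 s01 s1T.
  rewrite !hornerXn -yorth => <-; apply: eq_Rintegral => s _.
  by rewrite hornerXn.
have Isl (l : 'I_N) : lebesgue_measure.-integrable `]s0, s1]
    (EFin \o (fun s => s ^+ l * inner Omega (ut s) (z l))).
  have sT : (`]s0, s1] : set R) `<=` `[0, T].
    by apply: subset_itv; rewrite bnd_simp// ltW.
  have cX : continuous (fun s : R => s ^+ l) by move=> s; exact: exprn_continuous.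
  apply: (integrable_continuousM mJ (ltW T0) sT cX).
  exact: integrableS (inner_const_integrable (Lz l)).
have lhs : inner_st `]s0, s1] Omega ut v =
    \sum_(l < N) \int[lebesgue_measure]_(s in `]s0, s1]) (s ^+ l * inner Omega (ut s) (z l)).
  rewrite -Rintegral_sum//.
  have Lv : L2mxst `]s0, s1] Omega v.
    apply: (@eq_L2mx _ _ _ _ _ (measurableX mJ mO) _ _ (fun r => tpoly z r.1 r.2)).
      by move=> r /set_mem[rJ _]; rewrite vz.
    exact: L2mxst_tpoly.
  have Lut' := L2mxstS (measurable_itv _) mJ sub Lut.
  rewrite /inner_st /Rintegral; congr fine; apply: ae_eq_integral => //.
  - by have [/integrableP[]] := L2mxst_ip mJ mO Lut' Lv.
  - rewrite (_ : (fun s => _) = (fun s => \sum_(l < N) (s ^+ l * inner Omega (ut s) (z l))%:E)%E).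
      by apply: emeasurable_sum => l; have /integrableP[] := Isl l.
    by apply/funext => s; rewrite sumEFin.
  (* The inner product is expanded in the coefficients of v only where [ut s] is square integrable,
     that is, for almost every s. *)
  - apply: filterS (L2mxst_ae mJ Lut') => s /[swap] sJ /(_ sJ) Lus'.
    congr EFin; rewrite vz// [LHS](ipC mu Omega (ut s)) ip_lincombl//.
    by apply: eq_bigr => l _; rewrite ipC.
have ibp := Rintegral_ip_poly mO Ly Lz s01.
rewrite lhs (eq_bigr _ (fun l _ => part l)) !sumrB.
have -> : \sum_(l < N) \int[lebesgue_measure]_(s in `]s0, s1])
    (('X^l : {poly R})^`().[s] * ip (tpoly y s) (z l)) =
    \int[lebesgue_measure]_(s in `]s0, s1]) (ip_dpoly Omega z y).[s].
  have hE (l : 'I_N) s : ('X^l : {poly R})^`().[s] * ip (tpoly y s) (z l) =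
      (\sum_(k < N) ip (z l) (y k) *: (('X^l)^`() * 'X^k)).[s].
    rewrite ip_lincombl// mulr_sumr horner_sum; apply: eq_bigr => k _.
    by rewrite hornerZ hornerM hornerXn ipC; ring.
  rewrite -Rintegral_sum//.
    by apply: eq_Rintegral => s _; rewrite /ip_dpoly horner_sum; apply: eq_bigr => l _; rewrite hE.
  move=> l; rewrite (_ : _ \o _ = EFin \o
    horner (\sum_(k < N) ip (z l) (y k) *: (('X^l)^`() * 'X^k))).
    exact: integrable_horner.
  by apply/funext => s; rewrite /= hE.
have -> : \sum_(l < N) s1 ^+ l * ip (u s1) (z l) = ip (tpoly y s1) (tpoly z s1).
  rewrite [RHS]ipC ip_lincombl//; last exact: L2mx_lincomb.
  by apply: eq_bigr => l _; rewrite yend ipC.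
have -> : \sum_(l < N) s0 ^+ l * ip (u s0) (z l) = ip (u s0) (tpoly z s0).
  rewrite [RHS]ipC ip_lincombl//; last first.
    by apply: Lus; rewrite in_itv/= s00 (le_trans (ltW s01)).
  by apply: eq_bigr => l _; rewrite ipC.
have gen (a b c e f : R) : a + b = c - e -> c - f - b = a + e - f.
  by move=> H; rewrite (_ : b = c - e - a); [ring|rewrite -H addrAC subrr add0r].
exact: gen.
Qed.

End time_by_parts.

(** * The finite element spaces *)

Section galerkin_spaces.
Context {R : realType} {d : nat} (Omega : set 'rV[R]_d) (Xh : set (sob R d))
  (Mh : set ('rV[R]_d -> R)).
Hypotheses (mO : measurable Omega) (finX : fin_dim_subspace Xh)
  (finM : fin_dim_subspace Mh) (XH : Xh `<=` H10 Omega) (ML : Mh `<=` L20 Omega).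
Local Notation mu := (lebesgue_rV d).
Local Notation L2O := (L2mx mu Omega).
Local Notation ip := (L2inner mu Omega).
Local Notation V := (Vh Omega Xh Mh).
Implicit Types (u v : sob R d) (p q : 'rV[R]_d -> R).

(** Scalar functions as 1 x 1 matrices, so that the results on [L2inner] carry over to [sinner]. *)
Definition mx11 p : 'rV[R]_d -> 'M[R]_1 := fun x => const_mx (p x).

Lemma sinnerE p q : sinner Omega p q = ip (mx11 p) (mx11 q).
Proof. by apply: eq_Rintegral => x _; rewrite /frob !big_ord1 !mxE. Qed.

Lemma L2_mx11 p : L2 mu Omega p -> L2O (mx11 p).
Proof. by move=> Lp i j; under eq_fun do rewrite mxE. Qed.

Lemma sinnerC p q : sinner Omega p q = sinner Omega q p.
Proof. by rewrite !sinnerE ipC. Qed.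

Lemma ip_linear m n (a : R) (u v z : 'rV[R]_d -> 'M[R]_(m, n)) :
  L2O u -> L2O v -> L2O z -> ip (a *: u + v) z = a * ip u z + ip v z.
Proof. by move=> Lu Lv Lz; rewrite -ipZl// -ipDl//; exact: L2mxZ. Qed.

Lemma sinner_linear (a : R) p q r :
  L2 mu Omega p -> L2 mu Omega q -> L2 mu Omega r ->
  sinner Omega (a *: p + q) r = a * sinner Omega p r + sinner Omega q r.
Proof.
move=> Lp Lq Lr; rewrite !sinnerE -ip_linear; [|exact: L2_mx11..].
congr ip; apply/funext => x; apply/matrixP => i j.
by rewrite !mxE.
Qed.

Lemma div_linear (a : R) u v : div (a *: u + v) = a *: div u + div v.
Proof. by apply/funext => x; rewrite /div /= raddfD/= linearZ. Qed.

Lemma div_L2 v : L2O v.2 -> L2 mu Omega (div v).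
Proof.
move=> Lv; rewrite (_ : div v = (fun x => \sum_i v.2 x i i)) //.
by apply: L2_sum => // i _; exact: Lv.
Qed.

Lemma H10_L2 v : H10 Omega v -> L2O v.1 /\ L2O v.2.
Proof. by move=> [[]]. Qed.

Lemma Xh_L2 v : Xh v -> L2O v.1 /\ L2O v.2.
Proof. by move=> /XH/H10_L2. Qed.

Lemma Mh_L2 q : Mh q -> L2 mu Omega q.
Proof. by move=> /ML[]. Qed.

Lemma Vh_subspace : subspace_of V.
Proof.
have [X0 XD] := fin_dim_subspace_of finX; split.
  split=> // q Mq; rewrite /sinner (@eq_Rintegral _ _ _ _ _ (fun=> 0)).
    by rewrite Rintegral_cst// mul0r.
  by move=> x _; rewrite /div mxtrace0 mul0r.
move=> a u v [Xu Vu] [Xv Vv]; split; first exact: XD.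
move=> q Mq; rewrite div_linear sinner_linear.
- by rewrite Vu// Vv// mulr0 addr0.
- by apply: div_L2; case: (Xh_L2 Xu).
- by apply: div_L2; case: (Xh_L2 Xv).
- exact: Mh_L2.
Qed.

Lemma Vh_fin_dim : fin_dim_subspace V.
Proof.
have [n [b Xb]] := finX; apply: (@subspace_fin_dim _ _ n b) Vh_subspace _.
by rewrite -Xb => v [].
Qed.

Lemma Vh_L2 v : V v -> L2O v.1 /\ L2O v.2.
Proof. by move=> [/Xh_L2]. Qed.

(** The L^2-projection P_h. Functionals v -> (g, v) vanish on null vectors by Cauchy-Schwarz. *)
Lemma Vh_projection (g : 'rV[R]_d -> 'rV[R]_d) : L2O g ->
  exists2 r, V r & forall v, V v -> ip r.1 v.1 = ip g v.1.
Proof.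
move=> Lg.
apply: (@riesz_fin_dim _ _ V (fun u v => ip u.1 v.1) (fun v => ip g v.1)).
- exact: Vh_fin_dim.
- split=> [u v _ _|a u v z Vu Vv Vz|u _].
  + by rewrite ipC.
  + by apply: ip_linear; apply: (Vh_L2 _).1.
  + exact: ip_ge0.
- by move=> a u v Vu Vv; rewrite !(ipC _ _ g) ip_linear//; apply: (Vh_L2 _).1.
- move=> v Vv v0; have := ip_CS mO Lg (Vh_L2 Vv).1.
  by rewrite v0 mulr0 => g0; apply/eqP; rewrite -sqrf_eq0 eq_le g0 sqr_ge0.
Qed.

(** The operator A_h^-1. A null vector of the gradient form vanishes in L^2 by [H10_zero_gradient],
    hence (g, v) = 0 for it. *)
Lemma Vh_stokes_inverse (g : 'rV[R]_d -> 'rV[R]_d) : bounded_set Omega -> (0 < d)%N ->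
  L2O g -> exists2 z, V z & forall v, V v -> ip z.2 v.2 = ip g v.1.
Proof.
move=> bO d0 Lg.
apply: (@riesz_fin_dim _ _ V (fun u v => ip u.2 v.2) (fun v => ip g v.1)).
- exact: Vh_fin_dim.
- split=> [u v _ _|a u v z Vu Vv Vz|u _].
  + by rewrite ipC.
  + by apply: ip_linear; apply: (Vh_L2 _).2.
  + exact: ip_ge0.
- by move=> a u v Vu Vv; rewrite !(ipC _ _ g) ip_linear//; apply: (Vh_L2 _).1.
- move=> v Vv v0; have := ip_CS mO Lg (Vh_L2 Vv).1.
  rewrite (H10_zero_gradient (Ordinal d0) mO bO (XH Vv.1) v0) mulr0 => g0.
  by apply/eqP; rewrite -sqrf_eq0 eq_le g0 sqr_ge0.
Qed.

(** Applied to the coefficients of div u_h, it supplies the pressure test function that forces u_h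
    into V_h. *)
Lemma Mh_projection p : L2 mu Omega p ->
  exists2 r, Mh r & forall q, Mh q -> sinner Omega r q = sinner Omega p q.
Proof.
move=> Lp; apply: (@riesz_fin_dim _ _ Mh (sinner Omega) (sinner Omega p)) => //.
- split=> [u v _ _|a u v z Mu Mv Mz|u _].
  + exact: sinnerC.
  + by apply: sinner_linear; exact: Mh_L2.
  + by rewrite sinnerE; exact: ip_ge0.
- move=> a u v Mu Mv; rewrite !(sinnerC p) sinner_linear//; exact: Mh_L2.
- move=> v Mv; rewrite !sinnerE => v0.
  have := ip_CS mO (L2_mx11 Lp) (L2_mx11 (Mh_L2 Mv)).
  by rewrite v0 mulr0 => g0; apply/eqP; rewrite -sqrf_eq0 eq_le g0 sqr_ge0.
Qed.

End galerkin_spaces.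

(** * The bilinear form B on slab polynomials *)

Section discrete_bilinear_form.
Context {R : realType} {d : nat} (Omega : set 'rV[R]_d) {N : nat}.
Local Notation Im := Defs.Im.
Local Notation mu := (lebesgue_rV d).
Local Notation L2O := (L2mx mu Omega).
Local Notation ip := (L2inner mu Omega).
Variables (M : nat) (t : nat -> R).
Hypotheses (mO : measurable Omega) (t_incr : forall m, (m < M)%N -> t m < t m.+1)
  (M0 : (0 < M)%N).

Lemma tpoly1 (a : 'I_N -> sob R d) s : (tpoly a s).1 = tpoly (fun k => (a k).1) s.
Proof. exact: fst_lincomb. Qed.

Lemma tpoly2 (a : 'I_N -> sob R d) s : (tpoly a s).2 = tpoly (fun k => (a k).2) s.
Proof. exact: snd_lincomb. Qed.

Variables (U Z : nat -> 'I_N -> sob R d) (uh v : R -> sob R d).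
Hypotheses (LU : forall m k, L2O (U m k).1) (LZ : forall m k, L2O (Z m k).1)
  (uhU : forall m s, (0 < m <= M)%N -> Im t m s -> uh s = tpoly (U m) s)
  (vZ : forall m s, (0 < m <= M)%N -> Im t m s -> v s = tpoly (Z m) s).

Let U1 m k := (U m k).1.
Let Z1 m k := (Z m k).1.

(** Derivatives and one-sided limits are those of the slab polynomials. The limits agree with them
    only almost everywhere, which the inner products do not notice ([ip_ae]). *)
Lemma Bform_eval (T : R) ph q : Bform Omega T M t uh ph v q =
  time_form t Omega M U1 Z1
  + inner_st (itvT T) Omega (fun s => (uh s).2) (fun s => (v s).2)
  - sinner_st (itvT T) Omega ph (fun s => div (v s))
  + sinner_st (itvT T) Omega (fun s => div (uh s)) q.
Proof.
have uh1 m s : (0 < m <= M)%N -> s \in `]t m.-1, t m] -> (uh s).1 = tpoly (U1 m) s.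
  by move=> mM sm; rewrite (uhU mM sm) tpoly1.
have v1 m s : (0 < m <= M)%N -> s \in `]t m.-1, t m] -> (v s).1 = tpoly (Z1 m) s.
  by move=> mM sm; rewrite (vZ mM sm) tpoly1.
have Lt (c : nat -> 'I_N -> 'rV[R]_d -> 'rV[R]_d) m s :
    (forall m k, L2O (c m k)) -> L2O (tpoly (c m) s).
  by move=> Lc; apply: L2mx_lincomb.
have right_uh m (mM : (0 < m <= M)%N) := lim_right_tpoly mO (slab_lt t_incr mM) (LU m)
  (fun s => @uh1 m s mM).
have left_uh m (mM : (0 < m <= M)%N) := lim_left_tpoly mO (slab_lt t_incr mM) (LU m)
  (fun s => @uh1 m s mM).
have right_v m (mM : (0 < m <= M)%N) := lim_right_tpoly mO (slab_lt t_incr mM) (LZ m)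
  (fun s => @v1 m s mM).
have ip_ae (f f' g g' : 'rV[R]_d -> 'rV[R]_d) : L2O f -> L2O f' -> L2O g -> L2O g' ->
    {ae mu, forall x, Omega x -> f x = f' x} -> {ae mu, forall x, Omega x -> g x = g' x} ->
    ip f g = ip f' g'.
  move=> Lf Lf' Lg Lg' ff' gg'; rewrite (ae_ipl mO Lf Lf' Lg ff') ipC.
  by rewrite (ae_ipl mO Lg Lg' Lf' gg') ipC.
rewrite /Bform.
have -> : \sum_(1 <= m < M.+1) inner_st (Im t m) Omega (dt (fun s => (uh s).1)) (fun s => (v s).1) =
    \sum_(1 <= m < M.+1) \int[lebesgue_measure]_(s in Im t m) (ip_dpoly Omega (U1 m) (Z1 m)).[s].
  rewrite big_nat [RHS]big_nat; apply: eq_bigr => m /= mM.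
  exact: (inner_st_dt mO (slab_lt t_incr mM) (LU m) (LZ m) (fun s => @uh1 m s mM)
    (fun s => @v1 m s mM)).
have -> : \sum_(2 <= m < M.+1) inner Omega (jump Omega (fun s => (uh s).1) (t m.-1))
      (lim_right Omega (fun s => (v s).1) (t m.-1)) =
    \sum_(2 <= m < M.+1) (ip (tpoly (U1 m) (t m.-1)) (tpoly (Z1 m) (t m.-1))
       - ip (tpoly (U1 m.-1) (t m.-1)) (tpoly (Z1 m) (t m.-1))).
  rewrite big_nat [RHS]big_nat; apply: eq_bigr => m /andP[m2 mM1].
  have mM : (0 < m <= M)%N by rewrite (ltn_trans _ m2).
  have mM' : (0 < m.-1 <= M)%N by move: m2 mM1; case: (m) => [|[|m']]//= _ /ltnW.
  have [Lr er] := right_uh m mM; have [Ll el] := left_uh m.-1 mM'.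
  have [Lv ev] := right_v m mM.
  rewrite -ipBl; [|by []|exact: Lt|exact: Lt|exact: Lt].
  have LtU m' s := Lt U1 m' s LU; have LtZ m' s := Lt Z1 m' s LZ.
  apply: (ip_ae _ _ _ _ (L2mxB mO Lr Ll) (L2mxB mO (LtU m (t m.-1)) (LtU m.-1 (t m.-1)))
    Lv (LtZ m (t m.-1)) _ ev).
  by apply: filterS2 er el => x rx lx Ox; rewrite /= rx// lx.
have -> : inner Omega (lim_right Omega (fun s => (uh s).1) (t 0%N))
      (lim_right Omega (fun s => (v s).1) (t 0%N)) =
    ip (tpoly (U1 1%N) (t 0%N)) (tpoly (Z1 1%N) (t 0%N)).
  have m1 : (0 < 1 <= M)%N by [].
  have [Lr er] := right_uh 1%N m1; have [Lv ev] := right_v 1%N m1.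
  exact: (ip_ae _ _ _ _ Lr (Lt U1 1%N (t 0%N) LU) Lv (Lt Z1 1%N (t 0%N) LZ) er ev).
have gen (a b c e g h : R) : a + b - c + e + g + h = a + g + h + b - c + e by ring.
exact: gen.
Qed.

Lemma inner_lim_right0 (g : 'rV[R]_d -> 'rV[R]_d) : L2O g ->
  inner Omega g (lim_right Omega (fun s => (v s).1) (t 0%N)) =
  ip g (tpoly (Z1 1%N) (t 0%N)).
Proof.
move=> Lg; have m1 : (0 < 1 <= M)%N by [].
have v1 s : s \in `]t 0%N, t 1%N] -> (v s).1 = tpoly (Z1 1%N) s.
  by move=> sm; rewrite (vZ m1 sm) tpoly1.
have [Lv ev] := lim_right_tpoly mO (slab_lt t_incr m1) (LZ 1%N) v1.
have Lz : L2O (tpoly (Z1 1%N) (t 0%N)) by apply: L2mx_lincomb => // k; exact: LZ.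
by rewrite [LHS](ipC mu Omega g) (ae_ipl mO Lv Lz Lg ev) ipC.
Qed.

End discrete_bilinear_form.

(** * The time derivative of u against discrete test functions *)

Section continuous_identity.
Context {R : realType} {d : nat} (Omega : set 'rV[R]_d).
Local Notation Im := Defs.Im.
Local Notation mu := (lebesgue_rV d).
Local Notation L2O := (L2mx mu Omega).
Local Notation ip := (L2inner mu Omega).
Variables (M : nat) (t : nat -> R) (T : R) (w : nat).
Hypotheses (mO : measurable Omega) (t_incr : forall m, (m < M)%N -> t m < t m.+1)
  (M0 : (0 < M)%N) (t0 : t 0%N = 0) (tM : t M = T).
Variables (u ut : R -> 'rV[R]_d -> 'rV[R]_d) (u0 : 'rV[R]_d -> 'rV[R]_d)
  (piu : R -> 'rV[R]_d -> 'rV[R]_d) (V : set (sob R d))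
  (Q : nat -> 'I_w.+1 -> 'rV[R]_d -> 'rV[R]_d) (Y Z : nat -> 'I_w.+1 -> sob R d)
  (v : R -> sob R d).
Hypotheses (cu : continuous_L2 T Omega u) (Lut : L2mxst (itvT T) Omega ut)
  (uut : is_time_derivative T Omega u ut) (Lu0 : L2O u0)
  (uu0 : ae_on Omega (fun x => u 0 x = u0 x))
  (hpiu : is_pi_tau Omega w M t u piu)
  (LQ : forall m k, L2O (Q m k)) (LY : forall m k, L2O (Y m k).1)
  (LZ : forall m k, L2O (Z m k).1) (VZ : forall m k, V (Z m k))
  (piuQ : forall m s, (0 < m <= M)%N -> Im t m s -> piu s = tpoly (Q m) s)
  (YQ : forall m k z, V z -> ip (Y m k).1 z.1 = ip (Q m k) z.1)
  (vZ : forall m s, (0 < m <= M)%N -> Im t m s -> v s = tpoly (Z m) s).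

Let Y1 m k := (Y m k).1.
Let Z1 m k := (Z m k).1.

Let T0 : 0 < T.
Proof. by rewrite -t0 -tM; apply: (partition_lt t_incr). Qed.

Let t_itv m : (m <= M)%N -> t m \in `[0, T].
Proof.
by move=> mM; rewrite in_itv/= -[X in X <= _]t0 -tM !(partition_le t_incr).
Qed.

Let tpoly_YQ m m' l s : ip (tpoly (Y1 m) s) (Z1 m' l) = ip (tpoly (Q m) s) (Z1 m' l).
Proof.
rewrite (ip_lincombl mO _ (LY m) (LZ m' l)) (ip_lincombl mO _ (LQ m) (LZ m' l)).
by apply: eq_bigr => k _; rewrite YQ.
Qed.

(** Almost everywhere u(t_m) equals its left limit, the left limit of pi_tau u, and [Q m] at t_m;
    tests in V_h then do not separate Q from Y. The index m' is free because the value at t_m is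
    also tested on slab m + 1. *)
Let end_value m l m' : (0 < m <= M)%N ->
  ip (u (t m)) (Z1 m' l) = ip (tpoly (Y1 m) (t m)) (Z1 m' l).
Proof.
move=> mM; have [tm0 mM'] : 0 < t m /\ (m <= M)%N.
  by case/andP: mM => m0 mM; split=> //; rewrite -t0 (partition_lt t_incr).
have [_ /(_ m mM)[ul _]] := hpiu.
have tmT : 0 < t m <= T by rewrite tm0 -tM (partition_le t_incr).
have [Lul eul] := lim_left_continuous_L2 mO cu tmT.
have [Lpl epl] := lim_left_tpoly mO (slab_lt t_incr mM) (LQ m) (fun s => @piuQ m s mM).
have [Lum _] := cu (t_itv mM').
have Lt : L2O (tpoly (Q m) (t m)) by apply: L2mx_lincomb.
rewrite tpoly_YQ.
apply: (etrans (esym (ae_ipl mO Lul Lum (LZ m' l) eul))).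
apply: (etrans _ (ae_ipl mO Lpl Lt (LZ m' l) epl)).
apply: (ae_ipl mO Lul Lpl (LZ m' l)).
have {}ul : {ae mu, forall x, Omega x ->
  lim_left Omega piu (t m) x = lim_left Omega u (t m) x} := ul.
by apply: filterS ul => x + Ox => /(_ Ox) ->.
Qed.

(** The derivative of X^k is zero or k X^(k-1) with k - 1 < w, a weight to which pi_tau u - u is
    orthogonal by definition. *)
Let orthogonality m (k l : 'I_w.+1) : (0 < m <= M)%N ->
  \int[lebesgue_measure]_(s in Im t m) (('X^k : {poly R})^`().[s] * ip (u s) (Z1 m l)) =
  \int[lebesgue_measure]_(s in Im t m)
    (('X^k : {poly R})^`().[s] * ip (tpoly (Y1 m) s) (Z1 m l)).
Proof.
move=> mM; have mM' : (m <= M)%N by case/andP: mM.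
have sub : Im t m `<=` `[0, T].
  apply: subset_itv; rewrite bnd_simp.
    by have := t_itv (leq_trans (leq_pred m) mM'); rewrite in_itv/= => /andP[].
  by have := t_itv mM'; rewrite in_itv/= => /andP[].
have mI : measurable (Im t m : set (measurableTypeR R)) by exact: measurable_itv.
have Iu : lebesgue_measure.-integrable (Im t m) (EFin \o (fun s => ip (u s) (Z1 m l))).
  by apply: integrableS (integrable_continuous_itv (continuous_ip mO cu (LZ m l))).
have IY : lebesgue_measure.-integrable (Im t m)
    (EFin \o (fun s => ip (tpoly (Y1 m) s) (Z1 m l))).
  pose q : {poly R} := \sum_(j < w.+1) ip (Y1 m j) (Z1 m l) *: 'X^j.
  rewrite (_ : _ \o _ = EFin \o horner q); first exact: integrable_horner.
  apply/funext => s /=; congr EFin; rewrite /q horner_sum.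
  rewrite (ip_lincombl mO _ (LY m) (LZ m l)).
  by apply: eq_bigr => j _; rewrite hornerZ hornerXn mulrC.
have cq (q : {poly R}) : continuous (fun s : R => q.[s]).
  by apply: smooth_continuous; exact: smooth_horner.
have Iq (q : {poly R}) k' (Ik : lebesgue_measure.-integrable (Im t m) (EFin \o k')) :=
  integrable_continuousM mI (ltW T0) sub (cq q) Ik.
apply/eqP; rewrite -subr_eq0 -RintegralB//; [|exact: Iq..].
case: k => -[|k] kw /=.
  rewrite (@eq_Rintegral _ _ _ _ _ (fun=> 0)) ?Rintegral_cst ?mul0r//.
  by move=> s _; rewrite expr0 derivC horner0 !mul0r subrr.
(* The original exponent is now k + 1. This choice of coefficients gives the single monomial s^k
   times [Z1 m l]. *)
have [_ /(_ m mM)[_ /(_ (fun j => if j == Ordinal (kw : (k < w)%N) then Z1 m l else 0))]] := hpiu.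
set vv := (fun s x => \sum_(k < w) _) => H.
have {H} : inner_st (Im t m) Omega (fun s x => piu s x - u s x) vv = 0.
  by apply: H => j; case: ifP => _; [exact: LZ|exact: L2mx0].
have -> : inner_st (Im t m) Omega (fun s x => piu s x - u s x) vv =
    \int[lebesgue_measure]_(s in Im t m)
      (s ^+ k * (ip (tpoly (Y1 m) s) (Z1 m l) - ip (u s) (Z1 m l))).
  apply: eq_Rintegral => s /set_mem sI.
  have Lus : L2O (u s) by have [] := cu (sub _ sI).
  have LQs : L2O (tpoly (Q m) s) by apply: L2mx_lincomb.
  have vvE : vv s = s ^+ k *: Z1 m l.
    apply/funext => x; rewrite /vv (bigD1 (Ordinal (kw : (k < w)%N)))//= eqxx.
    by rewrite big1 ?addr0// => j /negbTE ->; rewrite scaler0.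
  have -> : (fun x => piu s x - u s x) = tpoly (Q m) s \- u s.
    by rewrite -(piuQ mM sI).
  rewrite vvE tpoly_YQ -(ipBl mO LQs Lus (LZ m l)).
  exact: (ipZr mO (s ^+ k) (LZ m l) (L2mxB mO LQs Lus)).
(* The factor k + 1 comes from differentiating X^(k+1), the sign from the order of u and pi_tau
   u. *)
move=> H; apply/eqP; rewrite -[RHS](mulr0 (- k.+1%:R)) -[in RHS]H -RintegralZl//; last first.
  rewrite (_ : _ \o _ = EFin \o (fun s => s ^+ k * ip (tpoly (Y1 m) s) (Z1 m l)
    - s ^+ k * ip (u s) (Z1 m l))); last by apply/funext => s; rewrite /= mulrBr.
  have I1 := Iq ('X^k) _ IY; have I2 := Iq ('X^k) _ Iu.
  rewrite (_ : _ \o _ = (fun s => (('X^k).[s] * ip (tpoly (Y1 m) s) (Z1 m l))%:E -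
      (('X^k).[s] * ip (u s) (Z1 m l))%:E)%E); first exact: integrableB.
  by apply/funext => s; rewrite /= hornerXn.
apply: eq_Rintegral => s _; rewrite derivXn hornerMn hornerXn/=.
by rewrite -mulr_natl; ring.
Qed.

(** Sum [slab_by_parts] over the slabs. At the start of slab m, u(t_(m-1)) is replaced by the end
    value of Y on slab m - 1, so that the mismatch becomes exactly the jump term of [time_form]. *)
Lemma inner_st_dt_continuous :
  inner_st (itvT T) Omega ut (fun s => (v s).1) =
  time_form t Omega M Y1 Z1 - ip u0 (tpoly (Z1 1%N) 0).
Proof.
have slab m : (0 < m <= M)%N -> inner_st (Im t m) Omega ut (fun s => (v s).1) =
    \int[lebesgue_measure]_(s in Im t m) (ip_dpoly Omega (Y1 m) (Z1 m)).[s] +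
    (ip (tpoly (Y1 m) (t m.-1)) (tpoly (Z1 m) (t m.-1)) -
     ip (u (t m.-1)) (tpoly (Z1 m) (t m.-1))).
  move=> mM; have mM' : (m <= M)%N by case/andP: mM.
  have s00 : 0 <= t m.-1.
    by have := t_itv (leq_trans (leq_pred m) mM'); rewrite in_itv/= => /andP[].
  have s1T : t m <= T by have := t_itv mM'; rewrite in_itv/= => /andP[].
  have vm s : s \in `]t m.-1, t m] -> (v s).1 = tpoly (Z1 m) s.
    by move=> sm; rewrite (vZ mM sm) tpoly1.
  rewrite addrA.
  exact: (slab_by_parts mO T0 cu Lut uut s00 (slab_lt t_incr mM) s1T (LY m) (LZ m) vm
    (fun l => end_value l m mM) (fun k l => orthogonality k l mM)).
have Lv : L2mxst (itvT T) Omega (fun s => (v s).1).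
  rewrite /itvT -t0 -tM; apply: (@L2mxst_piecewise _ _ _ t_incr _ _ mO _ _ w.+1).
    by rewrite t0 tM.
  move=> m mM; exists (Z1 m); split=> [l|s sm]; first exact: LZ.
  by rewrite (vZ mM sm) tpoly1.
have mJ : measurable (`]0, T] : set (measurableTypeR R)) by exact: measurable_itv.
have [Iutv _] := L2mxst_ip mJ mO Lut Lv.
rewrite /inner_st /itvT -[X in `]X, _]]t0 -tM (Rintegral_slabs t_incr)//; last first.
  by rewrite t0 tM; exact: Iutv.
rewrite big_nat (eq_bigr _ (fun m mM => slab m mM)) -big_nat big_split/=.
rewrite /time_form -!addrA; congr (_ + _).
(* The first slab has no predecessor; there u(0) = u0 remains. *)
rewrite (big_ltn (m := 1%N))// addrC [in RHS]addrA -addrA; congr (_ + _).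
  rewrite big_nat [RHS]big_nat; apply: eq_bigr => m /andP[m2 mM].
  have mM' : (0 < m.-1 <= M)%N by move: m2 mM; case: (m) => [|[|m']]//= _ /ltnW.
  have Lum : L2O (u (t m.-1)) by have [] := cu (t_itv (proj2 (andP mM'))).
  have LYm : L2O (tpoly (Y1 m.-1) (t m.-1)).
    by apply: L2mx_lincomb => // k; exact: LY.
  congr (_ - _); rewrite [LHS]ipC [RHS]ipC.
  rewrite (ip_lincombl mO _ (LZ m) Lum) (ip_lincombl mO _ (LZ m) LYm).
  by apply: eq_bigr => l _; rewrite ipC end_value// ipC.
rewrite /= t0; congr (_ - _).
have T0itv : (0 : R) \in `[0, T] by rewrite in_itv/= lexx ltW.
have Lz : L2O (tpoly (Z1 1%N) 0) by apply: L2mx_lincomb => // k; exact: LZ.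
have uu0' : {ae mu, forall x, Omega x -> u 0 x = u0 x} := uu0.
have [Lu00 _] := cu T0itv.
have E := ae_ipl mO Lu00 Lu0 Lz uu0'.
exact: E.
Qed.

End continuous_identity.

(** * The error estimate *)

Section error_estimate.
Context {R : realType} {d : nat} (Omega : set 'rV[R]_d) (w M : nat) (t : nat -> R) (T : R)
  (Xh : set (sob R d)) (Mh : set ('rV[R]_d -> R)).
Local Notation Im := Defs.Im.
Local Notation mu := (lebesgue_rV d).
Local Notation L2O := (L2mx mu Omega).
Local Notation ip := (L2inner mu Omega).
Local Notation V := (Vh Omega Xh Mh).
Hypotheses (mO : measurable Omega) (bO : bounded_set Omega) (d0 : (0 < d)%N)
  (finX : fin_dim_subspace Xh) (finM : fin_dim_subspace Mh)
  (XH : Xh `<=` H10 Omega) (ML : Mh `<=` L20 Omega).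
Hypotheses (t_incr : forall m, (m < M)%N -> t m < t m.+1) (M0 : (0 < M)%N)
  (t0 : t 0%N = 0) (tM : t M = T).

Let T0 : 0 < T.
Proof. by rewrite -t0 -tM; apply: (partition_lt t_incr). Qed.

Let mI : measurable (itvT T : set (measurableTypeR R)).
Proof. exact: measurable_itv. Qed.

Let ae_filter : Filter (almost_everywhere (lebesgue_measure : set (measurableTypeR R) -> \bar R)).
Proof. exact: ae_filter_ringOfSetsType. Qed.

Let mIO : measurable (itvT T `*` Omega : set (measurableTypeR R * 'rV[R]_d)).
Proof. exact: measurableX. Qed.

(** Coefficients are chosen for every index m, with 0 where m is not a slab, so that membership in S
    holds without side condition. *)
Lemma Xtau_coef (E : lmodType R) (S : set E) v : S 0 -> Xtau w M t S v ->
  exists a : nat -> 'I_w.+1 -> E, (forall m k, S (a m k)) /\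
    forall m s, (0 < m <= M)%N -> Im t m s -> v s = tpoly (a m) s.
Proof.
move=> S0 Xv.
have /choice[a aP] m : exists a : 'I_w.+1 -> E, (forall k, S (a k)) /\
    ((0 < m <= M)%N -> forall s, Im t m s -> v s = tpoly a s).
  have [mM|mM] := boolP (0 < m <= M)%N; last by exists (fun=> 0).
  by have [a [Sa va]] := Xv m mM; exists a.
exists a; split=> [m k|m s mM sm]; first by have [] := aP m.
by have [_ /(_ mM s sm)] := aP m.
Qed.

Lemma slab_of s : itvT T s -> exists2 m, (0 < m <= M)%N & Im t m s.
Proof.
rewrite /itvT /= in_itv/= -t0 -tM => sT.
by have [m mM sm] := slab_cover sT; exists m.
Qed.

Lemma subspace_tpoly (E : lmodType R) (S : set E) (a : 'I_w.+1 -> E) s :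
  subspace_of S -> (forall k, S (a k)) -> S (tpoly a s).
Proof. by move=> sS Sa; apply: subspace_sum. Qed.

Lemma L2mxst_coef m n (f : R -> 'rV[R]_d -> 'M[R]_(m, n))
    (a : nat -> 'I_w.+1 -> 'rV[R]_d -> 'M[R]_(m, n)) :
  (forall m k, L2O (a m k)) ->
  (forall m s, (0 < m <= M)%N -> Im t m s -> f s = tpoly (a m) s) ->
  L2mxst (itvT T) Omega f.
Proof.
move=> La fa; rewrite /itvT -t0 -tM.
apply: (@L2mxst_piecewise _ _ _ t_incr _ _ mO _ _ w.+1); first by rewrite t0 tM.
by move=> k kM; exists (a k); split=> // s sk; exact: fa.
Qed.

Lemma Xtau_L2mxst (S : set ('rV[R]_d -> 'rV[R]_d)) g :
  S 0 -> (forall v, S v -> L2O v) -> Xtau w M t S g ->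
  L2mxst (itvT T) Omega g.
Proof.
move=> S0 SL Xg; have [a [Sa ga]] := Xtau_coef S0 Xg.
by apply: (@L2mxst_coef _ _ _ a) => // m k; exact: SL.
Qed.

Lemma Xtau_sob_L2mxst (S : set (sob R d)) g :
  S 0 -> (forall v, S v -> L2O v.1) -> Xtau w M t S g ->
  L2mxst (itvT T) Omega (fun s => (g s).1).
Proof.
move=> S0 SL Xg; have [a [Sa ga]] := Xtau_coef S0 Xg.
apply: (@L2mxst_coef _ _ _ (fun m k => (a m k).1)) => [m k|m s mM sm].
  exact: SL.
by rewrite (ga m s mM sm) tpoly1.
Qed.

Lemma inner_st_ae m n m' n' (f g : R -> 'rV[R]_d -> 'M[R]_(m, n))
    (f' g' : R -> 'rV[R]_d -> 'M[R]_(m', n')) :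
  L2mxst (itvT T) Omega f -> L2mxst (itvT T) Omega g ->
  L2mxst (itvT T) Omega f' -> L2mxst (itvT T) Omega g' ->
  {ae lebesgue_measure, forall s, itvT T s -> ip (f s) (g s) = ip (f' s) (g' s)} ->
  inner_st (itvT T) Omega f g = inner_st (itvT T) Omega f' g'.
Proof.
move=> Lf Lg Lf' Lg' fg; rewrite /inner_st /Rintegral; congr fine.
apply: ae_eq_integral => //.
- by have [/integrableP[]] := L2mxst_ip mI mO Lf Lg.
- by have [/integrableP[]] := L2mxst_ip mI mO Lf' Lg'.
- rewrite /ae_eq; have FF := @ae_filter_ringOfSetsType _ (measurableTypeR R) R lebesgue_measure.
  by apply: (@filterS _ _ FF _ _ _ fg) => s /[apply] e; congr EFin; exact: e.
Qed.

Variables (u0 : sob R d) (u : R -> sob R d) (ut : R -> 'rV[R]_d -> 'rV[R]_d)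
  (p : R -> 'rV[R]_d -> R) (f : R -> 'rV[R]_d -> 'rV[R]_d)
  (uh : R -> sob R d) (ph : R -> 'rV[R]_d -> R) (piu : R -> 'rV[R]_d -> 'rV[R]_d)
  (rS : R -> sob R d) (rP : R -> 'rV[R]_d -> R) (chi : R -> sob R d).
Hypotheses (Lu0 : L2O u0.1) (hup : weak_solution Omega T f u0 u ut p)
  (huph : discrete_solution Omega T w M t Xh Mh f u0 uh ph)
  (hpiu : is_pi_tau Omega w M t (fun s => (u s).1) piu)
  (hRS : is_stokes_projection_st Omega T Xh Mh u p rS rP)
  (hchi : Xtau w M t V chi) (LrS : L2mxst (itvT T) Omega (fun s => (rS s).1)).

Let V_sub : subspace_of V := Vh_subspace mO finX XH ML.

(* The discrete equation only controls integrals in time; it is compared for q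
   and for 0, with q(s) the projection of div u_h(s) onto M_h. *)
Lemma discrete_solution_Vh :
  {ae lebesgue_measure, forall s, itvT T s -> V (uh s)}.
Proof.
have [XU Mph eqh] := huph.
have [U [XUk uhU]] := Xtau_coef (proj1 (fin_dim_subspace_of finX)) XU.
have LU m k := Xh_L2 XH (XUk m k).
have Ldiv m k : L2 mu Omega (div (U m k)) by apply: div_L2 => //; case: (LU m k).
have /choice[Pr PrP] (p0 : 'rV[R]_d -> R) : exists r, L2 mu Omega p0 ->
    Mh r /\ forall q, Mh q -> sinner Omega r q = sinner Omega p0 q.
  have [Lp|nLp] := pselect (L2 mu Omega p0); last by exists p0.
  by have [r Mr rP0] := Mh_projection mO finM ML Lp; exists r.
pose q0 m k := Pr (div (U m k)).
have Mq0 m k : Mh (q0 m k) by case: (PrP _ (Ldiv m k)).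
have q0P m k r : Mh r -> sinner Omega (q0 m k) r = sinner Omega (div (U m k)) r.
  by case: (PrP _ (Ldiv m k)) => _; exact.
pose q := piecewise M t q0.
have qE m s (mM : (0 < m <= M)%N) (sm : Im t m s) := piecewiseE t_incr q0 mM sm.
have M_sub := fin_dim_subspace_of finM.
have Xq : Xtau w M t Mh q.
  by move=> m mM; exists (q0 m); split=> // s sm; exact: qE.
have Xv0 : Xtau w M t Xh (fun=> 0).
  move=> m mM; exists (fun=> 0); split=> [k|s _].
    exact: (proj1 (fin_dim_subspace_of finX)).
  by rewrite big1// => k _; rewrite scaler0.
have Xq0 : Xtau w M t Mh (fun=> 0).
  move=> m mM; exists (fun=> 0); split=> [k|s _]; first exact: (proj1 M_sub).
  by rewrite big1// => k _; rewrite scaler0.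
have /eqP := etrans (eqh _ _ Xv0 Xq) (esym (eqh _ _ Xv0 Xq0)).
rewrite /Bform !(inj_eq (addIr _)) (inj_eq (addrI _)) => /eqP.
have -> : sinner_st (itvT T) Omega (fun s => div (uh s)) (fun=> 0) = 0.
  rewrite /sinner_st (@eq_Rintegral _ _ _ _ _ (fun=> 0)) ?Rintegral_cst ?mul0r//.
  move=> s _; rewrite /sinner (@eq_Rintegral _ _ _ _ _ (fun=> 0)) ?Rintegral_cst ?mul0r//.
  by move=> x _; rewrite mulr0.
(* Projecting the coefficients of div u_h projects its value at each time, as both sides are linear
   in the coefficients. *)
have divqE s r : itvT T s -> Mh r -> sinner Omega (div (uh s)) r = sinner Omega (q s) r.
  move=> /slab_of[m mM sm] Mr.
  have Lr := L2_mx11 (Mh_L2 ML Mr).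
  have divE : div (uh s) = \sum_(k < w.+1) s ^+ k *: div (U m k).
    rewrite (uhU m s mM sm); apply/funext => x.
    rewrite /div tpoly2 /tpoly !fct_sumE raddf_sum; apply: eq_bigr => k _.
    by rewrite /= linearZ.
  have lin (g : 'I_w.+1 -> 'rV[R]_d -> R) : (forall k, L2 mu Omega (g k)) ->
      sinner Omega (\sum_(k < w.+1) s ^+ k *: g k) r =
      \sum_(k < w.+1) s ^+ k * sinner Omega (g k) r.
    move=> Lg; have Lg' k := L2_mx11 (Lg k).
    rewrite sinnerE (_ : mx11 _ = \sum_(k < w.+1) s ^+ k *: mx11 (g k)).
      rewrite ip_lincombl//; apply: eq_bigr => k _; by rewrite sinnerE.
    apply/funext => x; apply/matrixP => i j; rewrite mxE !fct_sumE summxE.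
    by apply: eq_bigr => k _; rewrite !mxE.
  have qsE : q s = \sum_(k < w.+1) s ^+ k *: q0 m k by exact: qE.
  rewrite divE qsE !lin//; first by apply: eq_bigr => k _; rewrite q0P.
  by move=> k; exact: Mh_L2 (Mq0 m k).
have Mq s : itvT T s -> Mh (q s).
  move=> /slab_of[m mM sm]; have -> : q s = tpoly (q0 m) s := qE m s mM sm.
  exact: subspace_tpoly.
have Lq : L2mxst (itvT T) Omega (fun s => mx11 (q s)).
  apply: (@L2mxst_coef _ _ _ (fun m k => mx11 (q0 m k))).
    by move=> m k; apply: L2_mx11; exact: Mh_L2 (Mq0 m k).
  move=> m s mM sm; have -> : q s = tpoly (q0 m) s := qE m s mM sm.
  apply/funext => x; apply/matrixP => i j.
  rewrite mxE /tpoly !fct_sumE summxE.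
  by apply: eq_bigr => k _; rewrite !mxE.
have [Iq _] := L2mxst_ip mI mO Lq Lq.
move=> q_eq0.
have qq0 : (\int[lebesgue_measure]_(s in itvT T) `|(inner Omega (mx11 (q s)) (mx11 (q s)))%:E| = 0)%E.
  transitivity (\int[lebesgue_measure]_(s in itvT T) (inner Omega (mx11 (q s)) (mx11 (q s)))%:E)%E.
    by apply: eq_integral => s _; rewrite gee0_abs// lee_fin; exact: ip_ge0.
  rewrite -(fineK (integrable_fin_num mI Iq)); congr EFin.
  rewrite -[RHS]q_eq0; apply: eq_Rintegral => s /set_mem sT.
  by rewrite divqE//; [rewrite sinnerE|exact: Mq].
have /ae_eq_integral_abs : measurable_fun (itvT T : set (measurableTypeR R))
    (fun s => (inner Omega (mx11 (q s)) (mx11 (q s)))%:E).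
  by have /integrableP[] := Iq.
move=> /(_ lebesgue_measure mI)[/(_ qq0) + _].
apply: filterS => s qs sT; have {}qs : ip (mx11 (q s)) (mx11 (q s)) = 0.
  by have := qs sT => -[].
split; first by have [m mM sm] := slab_of sT; rewrite (uhU m s mM sm); exact: subspace_tpoly (fin_dim_subspace_of finX) (XUk m).
move=> r Mr; rewrite divqE// sinnerE; apply/eqP; rewrite -sqrf_eq0 eq_le sqr_ge0 andbT.
have := ip_CS mO (L2_mx11 (Mh_L2 ML (Mq s sT))) (L2_mx11 (Mh_L2 ML Mr)).
by rewrite qs mul0r.
Qed.

(** For almost every s, the definition of R_h^S tested with v(s) replaces (u, p) by its projection.
    The projected pressure drops out because v(s) is in V_h, and [pair] then trades (grad R, grad v)
    for (R, eta). *)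
Lemma stokes_projection_pairing (v : R -> sob R d) (eta : R -> 'rV[R]_d -> 'rV[R]_d) :
  L2mxst (itvT T) Omega (fun s => (v s).2) -> L2mxst (itvT T) Omega eta ->
  (forall s, itvT T s -> V (v s)) ->
  (forall s r, itvT T s -> V r -> ip r.2 (v s).2 = ip r.1 (eta s)) ->
  inner_st (itvT T) Omega (fun s => (u s).2) (fun s => (v s).2)
  - sinner_st (itvT T) Omega p (fun s => div (v s)) =
  inner_st (itvT T) Omega (fun s => (rS s).1) eta.
Proof.
move=> Lv2 Leta Vv pair.
have [[_ Lu2 Vu] _ [Lp Lp0] _ _] := hup; have [_ RS] := hRS.
have Lmp : L2mxst (itvT T) Omega (fun s => mx11 (p s)).
  by move=> i j; apply: eq_L2 Lp => // z _; rewrite mxE.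
have Lmd : L2mxst (itvT T) Omega (fun s => mx11 (div (v s))).
  move=> i j; apply: (@eq_L2 _ _ _ _ _ mIO (fun z => \sum_k (v z.1).2 z.2 k k)).
    by move=> z _; rewrite mxE.
  by apply: L2_sum => // k _; exact: Lv2.
have -> : sinner_st (itvT T) Omega p (fun s => div (v s)) =
    inner_st (itvT T) Omega (fun s => mx11 (p s)) (fun s => mx11 (div (v s))).
  by apply: eq_Rintegral => s _; exact: sinnerE.
have [I1 _] := L2mxst_ip mI mO Lu2 Lv2.
have [I2 _] := L2mxst_ip mI mO Lmp Lmd.
have [I3 _] := L2mxst_ip mI mO LrS Leta.
rewrite /inner_st -RintegralB// /Rintegral; congr fine.
have I12 := integrableB mI I1 I2.
apply: ae_eq_integral => //.
- by have /integrableP[] := I12.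
- by have /integrableP[] := I3.
have FF := @ae_filter_ringOfSetsType _ (measurableTypeR R) R lebesgue_measure.
apply: (@filterS3 _ _ FF _ _ _ _ _ Vu Lp0 RS) => s + + + sT.
move=> /(_ sT)[Hu divu] /(_ sT)[Lps _] /(_ sT)[XrS MrP orth div0]; congr EFin.
have [Lus1 Lus2] := H10_L2 Hu; have [Lr1 Lr2] := Xh_L2 XH XrS.
have [Lvs1 Lvs2] := Vh_L2 XH (Vv s sT).
(* R_h^S preserves the divergence tested against M_h, and div u(s) = 0. *)
have VrS : V (rS s).
  split=> // q Mq; have Lq := Mh_L2 ML Mq.
  have := div0 q Mq; rewrite (_ : u s - rS s = -1 *: rS s + u s); last first.
    by rewrite scaleN1r addrC.
  rewrite div_linear sinner_linear//; [|exact: div_L2..].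
  have -> : sinner Omega (div (u s)) q = 0.
    rewrite sinnerE (@ae_ipl _ _ _ mu _ mO _ _ _ (fun=> 0)) ?ip0l//.
    + by apply: L2_mx11; exact: div_L2.
    + exact: L2mx0.
    + exact: L2_mx11.
    + have {}divu : {ae mu, forall x, Omega x -> div (u s) x = 0} := divu.
      apply: filterS divu => x /[apply] dx; apply/matrixP => i j.
      by rewrite !mxE dx.
  by rewrite addr0 mulN1r => /eqP; rewrite oppr_eq0 => /eqP.
have Ldv := div_L2 mO Lvs2.
have := orth _ (proj1 (Vv s sT)).
have -> : inner Omega (u s - rS s).2 (v s).2 = ip (u s).2 (v s).2 - ip (rS s).2 (v s).2.
  by rewrite -ipBl.
have -> : sinner Omega (p s - rP s) (div (v s)) =
    ip (mx11 (p s)) (mx11 (div (v s))) - ip (mx11 (rP s)) (mx11 (div (v s))).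
  rewrite sinnerE -ipBl//; [|exact: L2_mx11|by apply: L2_mx11; exact: Mh_L2 MrP|exact: L2_mx11].
  by apply: eq_ip => // x _; apply/matrixP => i j; rewrite !mxE.
have -> : ip (mx11 (rP s)) (mx11 (div (v s))) = 0.
  by rewrite -sinnerE sinnerC; case: (Vv s sT) => _; exact.
rewrite (pair s (rS s) sT VrS) subr0 => /eqP; rewrite subr_eq0 => /eqP Hs.
rewrite [X in _ - X](_ : _ = ip (u s).2 (v s).2 - ip (rS s).1 (eta s)); last by rewrite Hs.
by rewrite opprB addrC subrK.
Qed.

(** The witness y is P_h pi_tau u. The theorem uses it only as an intermediate point between u_h and
    chi. *)
Lemma discrete_error : exists y : R -> sob R d,
  [/\ L2mxst (itvT T) Omega (fun s => (y s).1),
      L2norm lebesgue_st (itvT T `*` Omega) (fun z => (uh z.1).1 z.2 - (y z.1).1 z.2) <=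
      L2norm lebesgue_st (itvT T `*` Omega) (fun z => (rS z.1).1 z.2 - piu z.1 z.2) &
      L2norm lebesgue_st (itvT T `*` Omega) (fun z => (chi z.1).1 z.2 - (y z.1).1 z.2) <=
      L2norm lebesgue_st (itvT T `*` Omega) (fun z => (chi z.1).1 z.2 - piu z.1 z.2)].
Proof.
(* Here a1 and a2 are the time forms of u_h and y against v, b = (u_h, e), r = (R_h^S(u, p), e), l =
   (f, v) and c = (u0, v(0+)). Subtracting the discrete and the continuous equation gives a1 - a2 =
   r - b. *)
have gen (a1 a2 b r l c : R) : a1 + b - 0 + 0 = l + c -> a2 - c + r = l ->
    0 <= a1 - a2 -> b <= r.
  move=> e1 e2; rewrite (_ : a1 - a2 = r - b) ?subr_ge0//.
  rewrite (_ : a1 = l + c - b); last by rewrite -e1 subr0 addr0 addrK.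
  by rewrite -e2; ring.
have [XU Mph eqh] := huph.
have [[Lu1 Lu2 Vu] [Lut uut] _ [cu uu0] eqw] := hup.
have X_sub := fin_dim_subspace_of finX.
have [U [XUk uhU]] := Xtau_coef (proj1 X_sub) XU.
have LU m k := Xh_L2 XH (XUk m k).
have S0 : [set g : 'rV[R]_d -> 'rV[R]_d | L2O g] 0 by exact: L2mx0.
have [Q [LQ piuQ]] := Xtau_coef S0 (proj1 hpiu).
have [K [VK chiK]] := Xtau_coef (proj1 V_sub) hchi.
have LK m k := Vh_L2 XH (VK m k).
(* P_h and A_h^-1 are picked by choice, with no linearity known. They are therefore applied to the
   time coefficients, which makes y and v piecewise polynomial by construction. *)
have /choice[P PP] (g : 'rV[R]_d -> 'rV[R]_d) : exists r, L2O g ->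
    V r /\ forall v, V v -> ip r.1 v.1 = ip g v.1.
  have [Lg|nLg] := pselect (L2O g); last by exists 0.
  by have [r Vr rP'] := Vh_projection mO finX XH ML Lg; exists r.
have /choice[Z ZP] (g : 'rV[R]_d -> 'rV[R]_d) : exists r, L2O g ->
    V r /\ forall v, V v -> ip r.2 v.2 = ip g v.1.
  have [Lg|nLg] := pselect (L2O g); last by exists 0.
  by have [r Vr rP'] := Vh_stokes_inverse mO finX XH ML bO d0 Lg; exists r.
pose Y m k := P (Q m k).
have VY m k : V (Y m k) by case: (PP _ (LQ m k)).
have YQ m k z : V z -> ip (Y m k).1 z.1 = ip (Q m k) z.1.
  by case: (PP _ (LQ m k)) => _; exact.
have LY m k := Vh_L2 XH (VY m k).
pose e m k : sob R d := U m k - Y m k.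
have Le m k : L2O (e m k).1 by exact: (L2mxB mO (LU m k).1 (LY m k).1).
pose W m k := Z (e m k).1.
have VW m k : V (W m k) by case: (ZP _ (Le m k)).
have WP m k z : V z -> ip (W m k).2 z.2 = ip (e m k).1 z.1.
  by case: (ZP _ (Le m k)) => _; exact.
have LW m k := Vh_L2 XH (VW m k).
pose v := piecewise M t W; pose y := piecewise M t Y.
have vE m s (mM : (0 < m <= M)%N) (sm : Im t m s) : v s = tpoly (W m) s.
  exact: piecewiseE.
have yE m s (mM : (0 < m <= M)%N) (sm : Im t m s) : y s = tpoly (Y m) s.
  exact: piecewiseE.
pose eta s := (uh s - y s).1.
have etaE m s (mM : (0 < m <= M)%N) (sm : Im t m s) :
    eta s = tpoly (fun k => (e m k).1) s.
  by rewrite /eta (uhU m s mM sm) (yE m s mM sm) -tpolyB tpoly1.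
have Vv s : itvT T s -> V (v s).
  by move=> /slab_of[m mM sm]; rewrite (vE m s mM sm); exact: subspace_tpoly.
have Vy s : itvT T s -> V (y s).
  by move=> /slab_of[m mM sm]; rewrite (yE m s mM sm); exact: subspace_tpoly.
have Vchi s : itvT T s -> V (chi s).
  by move=> /slab_of[m mM sm]; rewrite (chiK m s mM sm); exact: subspace_tpoly.
have L1 (a : nat -> 'I_w.+1 -> sob R d) g :
    (forall m k, L2O (a m k).1) ->
    (forall m s, (0 < m <= M)%N -> Im t m s -> g s = tpoly (a m) s) ->
    L2mxst (itvT T) Omega (fun s => (g s).1).
  move=> La ga; apply: (@L2mxst_coef _ _ _ (fun m k => (a m k).1)) => //.
  by move=> m s mM sm; rewrite (ga m s mM sm) tpoly1.
have L2 (a : nat -> 'I_w.+1 -> sob R d) g :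
    (forall m k, L2O (a m k).2) ->
    (forall m s, (0 < m <= M)%N -> Im t m s -> g s = tpoly (a m) s) ->
    L2mxst (itvT T) Omega (fun s => (g s).2).
  move=> La ga; apply: (@L2mxst_coef _ _ _ (fun m k => (a m k).2)) => //.
  by move=> m s mM sm; rewrite (ga m s mM sm) tpoly2.
have Luh1 := L1 U uh (fun m k => (LU m k).1) uhU.
have Luh2 := L2 U uh (fun m k => (LU m k).2) uhU.
have Lv1 := L1 W v (fun m k => (LW m k).1) vE.
have Lv2 := L2 W v (fun m k => (LW m k).2) vE.
have Ly1 := L1 Y y (fun m k => (LY m k).1) yE.
have Lchi1 := L1 K chi (fun m k => (LK m k).1) chiK.
have Leta : L2mxst (itvT T) Omega eta.
  exact: (@L2mxst_coef _ _ _ (fun m k => (e m k).1)).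
have Lpiu : L2mxst (itvT T) Omega piu by exact: (@L2mxst_coef _ _ _ Q).
(* (grad r, grad v(s)) = (r, eta(s)) for r in V_h: v(s) is the discrete Stokes
   inverse of eta(s). *)
have pair s r : itvT T s -> V r -> ip r.2 (v s).2 = ip r.1 (eta s).
  move=> /slab_of[m mM sm] Vr; have [Lr1 Lr2] := Vh_L2 XH Vr.
  rewrite (vE m s mM sm) (etaE m s mM sm) tpoly2 ipC [RHS]ipC.
  rewrite (ip_lincombl mO _ (fun k => (LW m k).2) Lr2) (ip_lincombl mO _ (Le m) Lr1).
  by apply: eq_bigr => k _; rewrite WP.
have Vuh := discrete_solution_Vh.
have proj s r : itvT T s -> V r -> ip (y s).1 r.1 = ip (piu s) r.1.
  move=> /slab_of[m mM sm] Vr; have [Lr1 _] := Vh_L2 XH Vr.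
  rewrite (yE m s mM sm) (piuQ m s mM sm) tpoly1.
  rewrite (ip_lincombl mO _ (fun k => (LY m k).1) Lr1) (ip_lincombl mO _ (LQ m) Lr1).
  by apply: eq_bigr => k _; rewrite YQ.
have form_ge0 : 0 <= time_form t Omega M (fun m k => (e m k).1) (fun m k => (W m k).1).
  apply: (time_form_ge0 t_incr mO Le (fun m k => (LW m k).1) (fun m k => (LW m k).2)) => //.
  by move=> m k m' l; rewrite WP.
have formB : time_form t Omega M (fun m k => (e m k).1) (fun m k => (W m k).1) =
    time_form t Omega M (fun m k => (U m k).1) (fun m k => (W m k).1) -
    time_form t Omega M (fun m k => (Y m k).1) (fun m k => (W m k).1).
  exact: (time_formB t mO M (fun m k => (LU m k).1) (fun m k => (LY m k).1) (fun m k => (LW m k).1)).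
have Xv : Xtau w M t Xh v.
  by move=> m mM; exists (W m); split=> [k|s sm]; [case: (VW m k)|exact: vE].
have Xq0 : Xtau w M t Mh (fun=> 0).
  move=> m mM; exists (fun=> 0); split=> [k|s _]; first exact: (proj1 (fin_dim_subspace_of finM)).
  by rewrite big1// => k _; rewrite scaler0.
have zero_st (g : R -> 'rV[R]_d -> R) : sinner_st (itvT T) Omega g (fun=> 0) = 0.
  rewrite /sinner_st (@eq_Rintegral _ _ _ _ _ (fun=> 0)) ?Rintegral_cst ?mul0r//.
  move=> s _; rewrite /sinner (@eq_Rintegral _ _ _ _ _ (fun=> 0)) ?Rintegral_cst ?mul0r//.
  by move=> x _; rewrite mulr0.
have eq1 := eqh v _ Xv Xq0.
rewrite (Bform_eval mO t_incr M0 (fun m k => (LU m k).1) (fun m k => (LW m k).1) uhU vE) in eq1.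
rewrite zero_st (inner_lim_right0 mO t_incr M0 (fun m k => (LW m k).1) vE Lu0) in eq1.
(* The discrete pressure is invisible to v(s) in V_h. *)
have ph0 : sinner_st (itvT T) Omega ph (fun s => div (v s)) = 0.
  rewrite /sinner_st (@eq_Rintegral _ _ _ _ _ (fun=> 0)) ?Rintegral_cst ?mul0r//.
  move=> s /set_mem sT; rewrite sinnerC; have [_ divv] := Vv s sT; apply: divv.
  have [m mM sm] := slab_of sT; have [a [Ma pha]] := Mph m mM.
  by rewrite (pha s sm); exact: (subspace_tpoly s (fin_dim_subspace_of finM) Ma).
rewrite ph0 in eq1.
have Lv : L2sob (itvT T) Omega (H10 Omega) v.
  by split=> //; apply: aeW => s sT; apply: XH; case: (Vv s sT).
have L0 : L2L20 (itvT T) Omega (fun=> 0).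
  split; first exact: L2_0.
  apply: aeW => s _; split; first exact: L2_0.
  by rewrite Rintegral_cst// mul0r.
have eq2 := eqw v _ Lv L0; rewrite zero_st addr0 -addrA in eq2.
rewrite (stokes_projection_pairing Lv2 Leta Vv pair) in eq2.
have eq3 := inner_st_dt_continuous mO t_incr M0 t0 tM cu Lut uut Lu0 uu0 hpiu LQ
  (fun m k => (LY m k).1) (fun m k => (LW m k).1) VW piuQ YQ vE.
rewrite eq3 t0 in eq1 eq2.
(* [pair] applies with r = u_h(s), which lies in V_h for almost every s. *)
have eq4 : inner_st (itvT T) Omega (fun s => (uh s).2) (fun s => (v s).2) =
    inner_st (itvT T) Omega (fun s => (uh s).1) eta.
  by apply: inner_st_ae => //; apply: (@filterS _ _ ae_filter _ _ _ Vuh) => s /[swap] sT /(_ sT); exact: pair.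
have eq5 : inner_st (itvT T) Omega (fun s => (y s).1) eta = inner_st (itvT T) Omega piu eta.
  apply: inner_st_ae => //; apply: (@filterS _ _ ae_filter _ _ _ Vuh) => s /[swap] sT /(_ sT) Vus.
  apply: (proj s (uh s - y s)) => //.
  rewrite addrC -scaleN1r; apply: (proj2 V_sub) => //; exact: Vy.
pose ip_st := @L2inner _ _ _ lebesgue_st (itvT T `*` Omega) 1 d.
have ipE (g g' : R -> 'rV[R]_d -> 'rV[R]_d) (Lg : L2mxst (itvT T) Omega g)
    (Lg' : L2mxst (itvT T) Omega g') := proj2 (L2mxst_ip mI mO Lg Lg').
exists y; split; first exact: Ly1.
- apply: (@L2norm_le_of_ip _ _ _ lebesgue_st _ mIO _ _ (fun z => eta z.1 z.2)
    (fun z => (rS z.1).1 z.2 - piu z.1 z.2)).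
  + exact: Leta.
  + exact: (L2mxB mIO LrS Lpiu).
  have E1 : ip_st (fun z => eta z.1 z.2) (fun z => eta z.1 z.2) =
      inner_st (itvT T) Omega (fun s => (uh s).1) eta -
      inner_st (itvT T) Omega (fun s => (y s).1) eta.
    by rewrite (ipE _ _ Luh1 Leta) (ipE _ _ Ly1 Leta); exact: (ipBl mIO Luh1 Ly1 Leta).
  have E2 : ip_st (fun z => (rS z.1).1 z.2 - piu z.1 z.2) (fun z => eta z.1 z.2) =
      inner_st (itvT T) Omega (fun s => (rS s).1) eta - inner_st (itvT T) Omega piu eta.
    by rewrite (ipE _ _ LrS Leta) (ipE _ _ Lpiu Leta); exact: (ipBl mIO LrS Lpiu Leta).
  (* As (y, e) = (pi_tau u, e), the claim is reduced to (u_h, e) <= (R_h^S(u, p), e). *)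
  rewrite [leLHS]E1 [leRHS]E2 eq5 lerB//; move: form_ge0; rewrite formB.
  rewrite eq4 in eq1; exact: gen eq1 eq2.
- apply: (@L2norm_le_of_ip _ _ _ lebesgue_st _ mIO _ _ (fun z => (chi z.1).1 z.2 - (y z.1).1 z.2)
    (fun z => (chi z.1).1 z.2 - piu z.1 z.2)).
  + exact: (L2mxB mIO Lchi1 Ly1).
  + exact: (L2mxB mIO Lchi1 Lpiu).
  pose g s := (chi s - y s).1.
  have Lg : L2mxst (itvT T) Omega g by exact: (L2mxB mIO Lchi1 Ly1).
  have E1 : ip_st (fun z => g z.1 z.2) (fun z => g z.1 z.2) =
      inner_st (itvT T) Omega (fun s => (chi s).1) g -
      inner_st (itvT T) Omega (fun s => (y s).1) g.
    by rewrite (ipE _ _ Lchi1 Lg) (ipE _ _ Ly1 Lg); exact: (ipBl mIO Lchi1 Ly1 Lg).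
  have E2 : ip_st (fun z => (chi z.1).1 z.2 - piu z.1 z.2) (fun z => g z.1 z.2) =
      inner_st (itvT T) Omega (fun s => (chi s).1) g - inner_st (itvT T) Omega piu g.
    by rewrite (ipE _ _ Lchi1 Lg) (ipE _ _ Lpiu Lg); exact: (ipBl mIO Lchi1 Lpiu Lg).
  (* chi - y takes values in V_h, so that |chi - y|^2 = (chi - pi_tau u, chi - y). *)
  have E3 : inner_st (itvT T) Omega (fun s => (y s).1) g = inner_st (itvT T) Omega piu g.
    apply: inner_st_ae => //; apply: aeW => s sT; apply: (proj s (chi s - y s)) => //.
    by rewrite addrC -scaleN1r; apply: (proj2 V_sub); [exact: Vy|exact: Vchi].
  by rewrite [leLHS]E1 [leRHS]E2 E3.
Qed.

End error_estimate.

Unset Implicit Arguments.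
Set Strict Implicit.
Set Printing Implicit Defensive.

Theorem theorem6p1 (R : realType) (d : nat) (hd : d = 2%N \/ d = 3%N)
    (Omega : set 'rV[R]_d) (hOmega : polyhedral_lipschitz_domain Omega)
    (T : R) (hT : 0 < T) (w : nat)
    (beta c gamma kappa : R) (hbeta : 0 < beta)
    (hc : 0 < c) (hgamma : 0 < gamma) (hkappa : 0 < kappa) :
  exists C : R, 0 < C /\
  forall (h : R) (Th : seq 'M[R]_(d.+1, d)) (hTh : triangulation Omega Th h)
    (Xh : set (sob R d)) (Mh : set ('rV[R]_d -> R))
    (hXM : stokes_pair Omega beta Xh Mh)
    (M : nat) (t : nat -> R) (ht : time_partition T c gamma kappa M t)
    (f : R -> 'rV[R]_d -> 'rV[R]_d) (hf : L2mxst (itvT T) Omega f)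
    (u0 : sob R d) (hu0 : V1 Omega u0)
    (u : R -> sob R d) (ut : R -> 'rV[R]_d -> 'rV[R]_d) (p : R -> 'rV[R]_d -> R)
    (hup : weak_solution Omega T f u0 u ut p)
    (uh : R -> sob R d) (ph : R -> 'rV[R]_d -> R)
    (huph : discrete_solution Omega T w M t Xh Mh f u0 uh ph)
    (piu : R -> 'rV[R]_d -> 'rV[R]_d)
    (hpiu : is_pi_tau Omega w M t (fun s => (u s).1) piu)
    (rS : R -> sob R d) (rP : R -> 'rV[R]_d -> R)
    (hRS : is_stokes_projection_st Omega T Xh Mh u p rS rP)
    (chi : R -> sob R d) (hchi : Xtau w M t (Vh Omega Xh Mh) chi),
  (normL2_st (itvT T) Omega (fun s => ((u s).1 - (uh s).1)%R) <=
   C%:E * (normL2_st (itvT T) Omega (fun s => ((u s).1 - (chi s).1)%R)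
           + normL2_st (itvT T) Omega (fun s => ((u s).1 - piu s)%R)
           + normL2_st (itvT T) Omega (fun s => ((u s).1 - (rS s).1)%R)))%E.
Proof.
(* Each name lists the two functions whose distance it denotes. The factor 2 arises because u - chi
   enters directly and through chi - pi_tau u, and u - pi_tau u enters through chi - pi_tau u and
   R_h^S(u, p) - pi_tau u. *)
have gen (uuh uchi chiuh chiy yuh chipi chiu upi rpi ru : R) :
    uuh <= uchi + chiuh -> chiuh <= chiy + yuh -> chiy <= chipi ->
    chipi <= chiu + upi -> yuh <= rpi -> rpi <= ru + upi -> chiu = uchi -> 0 <= ru ->
    uuh <= 2 * (uchi + upi + ru) by lra.
have d0 : (0 < d)%N by case: hd => ->.
have [[oO _ _ bO] _] := hOmega; have mO := open_measurable_rV oO.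
exists 2; split=> // h Th _ Xh Mh [finX finM XH ML _] M t [[M0 t0 tM t_incr] _] f _
  u0 [/H10_L2[Lu0 _] _] u ut p hup uh ph huph piu hpiu rS rP hRS chi hchi.
have mI : measurable (itvT T : set (measurableTypeR R)) by exact: measurable_itv.
have mIO : measurable (itvT T `*` Omega : set (measurableTypeR R * 'rV[R]_d)).
  exact: measurableX.
have [[Lu _ _] _ _ _ _] := hup.
have norm_ge0 (v : R -> 'rV[R]_d -> 'rV[R]_d) : (0 <= normL2_st (itvT T) Omega v)%E.
  exact: poweR_ge0.
(* If this norm is infinite the right-hand side is +oo; otherwise R_h^S(u, p) is square integrable
   as the difference of u and u - R_h^S(u, p). *)
have [noo|foo] := eqVneq (normL2_st (itvT T) Omega (fun s => (u s).1 - (rS s).1)) +oo%E.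
  by rewrite noo addey ?gt_eqF ?(lt_le_trans (ltNyr 0)) ?adde_ge0// gt0_muley ?leey.
have Ldiff : L2mxst (itvT T) Omega (fun s => (u s).1 - (rS s).1).
  apply: normL2_st_lty => //; last by rewrite ltey.
  move=> i j; rewrite [i]ord1; under eq_fun do rewrite !mxE.
  by apply: measurable_funB; [case: (Lu 0 j)|exact: hRS.1].
have LrS : L2mxst (itvT T) Omega (fun s => (rS s).1).
  apply: (eq_L2mx mIO _ (L2mxB mIO Lu Ldiff)) => z _ /=.
  by rewrite opprB addrC subrK.
have X_sub := fin_dim_subspace_of finX.
have Luh : L2mxst (itvT T) Omega (fun s => (uh s).1).
  by case: huph => Xuh _ _; apply: (Xtau_sob_L2mxst mO t_incr M0 t0 tM X_sub.1 _ Xuh) => v /XH/H10_L2[].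
have Lchi : L2mxst (itvT T) Omega (fun s => (chi s).1).
  apply: (Xtau_sob_L2mxst mO t_incr M0 t0 tM _ _ hchi) => [|v [/XH/H10_L2[] //]].
  exact: (Vh_subspace mO finX XH ML).1.
have Lpiu : L2mxst (itvT T) Omega piu.
  by apply: (Xtau_L2mxst mO t_incr M0 t0 tM _ _ hpiu.1); first exact: L2mx0.
have [y [Ly uh_y chi_y]] := discrete_error mO bO d0 finX finM XH ML t_incr M0 t0 tM
  Lu0 hup huph hpiu hRS hchi LrS.
have E (v : R -> 'rV[R]_d -> 'rV[R]_d) : L2mxst (itvT T) Omega v ->
    normL2_st (itvT T) Omega (fun s => (u s).1 - v s) =
    (L2norm lebesgue_st (itvT T `*` Omega) ((fun z => (u z.1).1 z.2) \- (fun z => v z.1 z.2)))%:E.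
  by move=> Lv; apply: normL2_stE => //; exact: (L2mxB mIO Lu Lv).
rewrite [leLHS](E _ Luh) (E _ Lchi) (E _ Lpiu) (E _ LrS) -!EFinD -EFinM lee_fin.
have tri := @L2norm_triangle _ _ _ lebesgue_st _ mIO 1 d.
have symm := @L2normB _ _ _ lebesgue_st (itvT T `*` Omega) 1 d.
have r_ge0 := @L2norm_ge0 _ _ _ lebesgue_st (itvT T `*` Omega) 1 d.
rewrite symm in uh_y.
have := tri _ _ _ LrS Lpiu Lu; rewrite [X in _ <= X + _ -> _]symm => rpi.
exact: (gen _ _ _ _ _ _ _ _ _ _ (tri _ _ _ Lu Luh Lchi) (tri _ _ _ Lchi Luh Ly) chi_y
  (tri _ _ _ Lchi Lpiu Lu) uh_y rpi (symm _ _) (r_ge0 _)).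
Qed.
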